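(* Let $\mu\in\mathbb{R}$ with $\mu<\frac12$, and let $f$ be a complex-valued function on $\mathbb{R}_+=(0,\infty)$ which is represented by the integral $$f(x)=\Gamma(2(1-\mu))\,(2x)^{1-\mu}\int_{-\pi}^{\pi} e^{x\cosh^2(u)/2}\,D_{2(\mu-1)}\left(\sqrt{2x}\,\cosh(u)\right)\varphi(u)\,du,\qquad x>0,$$ where $\varphi(u)=\psi(u)\sinh(u)$ and $\psi$ is a $2\pi$-periodic function satisfying the Lipschitz condition on $[-\pi,\pi]$, i.e. there is an absolute constant $C>0$ such that $$|\psi(u)-\psi(v)|\le C|u-v|\qquad\text{for all } u,v\in[-\pi,\pi].$$ Let $$a_n=\int_0^\infty e^{-x/2}\,W_{\mu,\frac{in}{2}}(x)\,f(x)\,x^{\mu-2}\,dx,\qquad n\in\mathbb{N},\ n\ge 1 .$$ Then the following inversion formula holds for every $x>0$: $$f(x)=\frac{(x/2)^{1-\mu}}{\pi^2}\,\Gamma(2(1-\mu))\sum_{n=1}^\infty \sinh(\pi n)\,\Psi^\mu_n(x)\,a_n,$$ where $$\Psi^\mu_n(x)=\int_{-\pi}^{\pi} e^{x\cosh^2(u)/2}\,D_{2(\mu-1)}\left(\sqrt{2x}\,\cosh(u)\right)\sinh(u)\sin(nu)\,du .$$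
   Context: Here $i$ is the imaginary unit and $\Gamma$ is the Euler gamma function. $W_{\mu,\nu}(x)$, $x>0$, denotes the Whittaker function, i.e. the standard solution of Whittaker's equation $w''+\left(-\frac14+\frac{\mu}{x}+\frac{1/4-\nu^2}{x^2}\right)w=0$ with $W_{\mu,\nu}(x)\sim e^{-x/2}x^{\mu}$ as $x\to+\infty$. $D_\nu(z)$ denotes the parabolic cylinder function; for ${\rm Re}\,\alpha>0$, ${\rm Re}\,p>0$, $q\in\mathbb{C}$ it satisfies (and, for indices of negative real part, is defined by) $$\int_0^\infty x^{\alpha-1}e^{-px^2-qx}\,dx=\frac{\Gamma(\alpha)}{(2p)^{\alpha/2}}\,e^{q^2/(8p)}\,D_{-\alpha}\left(\frac{q}{\sqrt{2p}}\right).$$ The function $\psi$ is complex-valued and defined on $\mathbb{R}$. The infinite series is understood as the limit of its partial sums $\sum_{n=1}^N$ as $N\to\infty$. *)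

(* Defs.v *)
From HB Require Import structures.
From mathcomp Require Import all_boot all_order all_algebra.
From mathcomp Require Import complex.
From mathcomp Require Import all_classical all_reals all_analysis.

Set Implicit Arguments.
Unset Strict Implicit.
Unset Printing Implicit Defensive.

Import Order.TTheory GRing.Theory Num.Theory.
Import numFieldNormedType.Exports.

Local Open Scope classical_set_scope.
Local Open Scope ring_scope.
Local Open Scope complex_scope.

Definition cosh (R : realType) (x : R) : R := (expR x + expR (- x)) / 2.

Definition sinh (R : realType) (x : R) : R := (expR x - expR (- x)) / 2.

(* Lebesgue integral of a complex-valued function. As for [Rintegral], the
   value is only meaningful when the real and imaginary parts of [g] are
   integrable on [D]. *)
Definition Cintegral (R : realType) (D : set R) (g : R -> R[i]) : R[i] :=
  (\int[@lebesgue_measure R]_(x in D) complex.Re (g x)) +i*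
  (\int[@lebesgue_measure R]_(x in D) complex.Im (g x)).

(* [R[i]] carries no normed-module structure over [R] in the library, so the
   derivative of a function of a real variable with values in [R[i]] is taken
   componentwise. *)
Definition cderivable1 (R : realType) (w : R -> R[i]) (x : R) : Prop :=
  derivable (fun t => complex.Re (w t)) x 1 /\
  derivable (fun t => complex.Im (w t)) x 1.

Definition cderive1 (R : realType) (w : R -> R[i]) (x : R) : R[i] :=
  derive1 (fun t => complex.Re (w t)) x +i*
  derive1 (fun t => complex.Im (w t)) x.

(* Euler's integral; meaningful for [0 < a]. *)
Definition Gamma (R : realType) (a : R) : R :=
  \int[@lebesgue_measure R]_(t in `]0, +oo[) (t `^ (a - 1) * expR (- t)).

(* Parabolic cylinder function of negative order [nu] and real argument [z]:
     int_0^oo t^(a-1) e^(-p t^2 - q t) dt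
       = Gamma(a) (2p)^(-a/2) e^(q^2/(8p)) D_(-a)(q / sqrt(2p)),
   solved for D_(-a) with a = - nu, p = 1/2, q = z; all other p > 0 reduce to
   this case by rescaling t. The value is meaningless for [0 <= nu]. *)
Definition parcylD (R : realType) (nu z : R) : R :=
  expR (- (z ^+ 2 / 4)) / Gamma (- nu) *
  \int[@lebesgue_measure R]_(t in `]0, +oo[)
     (t `^ (- nu - 1) * expR (- (t ^+ 2 / 2) - z * t)).

(* Whittaker's equation
     w'' + (-1/4 + mu/x + (1/4 - nu^2)/x^2) w = 0  on (0, +oo)
   together with the normalisation w(x) ~ e^(-x/2) x^mu as x -> +oo. *)
Definition is_whittakerW (R : realType) (mu : R) (nu : R[i])
    (w : R -> R[i]) : Prop :=
  (forall x : R, 0 < x ->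
     [/\ cderivable1 w x, cderivable1 (cderive1 w) x &
         cderive1 (cderive1 w) x +
         (- (1 / 4) + mu%:C / x%:C + (1 / 4 - nu ^+ 2) / x%:C ^+ 2) * w x
         = 0]) /\
  (w x / (expR (- (x / 2)) * x `^ mu)%:C) @[x --> +oo] --> (1 : R[i]^o).

(* The recessive solution of Whittaker's equation is unique on (0, +oo), so
   the choice below only matters for [x <= 0]. *)
Definition whittakerW (R : realType) (mu : R) (nu : R[i]) : R -> R[i] :=
  xget (fun=> 0) [set w | is_whittakerW mu nu w].

Definition Psi (R : realType) (mu : R) (n : nat) (x : R) : R :=
  \int[@lebesgue_measure R]_(u in `[- pi, pi])
     (expR (x * cosh u ^+ 2 / 2) *
      parcylD (2 * (mu - 1)) (Num.sqrt (2 * x) * cosh u) *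
      sinh u * sin (n%:R * u)).

(* Main.v *)
Require Import Defs.
From HB Require Import structures.
From mathcomp Require Import all_boot all_order all_algebra.
From mathcomp Require Import complex.
From mathcomp Require Import all_classical all_reals all_analysis.
From mathcomp Require Import ring lra measurable_realfun gauss_integral.

Set Implicit Arguments.
Unset Strict Implicit.
Unset Printing Implicit Defensive.

Import Order.TTheory GRing.Theory Num.Theory.
Import numFieldNormedType.Exports.

Local Open Scope classical_set_scope.
Local Open Scope ring_scope.

(* Write c = 1 - mu. The function x^(3/2-mu) e^(x/2) V(x), with V(x) the integral
   over v, w > 0 of cos(n v) w^(-2 mu) B e^(-x B^2), B = cosh v + w, solves
   Whittaker's equation with nu = i n / 2 (the operator turns the kernel into a
   divergence), and Laplace's method gives its behaviour at infinity; by
   uniqueness of the recessive solution it is a multiple of W. The parabolic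
   cylinder function is itself an integral over t > 0, and integrating the product
   of the two kernels over x (Cauchy-Schloemilch), then over w and t (Gamma
   integrals), leaves a constant times 1 / (cosh u + cosh v). Together with
     int_0^oo cos(n v) sinh u / (cosh u + cosh v) dv = pi sin(n u) / sinh(pi n)
   Fubini's theorem gives sinh(pi n) a_n = 2^(2c) pi int psi(u) sin(n u) du: the
   series is the sine part of the Fourier series of psi, integrated against the odd
   kernel of f. The partial Fourier sums of the Lipschitz function psi converge
   pointwise and are uniformly bounded, so dominated convergence concludes. *)

(** The prefactor of the Whittaker integral fits the weight of [a_n]: x^(3/2-mu) e^(x/2) times
    e^(-x/2) x^(mu-2) is x^(-1/2), the power for which the Cauchy-Schloemilch integral is
    elementary. The change of scale in Laplace's method is done for nonnegative integrands, so cos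
    (n v) is split as (1 + cos (n v)) - 1. The integral of cos (n v) sinh u / (cosh u + cosh v) is
    found without contours: parts give sin (n u) times a constant free of u, an exponential series
    turns that constant into an alternating series in 1 / (n^2 + k^2), and the Fourier series of
    cosh (n v) at 0 sums it. The theorem on Fourier sums thus serves twice. Its proof divides psi u
    - psi v by sin ((u - v) / 2). Periodicity keeps the quotient bounded also for u and v near
    opposite ends, and this bound gives both the uniform bound on the partial sums and, through
    Bessel's inequality, their convergence. A partial sum of the series is exactly the integral of
    the kernel against the odd part of a Fourier sum, so only finite sums are exchanged with
    integrals. *)

(* A copy of [is_derive _ 1 _ _] that is not a type class, so that derivatives can
   be computed with existential variables. *)
Definition hasder (R : realType) (x : R) (f : R -> R) (a : R) : Prop :=
  is_derive x 1 f a.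

(** * Integration on the half-line *)

Lemma dominated_cvgE d (T : measurableType d) (R : realType)
    (mu : {measure set T -> \bar R}) (D : set T) (f_ : nat -> T -> R) (f g : T -> R) :
  measurable D -> (forall n, measurable_fun D (f_ n)) ->
  (forall x, D x -> f_ n x @[n --> \oo] --> f x) ->
  mu.-integrable D (EFin \o g) ->
  (forall n x, D x -> `|f_ n x| <= g x) ->
  (\int[mu]_(x in D) (f_ n x)%:E)%E @[n --> \oo] --> (\int[mu]_(x in D) (f x)%:E)%E.
Proof.
move=> mD mf_ f_f ig f_g.
have mf : measurable_fun D f by apply: measurable_fun_cvg f_f.
have [] // := @dominated_convergence _ _ R mu D mD (fun n => EFin \o f_ n) (EFin \o f) (EFin \o g).
- by move=> n; exact/measurable_EFinP.
- exact/measurable_EFinP.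
- by apply/aeW => x Dx; apply: cvg_EFin; [exact: nearW|exact: f_f].
- by apply/aeW => x n Dx; rewrite /= lee_fin f_g.
Qed.

Section tools.
Variable R : realType.
Implicit Types (f F G : R -> R).
Local Notation leb := (@lebesgue_measure R).
Local Notation hl := (`]0%R, +oo[%classic : set R).

(** The inverse is expressed through the power function, measurable for every exponent: the square
    makes the base nonnegative and the leading factor restores the sign. At 0 both sides are 0 by
    convention. *)
Lemma measurable_inv : measurable_fun [set: R] (fun x : R => x^-1).
Proof.
rewrite (_ : (fun x : R => x^-1) = (fun x => x * (x ^+ 2) `^ (- 1))).
  apply: measurable_funM => //.
  apply: (measurableT_comp (measurable_powR (- 1))).
  exact: exprn_measurable.
apply/funext => x.
have [->|x0] := eqVneq x 0; first by rewrite invr0 mul0r.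
rewrite powR_inv1 ?sqr_ge0// expr2 invfM mulrA mulfV// mul1r//.
Qed.

(** A compact exhaustion of the open half-line, so that the fundamental theorem of calculus is only
    used away from 0 and infinity. *)
Definition expand_itv (n : nat) : set R := `[n.+1%:R^-1, n.+1%:R].

Lemma bigcup_expand_itv : \bigcup_n expand_itv n = hl.
Proof.
apply/seteqP; split => x /=.
  move=> [n _]; rewrite /expand_itv/= !in_itv/= andbT => /andP[nx _].
  by rewrite (lt_le_trans _ nx).
rewrite in_itv/= andbT => x0.
have [n nx] : exists n : nat, Num.max x x^-1 <= n.+1%:R.
  exists (Num.truncn (Num.max x x^-1)).
  by rewrite ltW// truncnS_gt.
exists n => //; rewrite /expand_itv/= in_itv/=.
move: nx; rewrite ge_max => /andP[-> nx]; rewrite andbT.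
by rewrite -[leRHS]invrK lef_pV2 ?posrE ?invr_gt0.
Qed.

Lemma expand_itv_ndecr : {homo expand_itv : n m / (n <= m)%N >-> (n <= m)%O}.
Proof.
move=> n m nm; apply/subsetPset => x; rewrite /expand_itv/= !in_itv/= => /andP[a b].
rewrite (le_trans b) ?ler_nat// andbT (le_trans _ a)//.
by rewrite lef_pV2 ?posrE// ler_nat.
Qed.

Lemma sub_expand_itv n : expand_itv n `<=` hl.
Proof. by rewrite -bigcup_expand_itv; exact: bigcup_sup. Qed.

Lemma FTC_segment0y F f (a b : R) : 0 < a -> a < b ->
  (forall x : R, 0 < x -> hasder x F (f x)) ->
  (forall x : R, 0 < x -> {for x, continuous f}) ->
  (\int[leb]_(x in `[a, b]) (f x)%:E = (F b - F a)%:E)%E.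
Proof.
move=> a0 ab dF cf; rewrite EFinB.
have dF' x : a <= x -> derivable F x 1.
  by move=> ax; have [] := dF x (lt_le_trans a0 ax).
have cF x : a <= x -> {for x, continuous F}.
  move=> ax; apply: differentiable_continuous; apply/derivable1_diffP.
  exact: dF'.
apply: continuous_FTC2 => //.
- apply/continuous_within_itvP => //; split.
  + by move=> x; rewrite in_itv/= => /andP[ax _]; apply: cf; rewrite (lt_trans a0).
  + by apply: cvg_at_right_filter; apply: cf.
  + by apply: cvg_at_left_filter; apply: cf; rewrite (lt_trans a0).
- split.
  + by move=> x; rewrite in_itv/= => /andP[ax _]; exact/dF'/ltW.
  + by apply: cvg_at_right_filter; apply: cF.
  + by apply: cvg_at_left_filter; apply: cF; exact: ltW.
- move=> x; rewrite in_itv/= => /andP[ax _].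
  by have [_ <-] := dF x (lt_trans a0 ax); rewrite derive1E.
Qed.

Lemma cvg_expand_itv F (l0 l1 : R) :
  F x @[x --> 0^'+] --> l0 -> F x @[x --> +oo] --> l1 ->
  (F n.+1%:R - F n.+1%:R^-1) @[n --> \oo] --> l1 - l0.
Proof.
move=> F0 F1; apply: cvgB.
  move/cvg_pinftyP : F1; apply.
  by rewrite (cvg_shiftS (fun n => n%:R : R)); exact: cvgr_idn.
move/cvg_at_rightP : F0; apply; split; first by move=> n; rewrite invr_gt0.
by apply: cvg_harmonic.
Qed.

(** Monotone convergence along the exhaustion. Integrability is not assumed for a nonnegative
    integrand: the finite value found here is what later proves it, through [integrable_ge0]. *)
Lemma FTC0y_ge0 F f (l0 l1 : R) :
  (forall x : R, 0 < x -> hasder x F (f x)) ->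
  (forall x : R, 0 < x -> {for x, continuous f}) ->
  F x @[x --> 0^'+] --> l0 -> F x @[x --> +oo] --> l1 ->
  (forall x : R, 0 < x -> 0 <= f x) ->
  (\int[leb]_(x in hl) (f x)%:E = (l1 - l0)%:E)%E.
Proof.
move=> dF cf F0 F1 f0.
have mf : measurable_fun hl f.
  by apply: open_continuous_measurable_fun => // x; rewrite inE/= in_itv/= andbT; exact: cf.
have := @ge0_nondecreasing_set_cvg_integral _ (measurableTypeR R) R expand_itv (EFin \o f) leb expand_itv_ndecr.
rewrite bigcup_expand_itv.
have H1 : forall i, measurable (expand_itv i) by move=> i; exact: measurable_itv.
have H2 : forall i, measurable_fun (expand_itv i) (EFin \o f).
  move=> i; apply/measurable_EFinP; apply: measurable_funS mf => //.
  exact: sub_expand_itv.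
have H3 : forall i x, expand_itv i x -> (0 <= (EFin \o f) x)%E.
  by move=> i x /sub_expand_itv/=; rewrite in_itv/= andbT lee_fin => /f0.
move=> /(_ H1 H2 H3) H4.
have H5 : (\int[leb]_(x in expand_itv n) (f x)%:E)%E @[n --> \oo] --> (l1 - l0)%:E.
  apply: (@cvg_trans _ ((F n.+1%:R - F n.+1%:R^-1)%:E @[n --> \oo])).
    apply: near_eq_cvg; near=> n.
    rewrite /expand_itv (FTC_segment0y _ _ dF cf)// ?invr_gt0//.
    have n1 : (1 < n.+1%:R :> R) by rewrite ltr1n ltnS; near: n; exact: nbhs_infty_gt.
    by rewrite (lt_trans _ n1)// invf_lt1.
  by apply: cvg_EFin; [exact: nearW|exact: cvg_expand_itv].
exact: (cvg_unique _ H4 H5).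
Unshelve. all: by end_near. Qed.

(** The signed version: dominated convergence of the truncations to the exhausting intervals, with
    |f| as majorant. *)
Lemma FTC0y F f (l0 l1 : R) :
  (forall x : R, 0 < x -> hasder x F (f x)) ->
  (forall x : R, 0 < x -> {for x, continuous f}) ->
  F x @[x --> 0^'+] --> l0 -> F x @[x --> +oo] --> l1 ->
  leb.-integrable hl (EFin \o f) ->
  (\int[leb]_(x in hl) (f x)%:E = (l1 - l0)%:E)%E.
Proof.
move=> dF cf F0 F1 fi.
have mf : measurable_fun hl f.
  by apply: open_continuous_measurable_fun => // x; rewrite inE/= in_itv/= andbT; exact: cf.
have := @dominated_cvgE _ (measurableTypeR R) R leb hl (fun n => f \_ (expand_itv n)) f (fun x => `|f x|).
have H1 : forall n, measurable_fun hl (f \_ (expand_itv n)).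
  move=> n; apply: measurable_funS (@measurableT _ _) _ _ => //.
  apply/(measurable_restrictT _ _).1 => //; first exact: measurable_itv.
  by apply: measurable_funS mf => //; exact: sub_expand_itv.
have H2 : forall x, hl x -> (f \_ (expand_itv n)) x @[n --> \oo] --> f x.
  move=> x; rewrite -bigcup_expand_itv => -[m _ mx]; apply: cvg_near_cst.
  near=> n; rewrite patchE ifT// inE.
  have /expand_itv_ndecr/subsetPset : (m <= n)%N by near: n; exact: nbhs_infty_ge.
  exact.
have H3 : forall n x, hl x -> `|(f \_ (expand_itv n)) x| <= (fun x => `|f x|) x.
  by move=> n x _; rewrite patchE; case: ifPn => //; rewrite normr0.
move=> /(_ (measurable_itv _) H1 H2) /(_ (integrable_abse fi) H3) H4.
have H5 : (\int[leb]_(x in hl) ((f \_ (expand_itv n)) x)%:E)%E @[n --> \oo] --> (l1 - l0)%:E.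
  apply: (@cvg_trans _ ((F n.+1%:R - F n.+1%:R^-1)%:E @[n --> \oo])).
    apply: near_eq_cvg; near=> n.
    have n1 : (1 < n.+1%:R :> R) by rewrite ltr1n ltnS; near: n; exact: nbhs_infty_gt.
    rewrite -(FTC_segment0y _ _ dF cf)// ?invr_gt0// ?(lt_trans _ n1)// ?invf_lt1//.
    rewrite -/(expand_itv n) -[in LHS](setIidr (@sub_expand_itv n)).
    by rewrite integral_mkcondr; apply: eq_integral => x _; rewrite restrict_EFin.
  by apply: cvg_EFin; [exact: nearW|exact: cvg_expand_itv].
exact: (cvg_unique _ H4 H5).
Unshelve. all: by end_near. Qed.
End tools.

(** Lebesgue measure is l times its image under multiplication by l, since the two agree on
    intervals; the rule is then the transfer of nonnegative integrals to an image measure. *)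
Lemma integral_scale (R : realType) (l : R) (f : R -> \bar R) : 0 < l ->
  measurable_fun (`]0%R, +oo[%classic : set R) f -> (forall r : R, 0 < r -> (0 <= f r)%E) ->
  (\int[@lebesgue_measure R]_(r in `]0%R, +oo[) f r =
   l%:E * \int[@lebesgue_measure R]_(r in `]0%R, +oo[) f (l * r)%R)%E.
Proof.
move=> l0 mf f0.
pose phi (r : measurableTypeR R) : measurableTypeR R := l * r.
have mphi : measurable_fun [set: measurableTypeR R] phi by exact: mulrl_measurable.
have H (A : set R) : measurable A -> lebesgue_measure A =
    mscale (NngNum (ltW l0)) (pushforward lebesgue_measure phi) A.
  move=> mA; apply: lebesgue_measure_unique => //= _ [[a b]] _ <-.
  rewrite /mscale/= /pushforward.
  rewrite (_ : phi @^-1` _ = `]a / l, b / l]%classic); last first.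
    apply/seteqP; split => x /=; rewrite !in_itv/= /phi ltr_pdivrMr// ler_pdivlMr// mulrC//.
  rewrite !lebesgue_measure_itv/= !lte_fin ltr_pM2r ?invr_gt0//.
  by case: ifP => _; rewrite ?mule0// -EFinB -EFinM -mulrBl mulrCA mulfV ?gt_eqF// mulr1.
rewrite (_ : (fun r => f (l * r)) = f \o phi)//.
rewrite [X in (_ = _ * integral _ X _)%E](_ : _ = phi @^-1` `]0, +oo[%classic); last first.
  by apply/seteqP; split => x /=; rewrite !in_itv/= !andbT /phi pmulr_rgt0.
rewrite -(ge0_integral_pushforward mphi)//=; last first.
  by move=> y; rewrite inE/= in_itv/= andbT; exact: f0.
rewrite -[l%:E]/((NngNum (ltW l0))%:num%:E) -ge0_integral_mscale//; last first.
  by move=> y; rewrite /= in_itv/= andbT; exact: f0.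
by apply: eq_measure_integral => A mA _; exact: H.
Qed.

(** * Tonelli and Fubini on product sets *)

Section rectangle.
Local Open Scope ereal_scope.
Context d1 d2 (T1 : measurableType d1) (T2 : measurableType d2) (R : realType).
Variables (m1 : {sigma_finite_measure set T1 -> \bar R})
  (m2 : {sigma_finite_measure set T2 -> \bar R}).
Variables (D1 : set T1) (D2 : set T2) (mD1 : measurable D1) (mD2 : measurable D2).
Variable f : T1 * T2 -> \bar R.

(** Integrating out one variable commutes with extension by zero; this reduces each statement on a
    rectangle to the one on the full product. *)
Let restrict_iter1 :
  (fun x => \int[m2]_y (f \_ (D1 `*` D2)) (x, y)) =
  (fun x => \int[m2]_(y in D2) f (x, y)) \_ D1.
Proof.
apply/funext => x; rewrite patchE; case: ifPn => [|xD1].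
  rewrite inE => xD1; rewrite [RHS]integral_mkcond; apply: eq_integral => y _.
  by rewrite !patchE in_setX (mem_set xD1).
by apply: integral0_eq => y _; rewrite patchE in_setX (negbTE xD1).
Qed.

Let restrict_iter2 :
  (fun y => \int[m1]_x (f \_ (D1 `*` D2)) (x, y)) =
  (fun y => \int[m1]_(x in D1) f (x, y)) \_ D2.
Proof.
apply/funext => y; rewrite patchE; case: ifPn => [|yD2].
  rewrite inE => yD2; rewrite [RHS]integral_mkcond; apply: eq_integral => x _.
  by rewrite !patchE in_setX (mem_set yD2) andbT.
by apply: integral0_eq => x _; rewrite patchE in_setX (negbTE yD2) andbF.
Qed.

Let mD12 : measurable (D1 `*` D2). Proof. exact: measurableX. Qed.

Lemma tonelli12_rect : measurable_fun (D1 `*` D2) f ->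
  (forall z, (D1 `*` D2) z -> 0 <= f z) ->
  \int[m1 \x m2]_(z in D1 `*` D2) f z = \int[m1]_(x in D1) \int[m2]_(y in D2) f (x, y).
Proof.
move=> mf f0; rewrite integral_mkcond fubini_tonelli1.
- by rewrite /fubini_F restrict_iter1 -integral_mkcond.
- exact/(measurable_restrictT _ _).1.
- by move=> z; rewrite patchE; case: ifPn => //; rewrite inE; exact: f0.
Qed.

Lemma tonelli21_rect : measurable_fun (D1 `*` D2) f ->
  (forall z, (D1 `*` D2) z -> 0 <= f z) ->
  \int[m1 \x m2]_(z in D1 `*` D2) f z = \int[m2]_(y in D2) \int[m1]_(x in D1) f (x, y).
Proof.
move=> mf f0; rewrite integral_mkcond fubini_tonelli2.
- by rewrite /fubini_G restrict_iter2 -integral_mkcond.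
- exact/(measurable_restrictT _ _).1.
- by move=> z; rewrite patchE; case: ifPn => //; rewrite inE; exact: f0.
Qed.

Lemma fubini12_rect : (m1 \x m2).-integrable (D1 `*` D2) f ->
  \int[m1]_(x in D1) \int[m2]_(y in D2) f (x, y) = \int[m1 \x m2]_(z in D1 `*` D2) f z.
Proof.
move=> fi; rewrite [RHS]integral_mkcond -integral12_prod_meas1.
  by rewrite restrict_iter1 -integral_mkcond.
by apply/(integrable_mkcond _ _).1.
Qed.

Lemma fubini21_rect : (m1 \x m2).-integrable (D1 `*` D2) f ->
  \int[m2]_(y in D2) \int[m1]_(x in D1) f (x, y) = \int[m1 \x m2]_(z in D1 `*` D2) f z.
Proof.
move=> fi; rewrite [RHS]integral_mkcond -integral21_prod_meas1.
  by rewrite restrict_iter2 -integral_mkcond.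
by apply/(integrable_mkcond _ _).1.
Qed.

Lemma measurable_iter1_rect : measurable_fun (D1 `*` D2) f ->
  (forall z, (D1 `*` D2) z -> 0 <= f z) ->
  measurable_fun D1 (fun x => \int[m2]_(y in D2) f (x, y)).
Proof.
move=> mf f0; apply/(measurable_restrictT _ mD1).2.
rewrite -restrict_iter1; apply: measurable_fun_fubini_tonelli_F.
- exact/(measurable_restrictT _ _).1.
- by move=> z; rewrite patchE; case: ifPn => //; rewrite inE; exact: f0.
Qed.

End rectangle.

(** * Derivatives *)

Section pointwise_derive.
Variables (R : realType) (x : R).
Implicit Types (f g : R -> R) (a b : R).

Lemma der_eq f a b : hasder x f a -> a = b -> hasder x f b.
Proof. by move=> ? <-. Qed.

Lemma der_cst a : hasder x (fun=> a) 0. Proof. exact: is_derive_cst. Qed.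

Lemma der_id : hasder x (fun t : R => t) 1. Proof. exact: is_derive_id. Qed.

Lemma der_opp f a : hasder x f a -> hasder x (fun t => - f t) (- a).
Proof. exact: is_deriveN. Qed.

Lemma der_add f g a b : hasder x f a -> hasder x g b ->
  hasder x (fun t => f t + g t) (a + b).
Proof. exact: is_deriveD. Qed.

Lemma der_mul f g a b : hasder x f a -> hasder x g b ->
  hasder x (fun t => f t * g t) (f x * b + g x * a).
Proof. exact: is_deriveM. Qed.

Lemma der_pow f a n : hasder x f a ->
  hasder x (fun t => f t ^+ n) (n%:R * f x ^+ n.-1 * a).
Proof.
move=> df; rewrite (_ : (fun t => f t ^+ n) = f ^+ n); first exact: is_deriveX.
by apply/funext => t; elim: n => [|n IH]; rewrite ?expr0// !exprS fctE IH.
Qed.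

Lemma der_inv f a : f x != 0 -> hasder x f a ->
  hasder x (fun t => (f t)^-1) (- (f x) ^- 2 * a).
Proof. by move=> f0 df; apply: (is_deriveV f0). Qed.

Lemma der_comp (h f : R -> R) a b : hasder (f x) h b -> hasder x f a ->
  hasder x (fun t => h (f t)) (b * a).
Proof. by move=> dh df; exact: (is_derive1_comp dh df). Qed.

Lemma der_expR f a : hasder x f a ->
  hasder x (fun t => expR (f t)) (expR (f x) * a).
Proof. by move=> df; apply: (der_comp _ df); exact: is_derive_expR. Qed.

Lemma der_cos f a : hasder x f a ->
  hasder x (fun t => cos (f t)) (- sin (f x) * a).
Proof. by move=> df; apply: (der_comp _ df); exact: is_derive_cos. Qed.

Lemma der_sin f a : hasder x f a ->
  hasder x (fun t => sin (f t)) (cos (f x) * a).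
Proof. by move=> df; apply: (der_comp _ df); exact: is_derive_sin. Qed.

Lemma der_powR f a p : 0 < f x -> hasder x f a ->
  hasder x (fun t => f t `^ p) (p * f x `^ (p - 1) * a).
Proof. by move=> f0 df; have := der_comp (is_derive1_powR p f0) df. Qed.

Lemma der_cosh f a : hasder x f a ->
  hasder x (fun t => cosh (f t)) (sinh (f x) * a).
Proof.
move=> df; apply: der_eq.
  apply: der_mul; last exact: der_cst.
  exact: (der_add (der_expR df) (der_expR (der_opp df))).
rewrite mulr0 add0r /sinh; ring.
Qed.

Lemma der_sinh f a : hasder x f a ->
  hasder x (fun t => sinh (f t)) (cosh (f x) * a).
Proof.
move=> df; apply: der_eq.
  apply: der_mul; last exact: der_cst.
  exact: (der_add (der_expR df) (der_opp (der_expR (der_opp df)))).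
rewrite mulr0 add0r /cosh; ring.
Qed.

Lemma der_continuous f a : hasder x f a -> {for x, continuous f}.
Proof. by move=> [df _]; apply: differentiable_continuous; apply/derivable1_diffP. Qed.

Lemma der_cvg_right f a l : hasder x f a -> f x = l -> f t @[t --> x^'+] --> l.
Proof. by move=> df <-; apply: cvg_at_right_filter; exact: (der_continuous df). Qed.

End pointwise_derive.

(** Second-order matching reads off the shape of the function, so the derivative is built as an
    existential variable. Hypotheses are tried first, which lets known derivatives of opaque
    functions enter; positivity and nonvanishing conditions are left as goals. *)
Ltac der_step := first [eassumption | lazymatch goal with
  | |- hasder _ (fun _ => ?c) _ => apply: (@der_cst _ _ c)
  | |- hasder _ (fun t => @?f t + @?g t) _ => apply: (@der_add _ _ f g)
  | |- hasder _ (fun t => - @?f t) _ => apply: (@der_opp _ _ f)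
  | |- hasder _ (fun t => @?f t * @?g t) _ => apply: (@der_mul _ _ f g)
  | |- hasder _ (fun t => @?f t ^+ ?n) _ => apply: (@der_pow _ _ f _ n)
  | |- hasder _ (fun t => (@?f t)^-1) _ => apply: (@der_inv _ _ f)
  | |- hasder _ (fun t => expR (@?f t)) _ => apply: (@der_expR _ _ f)
  | |- hasder _ (fun t => cos (@?f t)) _ => apply: (@der_cos _ _ f)
  | |- hasder _ (fun t => sin (@?f t)) _ => apply: (@der_sin _ _ f)
  | |- hasder _ (fun t => cosh (@?f t)) _ => apply: (@der_cosh _ _ f)
  | |- hasder _ (fun t => sinh (@?f t)) _ => apply: (@der_sinh _ _ f)
  | |- hasder _ (fun t => @?f t `^ ?p) _ => apply: (@der_powR _ _ f _ p)
  | |- hasder _ _ _ => apply: der_id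
  end].
Ltac der := match goal with |- is_derive ?x _ ?f ?b => change (hasder x f b) | _ => idtac end; apply: der_eq; [repeat der_step|].

(** * Hyperbolic functions and Gamma integrals *)

Section hyperbolic.
Variable R : realType.
Implicit Types x y u v : R.

Lemma coshN x : cosh (- x) = cosh x.
Proof. by rewrite /cosh opprK addrC. Qed.

Lemma sinhN x : sinh (- x) = - sinh x.
Proof. by rewrite /sinh opprK -mulNr opprB. Qed.

Lemma sinh0 : sinh (0 : R) = 0.
Proof. by rewrite /sinh oppr0 subrr mul0r. Qed.

Lemma cosh0 : cosh (0 : R) = 1.
Proof. by rewrite /cosh oppr0 expR0 -mulr2n -mulr_natr mul1r mulfV. Qed.

Lemma cosh2Bsinh2 x : cosh x ^+ 2 - sinh x ^+ 2 = 1.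
Proof.
have e : expR x * expR (- x) = 1 by rewrite -expRD subrr expR0.
rewrite /cosh /sinh; nra.
Qed.

Lemma cosh_ge1 x : 1 <= cosh x.
Proof.
rewrite /cosh ler_pdivlMr// mul1r.
by have := expR_ge1Dx x; have := expR_ge1Dx (- x); lra.
Qed.

Lemma cosh_gt0 x : 0 < cosh x.
Proof. exact: lt_le_trans ltr01 (cosh_ge1 x). Qed.

Lemma expR_le_cosh x : expR x / 2 <= cosh x.
Proof. by rewrite /cosh ler_pM2r ?invr_gt0// lerDl expR_ge0. Qed.

Lemma sinh_ge0 x : 0 <= x -> 0 <= sinh x.
Proof.
move=> x0; rewrite /sinh divr_ge0// subr_ge0 ler_expR.
by rewrite (le_trans _ x0)// oppr_le0.
Qed.

Lemma sinh_gt0 x : 0 < x -> 0 < sinh x.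
Proof.
by move=> x0; rewrite /sinh divr_gt0// subr_gt0 ltr_expR; lra.
Qed.

Lemma continuous_cosh : continuous (@cosh R).
Proof. by move=> x; apply: der_continuous; apply: der_cosh; exact: der_id. Qed.

Lemma continuous_sinh : continuous (@sinh R).
Proof. by move=> x; apply: der_continuous; apply: der_sinh; exact: der_id. Qed.

Lemma norm_sinh_le x : `|sinh x| <= cosh x.
Proof.
rewrite -ler_sqr ?nnegrE ?normr_ge0 ?(ltW (cosh_gt0 x))// real_normK ?num_real//.
by have := cosh2Bsinh2 x; lra.
Qed.

Lemma sinh_ge x : 0 <= x -> x <= sinh x.
Proof.
move=> x0.
have [->|xn0] := eqVneq x 0; first by rewrite sinh0.
have xgt0 : 0 < x by rewrite lt_neqAle eq_sym xn0.
have [c] := @MVT R (@sinh R) (@cosh R) 0 x xgt0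
  (fun c _ => der_eq (der_sinh (der_id c)) (mulr1 _))
  (continuous_subspaceT continuous_sinh).
rewrite sinh0 !subr0 => _ ->.
by rewrite ler_peMl// cosh_ge1.
Qed.

Lemma ge_cosh x : x <= cosh x.
Proof.
have [x0|/ltW x0] := leP 0 x; last exact: (le_trans x0 (ltW (cosh_gt0 x))).
exact: le_trans (sinh_ge x0) (le_trans (ler_norm _) (norm_sinh_le x)).
Qed.

Lemma exprn_le_expR x n : 0 <= x -> x ^+ n <= n`!%:R * expR x.
Proof.
move=> x0; case: n => [|n].
  by rewrite expr0 fact0 mul1r -expR0 ler_expR.
have h := @expR_ge1Dxn R x n x0.
rewrite mulrC -ler_pdivrMr ?ltr0n ?fact_gt0//.
by apply: le_trans h; rewrite lerDr.
Qed.

Lemma expR_cvgy (C : R) (f : R -> R) : (forall v, 0 < v -> `|f v| <= C * expR (- v)) ->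
  f v @[v --> +oo] --> (0 : R).
Proof.
move=> H; apply/norm_cvg0P.
apply: (squeeze_cvgr (f := fun=> 0) (h := fun v => C * expR (- v))).
- by near=> v; rewrite normr_ge0/= H//; near: v; exact: nbhs_pinfty_gt.
- exact: cvg_cst.
- by rewrite -(mulr0 C); apply: cvgM; [exact: cvg_cst|exact: cvgr_expR].
Unshelve. all: by end_near. Qed.

End hyperbolic.

(** * Measurability of pointwise operations *)

Section pointwise_measurable.
Context d (T : measurableType d) (R : realType).
Variable D : set T.
Implicit Types f g : T -> R.

Lemma mf_cst (a : R) : measurable_fun D (fun=> a). Proof. exact: measurable_cst. Qed.

Lemma mf_add f g : measurable_fun D f -> measurable_fun D g ->
  measurable_fun D (fun x => f x + g x).
Proof. exact: measurable_funD. Qed.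

Lemma mf_opp f : measurable_fun D f -> measurable_fun D (fun x => - f x).
Proof. by move=> mf; apply: measurableT_comp mf; exact: oppr_measurable. Qed.

Lemma mf_mul f g : measurable_fun D f -> measurable_fun D g ->
  measurable_fun D (fun x => f x * g x).
Proof. exact: measurable_funM. Qed.

Lemma mf_pow f n : measurable_fun D f -> measurable_fun D (fun x => f x ^+ n).
Proof. exact: measurable_funX. Qed.

Lemma mf_inv f : measurable_fun D f -> measurable_fun D (fun x => (f x)^-1).
Proof. exact: measurableT_comp (@measurable_inv R). Qed.

Lemma mf_norm f : measurable_fun D f -> measurable_fun D (fun x => `|f x|).
Proof. by move=> mf; apply: measurableT_comp mf; exact: normr_measurable. Qed.

Lemma mf_expR f : measurable_fun D f -> measurable_fun D (fun x => expR (f x)).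
Proof. exact: measurableT_comp (@measurable_expR R). Qed.

Lemma mf_powR f p : measurable_fun D f -> measurable_fun D (fun x => f x `^ p).
Proof. exact: measurableT_comp (@measurable_powR R p). Qed.

Lemma mf_continuous (h : R -> R) f : continuous h -> measurable_fun D f ->
  measurable_fun D (fun x => h (f x)).
Proof. by move=> ch; apply: measurableT_comp; exact: continuous_measurable_fun. Qed.

End pointwise_measurable.

Ltac mf_step := lazymatch goal with
  | |- measurable_fun _ (fun x => @?f x + @?g x) => apply: (@mf_add _ _ _ _ f g)
  | |- measurable_fun _ (fun x => - @?f x) => apply: (@mf_opp _ _ _ _ f)
  | |- measurable_fun _ (fun x => @?f x * @?g x) => apply: (@mf_mul _ _ _ _ f g)
  | |- measurable_fun _ (fun x => @?f x ^+ ?n) => apply: (@mf_pow _ _ _ _ f n)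
  | |- measurable_fun _ (fun x => (@?f x)^-1) => apply: (@mf_inv _ _ _ _ f)
  | |- measurable_fun _ (fun x => `|@?f x|) => apply: (@mf_norm _ _ _ _ f)
  | |- measurable_fun _ (fun x => expR (@?f x)) => apply: (@mf_expR _ _ _ _ f)
  | |- measurable_fun _ (fun x => @?f x `^ ?p) => apply: (@mf_powR _ _ _ _ f p)
  | |- measurable_fun _ (fun x => cos (@?f x)) => apply: (mf_continuous (@continuous_cos _) (f := f))
  | |- measurable_fun _ (fun x => sin (@?f x)) => apply: (mf_continuous (@continuous_sin _) (f := f))
  | |- measurable_fun _ (fun x => cosh (@?f x)) => apply: (mf_continuous (@continuous_cosh _) (f := f))
  | |- measurable_fun _ (fun x => sinh (@?f x)) => apply: (mf_continuous (@continuous_sinh _) (f := f))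
  | |- measurable_fun _ (fun x => Num.sqrt (@?f x)) => apply: (mf_continuous (@sqrt_continuous _) (f := f))
  | |- _ => first [ assumption | exact: mf_cst | exact: measurable_id | exact: measurable_fst | exact: measurable_snd
     | by apply: measurable_funTS; first [assumption | exact: measurable_id | exact: measurable_fst | exact: measurable_snd] ]
  end.
Ltac mfun := repeat mf_step.

Lemma integrable_le d (T : measurableType d) (R : realType) (mu : {measure set T -> \bar R})
    (D : set T) (f g : T -> R) : measurable D -> measurable_fun D f ->
  (forall x, D x -> `|f x| <= g x) ->
  mu.-integrable D (EFin \o g) -> mu.-integrable D (EFin \o f).
Proof.
move=> mD mf fg ig; apply: le_integrable ig => //; first exact/measurable_EFinP.
by move=> x Dx; rewrite /= lee_fin (le_trans (fg _ Dx))// ler_norm.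
Qed.

Lemma integrable_ge0 d (T : measurableType d) (R : realType) (mu : {measure set T -> \bar R})
    (D : set T) (f : T -> R) (r : R) : measurable D -> measurable_fun D f ->
  (forall x, D x -> 0 <= f x) -> (\int[mu]_(x in D) (f x)%:E = r%:E)%E ->
  mu.-integrable D (EFin \o f).
Proof.
move=> mD mf f0 fr; apply/integrableP; split; first exact/measurable_EFinP.
rewrite (eq_integral (EFin \o f)) ?fr ?ltry// => x; rewrite inE => Dx.
by rewrite /= ger0_norm// f0.
Qed.

(** * Euler's integral *)

Section gamma.
Variable R : realType.
Local Notation leb := (@lebesgue_measure R).
Local Notation hl := (`]0%R, +oo[%classic : set R).
Implicit Types (s l t x : R).

Lemma hl_gt0 t : hl t -> 0 < t. Proof. by rewrite /= in_itv/= andbT. Qed.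

Lemma le_powRl s x t : 0 <= s -> 0 <= x -> x <= t -> x `^ s <= t `^ s.
Proof.
move=> s0 x0 xt; apply: ge0_ler_powR => //; rewrite nnegrE//.
exact: le_trans xt.
Qed.

Lemma cvgr_powR s : 0 < s -> t `^ s @[t --> +oo] --> +oo.
Proof.
move=> s0; apply/cvgryPge => A; near=> t.
have t0 : 0 < t by near: t; exact: nbhs_pinfty_gt.
have [A0|/ltW A0] := leP 0 A; last by rewrite (le_trans A0)// powR_ge0.
have -> : A = (A `^ s^-1) `^ s by rewrite -powRrM mulVf ?gt_eqF// powRr1.
apply: le_powRl; [exact: ltW|exact: powR_ge0|].
near: t; exact: nbhs_pinfty_ge.
Unshelve. all: by end_near. Qed.

(** The primitive is -1 / (1 + t^s). The integrand behaves like t^(s-1) at 0, as Euler's does, and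
    is integrable at infinity, which makes it a majorant for every s > 0. *)
Lemma integral_powR_rational s : 0 < s ->
  (\int[leb]_(t in hl) (s * t `^ (s - 1) / (1 + t `^ s) ^+ 2)%:E = 1%:E)%E.
Proof.
move=> s0.
have p0 t : 0 < 1 + t `^ s by rewrite ltr_wpDr// powR_ge0.
have -> : (1 : \bar R)%E = (0 - (- 1))%:E by rewrite sub0r opprK.
apply: (@FTC0y_ge0 _ (fun t => - (1 + t `^ s)^-1)).
- move=> t t0; der; rewrite ?gt_eqF//=.
  by field; rewrite gt_eqF.
- move=> t t0; apply: der_continuous.
  by repeat (der_step; rewrite /= ?gt_eqF ?exprn_gt0//).
- rewrite -[in X in _ --> X]invr1 -[1 in X in _ --> X](addr0 1).
  apply: cvgN; apply: cvgV; first by rewrite addr0.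
  by apply: cvgD; [exact: cvg_cst|exact: powR_cvg0].
- rewrite -[0]oppr0; apply: cvgN.
  apply/gtr0_cvgV0; first exact: nearW.
  apply/cvgryPge => A; move/cvgryPge : (cvgr_powR s0) => /(_ A).
  by apply: filterS => t /le_trans; apply; rewrite lerDr.
- by move=> t t0; rewrite divr_ge0 ?sqr_ge0// mulr_ge0 ?powR_ge0// ltW.
Qed.

Let mgamma s : measurable_fun hl (fun t : R => t `^ (s - 1) * expR (- t)).
Proof. by mfun. Qed.

(** The bound (1 + t^s)^2 <= K^2 e^t compares Euler's integrand with the rational one, at 0 and at
    infinity at once. *)
Lemma integrable_gamma s : 0 < s ->
  leb.-integrable hl (EFin \o (fun t : R => t `^ (s - 1) * expR (- t))).
Proof.
move=> s0.
have [n sn] : exists n : nat, s <= n%:R.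
  by exists (Num.truncn s).+1; rewrite ltW// truncnS_gt.
(* The summand 2 covers t <= 1, where t^s <= 1; the other one covers t > 1, where t^s <= t^n <= 2^n
   n! e^(t/2). *)
pose K := 2 + 2 ^+ n * n`!%:R : R.
have K0 : 0 < K by rewrite /K addr_gt0// mulr_gt0 ?exprn_gt0// ltr0n fact_gt0.
have bnd t : 0 < t -> 1 + t `^ s <= K * expR (t / 2).
  move=> t0; have e1 : 1 <= expR (t / 2).
    by rewrite -expR0 ler_expR divr_ge0// ltW.
  have [t1|t1] := leP t 1.
    have ts : t `^ s <= 1.
      have -> : 1 = 1 `^ s :> R by rewrite powR1.
    by apply: le_powRl => //; exact: ltW.
    have : 2 <= K by rewrite /K lerDl mulr_ge0// exprn_ge0.
    by move: ts e1 (powR_ge0 t s); nra.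
  have ts : t `^ s <= t ^+ n.
    by rewrite -powR_mulrn ?(ltW t0)//; apply: ler_powR => //; exact: ltW.
  have := @exprn_le_expR R (t / 2) n (divr_ge0 (ltW t0) (ler0n _ _)).
  rewrite expr_div_n ler_pdivrMr ?exprn_gt0// => h.
  rewrite /K mulrDl; apply: lerD; first lra.
  by rewrite (le_trans ts)// (le_trans h)// mulrC mulrA.
pose C := s^-1 * K ^+ 2.
have Cf : leb.-integrable hl (EFin \o (fun t : R => C * (s * t `^ (s - 1) / (1 + t `^ s) ^+ 2))).
  have := @integrable_ge0 _ _ R leb hl (fun t => s * t `^ (s - 1) / (1 + t `^ s) ^+ 2) 1.
  have m1 : measurable_fun hl (fun t : R => s * t `^ (s - 1) / (1 + t `^ s) ^+ 2) by mfun.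
  have ge0 t : hl t -> 0 <= s * t `^ (s - 1) / (1 + t `^ s) ^+ 2.
    by move=> _; rewrite divr_ge0 ?sqr_ge0// mulr_ge0 ?powR_ge0// ltW.
  move=> /(_ (measurable_itv _) m1 ge0 (integral_powR_rational s0)) h.
  rewrite (_ : _ \o _ = fun t => C%:E * (s * t `^ (s - 1) / (1 + t `^ s) ^+ 2)%:E)%E//.
  exact: integrableZl.
apply: (integrable_le _ _ _ Cf) => //; first exact: mgamma.
move=> t /hl_gt0 t0.
rewrite ger0_norm ?mulr_ge0 ?powR_ge0 ?expR_ge0//.
have p0 : 0 < 1 + t `^ s by rewrite ltr_wpDr// powR_ge0.
have -> : C * (s * t `^ (s - 1) / (1 + t `^ s) ^+ 2) =
    t `^ (s - 1) * (K ^+ 2 / (1 + t `^ s) ^+ 2).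
  by rewrite /C; field; rewrite !gt_eqF.
rewrite ler_wpM2l ?powR_ge0// ler_pdivlMr ?exprn_gt0//.
have e2 : expR t = expR (t / 2) ^+ 2 by rewrite expr2 -expRD; congr expR; field.
have h : (1 + t `^ s) ^+ 2 <= K ^+ 2 * expR t.
  by rewrite e2 -exprMn ler_sqr ?nnegrE ?(ltW p0) ?mulr_ge0 ?expR_ge0 ?(ltW K0)// bnd.
by rewrite expRN mulrC ler_pdivrMr ?expR_gt0.
Qed.

Lemma GammaE s : 0 < s ->
  (\int[leb]_(t in hl) (t `^ (s - 1) * expR (- t))%:E = (Gamma s)%:E)%E.
Proof.
by move=> s0; rewrite /Gamma /Rintegral fineK//; exact/integrable_fin_num/integrable_gamma.
Qed.

(** The integrand has a positive lower bound on [1, 2]; the minimum in [c] allows t^(s-1) to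
    increase or to decrease. *)
Lemma Gamma_gt0 s : 0 < s -> 0 < Gamma s.
Proof.
move=> s0; pose c := Num.min 1 (2 `^ (s - 1)) * expR (- 2) : R.
have c0 : 0 < c by rewrite mulr_gt0 ?expR_gt0// lt_min ltr01 powR_gt0.
suff : (c%:E <= (Gamma s)%:E)%E by rewrite lee_fin; exact: lt_le_trans.
rewrite -GammaE//.
have -> : (c%:E = \int[leb]_(x in `[1%R, 2%R]) c%:E)%E.
  by rewrite integral_cst//= lebesgue_measure_itv/= lte_fin ltr1n -EFinB [(2 - 1)%R](_ : _ = 1) ?mule1//; lra.
apply: (@le_trans _ _ (\int[leb]_(t in `[1%R, 2%R]) (t `^ (s - 1) * expR (- t))%:E)%E).
  apply: ge0_le_integral => //=.
  - by move=> x _; rewrite lee_fin ltW.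
  - by apply/measurable_EFinP; mfun.
  - move=> x; rewrite in_itv/= => /andP[x1 x2]; rewrite lee_fin.
    apply: ler_pM; rewrite ?expR_ge0 ?ler_expR ?lerN2//.
    rewrite ge_min; have [s1|s1] := leP 0 (s - 1).
      by have := ler_powR x1 s1; rewrite powRr0 => ->.
    apply/orP; right.
    have x0 : 0 < x by lra.
    rewrite -[s - 1]opprK 2!(powRN _ (- (s - 1))) lef_pV2 ?posrE ?powR_gt0//.
    by apply: le_powRl; lra.
apply: ge0_subset_integral => //=.
- by apply/measurable_EFinP; exact: mgamma.
- by move=> x _; rewrite lee_fin mulr_ge0 ?powR_ge0 ?expR_ge0.
- by move=> x /=; rewrite !in_itv/= andbT => /andP[x1 _]; lra.
Qed.

Lemma integral_gamma_scale s l : 0 < s -> 0 < l ->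
  (\int[leb]_(t in hl) (t `^ (s - 1) * expR (- (l * t)))%:E = (Gamma s * l `^ (- s))%:E)%E.
Proof.
move=> s0 l0.
have := @integral_scale R l (fun t : R => (t `^ (s - 1) * expR (- t))%:E) l0.
rewrite GammaE// => h.
have e : (Gamma s)%:E = (l%:E * ((l `^ (s - 1))%:E *
    \int[leb]_(t in hl) (t `^ (s - 1) * expR (- (l * t)))%:E))%E.
  rewrite h; [|exact/measurable_EFinP|by move=> r _; rewrite lee_fin mulr_ge0 ?powR_ge0 ?expR_ge0].
  congr (_ * _)%E; rewrite -ge0_integralZl//.
  - apply: eq_integral => t; rewrite inE => /hl_gt0 t0.
    by rewrite powRM ?(ltW l0) ?(ltW t0)// -EFinM mulrA.
  - by apply/measurable_EFinP; mfun.
  - by move=> r _; rewrite lee_fin mulr_ge0 ?powR_ge0 ?expR_ge0.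
  - by rewrite lee_fin powR_ge0.
rewrite EFinM e muleC !muleA -!EFinM.
have -> : l `^ (- s) * l * l `^ (s - 1) = 1.
  rewrite -{2}(powRr1 (ltW l0)) -!powRD ?(gt_eqF l0) ?implybT//.
  by rewrite (_ : _ + _ = 0) ?powRr0//; ring.
by rewrite mul1e.
Qed.

Lemma integral_expR_scale l : 0 < l ->
  (\int[leb]_(t in hl) (expR (- (l * t)))%:E = (l^-1)%:E)%E.
Proof.
move=> l0; have -> : (l^-1 = 0 - (- l^-1)) by rewrite sub0r opprK.
apply: (@FTC0y_ge0 _ (fun t => - (l^-1 * expR (- (l * t))))).
- by move=> t t0; der => /=; field; rewrite gt_eqF.
- by move=> t t0; apply: der_continuous; repeat der_step.
- apply: der_cvg_right; last by rewrite mulr0 oppr0 expR0 mulr1.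
  by repeat der_step.
- rewrite -oppr0 -(mulr0 l^-1); apply: cvgN; apply: cvgM; first exact: cvg_cst.
  apply: (cvg_comp (fun t => l * t) (fun y => expR (- y))); last exact: cvgr_expR.
  by apply: gt0_cvgMry.
- by move=> t _; rewrite expR_ge0.
Qed.

End gamma.

(** * Primitives of integrable functions on the line *)

Section primitive.
Variable R : realType.
Local Notation leb := (@lebesgue_measure R).
Variable f : R -> R.
Hypothesis fi : leb.-integrable setT (EFin \o f).
Hypothesis cf : continuous f.

Definition primitive (w : R) : R := \int[leb]_(t in `]-oo, w]) f t.

Let fiA (A : set (measurableTypeR R)) : measurable A -> leb.-integrable A (EFin \o f).
Proof. by move=> mA; apply: integrableS fi. Qed.

Lemma hasder_primitive w : hasder w primitive (f w).
Proof.
have ww : w < w + 1 by rewrite ltrDl.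
have [dF F'] := @continuous_FTC1 R f -oo%O w (w + 1) ww
  (fiA (measurable_itv _)) (ltNyr _) (@cf w).
by split; [exact: dF|rewrite -F' derive1E].
Qed.

Let mf : measurable_fun [set: measurableTypeR R] f. Proof. exact: continuous_measurable_fun. Qed.

Let primitiveE w : (primitive w)%:E = (\int[leb]_t ((f \_ `]-oo, w]) t)%:E)%E.
Proof.
rewrite /primitive /Rintegral fineK; last first.
  by apply: integrable_fin_num; [|exact/fiA].
by rewrite integral_mkcond; apply: eq_integral => t _; rewrite restrict_EFin.
Qed.

Let cvg_primitive (u : nat -> R) (g : R -> R) :
  (forall t, (f \_ `]-oo, u n]) t @[n --> \oo] --> g t) ->
  (primitive (u n))%:E @[n --> \oo] --> (\int[leb]_t (g t)%:E)%E.
Proof.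
move=> ug; under eq_fun do rewrite primitiveE.
apply: (@dominated_cvgE _ (measurableTypeR R) R leb setT _ g (fun t => `|f t|)) => //.
- by move=> n; apply/(measurable_restrictT _ _).1; [exact: measurable_itv|exact: measurable_funTS].
- exact: (integrable_norm fi).
- by move=> n t _; rewrite patchE; case: ifPn => //; rewrite normr0.
Qed.

Lemma primitive_cvgy : primitive w @[w --> +oo] --> (\int[leb]_t f t : R).
Proof.
apply/cvg_pinftyP => u uy.
have := @cvg_primitive u f.
have <- : (\int[leb]_t f t)%:E = (\int[leb]_t (f t)%:E)%E.
  by rewrite /Rintegral fineK//; exact: integrable_fin_num.
move=> H; apply: (@fine_cvg _ _ _ _ (fun n => (primitive (u n))%:E)).
apply: H => t; apply: cvg_near_cst.
near=> n; rewrite patchE ifT// inE/= in_itv/=.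
by near: n; move/cvgryPge : uy; exact.
Unshelve. all: by end_near. Qed.

Lemma primitive_cvgNy : primitive w @[w --> -oo] --> (0 : R).
Proof.
apply/cvg_ninftyP => u uy.
have := @cvg_primitive u (fun=> 0); rewrite integral0 => H.
apply: (@fine_cvg _ _ _ _ (fun n => (primitive (u n))%:E)); apply: H => t; apply: cvg_near_cst.
near=> n; rewrite patchE ifF//; apply/negbTE; rewrite notin_setE/= in_itv/=.
apply/negP; rewrite -ltNge.
by near: n; move/cvgrNyPlt : uy; exact.
Unshelve. all: by end_near. Qed.

End primitive.

Section cauchy_schlomilch.
Variable R : realType.
Local Notation leb := (@lebesgue_measure R).
Local Notation hl := (`]0%R, +oo[%classic : set R).
Implicit Types x A B : R.

Lemma cvgr_at_right_powRN (s : R) : 0 < s -> x `^ (- s) @[x --> (0 : R)^'+] --> +oo.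
Proof.
move=> s0; apply/cvgryPge => M.
have [M0|M0] := ltP 0 M; last first.
  by apply: nearW => x; rewrite (le_trans M0)// powR_ge0.
near=> x.
have x0 : 0 < x by near: x; exact: nbhs_right_gt.
have -> : M = (M `^ (- s^-1)) `^ (- s).
  by rewrite -powRrM mulrNN mulVf ?gt_eqF// powRr1// ltW.
rewrite !(powRN _ s) lef_pV2 ?posrE ?powR_gt0//.
apply: le_powRl; [exact: ltW|exact: ltW|].
near: x; apply: nbhs_right_le; exact: (powR_gt0 _ M0).
Unshelve. all: by end_near. Qed.

Lemma cvgNy_subr (T : Type) (F : set_system T) {FF : Filter F} (u v : T -> R) (a B : R) :
  0 < B -> u x @[x --> F] --> a -> v x @[x --> F] --> +oo ->
  (u x - B * v x) @[x --> F] --> -oo.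
Proof.
move=> B0 ua vy; apply/cvgrNyPle => M.
have h1 : \forall x \near F, u x < a + 1 by apply: (cvgr_lt a) => //; rewrite ltrDl.
move/cvgryPge : vy => /(_ ((a + 1 - M) / B)) h2.
near=> x.
have : u x < a + 1 by near: x.
have : (a + 1 - M) / B <= v x by near: x.
rewrite ler_pdivrMr// mulrC; lra.
Unshelve. all: by end_near. Qed.

(* With [E] a primitive of the Gaussian, the integrand has the antiderivative
   [(e^{-2AB} E(A sqrt x - B / sqrt x) - e^{2AB} E(- A sqrt x - B / sqrt x)) / A]. *)
Lemma cauchy_schlomilch A B : 0 < A -> 0 < B ->
  (\int[leb]_(x in hl) (x `^ (- 2^-1) * expR (- (x * A ^+ 2) - B ^+ 2 / x))%:E =
   (Num.sqrt pi / A * expR (- (2 * A * B)))%:E)%E.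
Proof.
move=> A0 B0.
pose E := primitive (@gauss_fun R).
have gi := @integrableT_gauss R.
have gc := @continuous_gauss_fun R.
have dE w : hasder w E (expR (- w ^+ 2)) by exact: (hasder_primitive gi gc).
have EyE : (\int[leb]_t gauss_fun t)%R = Num.sqrt pi.
  by rewrite /Rintegral integralT_gauss.
have Ey : E w @[w --> +oo] --> Num.sqrt pi by rewrite -EyE; exact: primitive_cvgy.
have ENy : E w @[w --> -oo] --> (0 : R) by exact: primitive_cvgNy.
pose p x := x `^ 2^-1; pose q x := x `^ (- 2^-1).
pose F x := A^-1 * (expR (- (2 * A * B)) * E (A * p x - B * q x) -
  expR (2 * A * B) * E (- (A * p x) - B * q x)).
have p0 x : 0 < x -> 0 < p x by move=> x0; exact: powR_gt0.
have qE x : q x = (p x)^-1 by rewrite /q /p powRN.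
have pp x : 0 < x -> p x ^+ 2 = x.
  by move=> x0; rewrite /p -powR_mulrn ?powR_ge0// -powRrM mulVf// powRr1// ltW.
have dp x : 0 < x -> hasder x p (2^-1 * (p x)^-1).
  move=> x0; rewrite /p; der => //; rewrite /= mulr1; congr (_ * _).
  rewrite -/(p x) -qE /q; congr (_ `^ _); lra.
have dq x : 0 < x -> hasder x q (- 2^-1 * (p x) ^- 3).
  move=> x0; apply: (@der_eq _ _ _ (- (p x) ^- 2 * (2^-1 * (p x)^-1))).
    rewrite (_ : q = fun x => (p x)^-1); last by apply/funext.
    by apply: der_inv; [rewrite gt_eqF// p0|exact: dp].
  by field; rewrite gt_eqF// p0.
have dF x : 0 < x -> hasder x F (x `^ (- 2^-1) * expR (- (x * A ^+ 2) - B ^+ 2 / x)).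
  move=> x0; apply: der_eq.
    apply: der_mul; first exact: der_cst.
    apply: der_add; [|apply: der_opp]; (apply: der_mul; first exact: der_cst);
      apply: (der_comp (dE _)).
    - apply: der_add; [|apply: der_opp]; (apply: der_mul; first exact: der_cst);
      [exact: dp|exact: dq].
    - apply: der_add; [apply: der_opp|apply: der_opp]; (apply: der_mul; first exact: der_cst);
      [exact: dp|exact: dq].
  have px0 := p0 _ x0.
  have px0' : p x != 0 by rewrite gt_eqF.
  rewrite /= -/(q x) !mulr0 !addr0 qE.
  (* As p^2 = x, the square (A p - B / p)^2 is x A^2 + B^2 / x - 2 A B, and (A p + B / p)^2 has + 2
     A B instead; the outer exponentials remove the mixed term, and both products are the same
     integrand. *)
  have e1 : expR (- (2 * A * B)) * expR (- (A * p x - B * (p x)^-1) ^+ 2) =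
     expR (- (x * A ^+ 2) - B ^+ 2 / x).
    by rewrite -expRD; congr expR; rewrite -[in RHS](pp _ x0); field.
  have e2 : expR (2 * A * B) * expR (- (- (A * p x) - B * (p x)^-1) ^+ 2) =
     expR (- (x * A ^+ 2) - B ^+ 2 / x).
    by rewrite -expRD; congr expR; rewrite -[in RHS](pp _ x0); field.
  rewrite [in LHS]mulrA e1 [in LHS](mulrA (expR (2 * A * B))) e2.
  by field; rewrite px0' gt_eqF.
have py : p x @[x --> +oo] --> +oo by apply: cvgr_powR.
have q0 : q x @[x --> (0:R)^'+] --> +oo by apply: cvgr_at_right_powRN.
have qy : q x @[x --> +oo] --> 0.
  under eq_fun do rewrite qE.
  apply/gtr0_cvgV0; last exact: py.
  by near=> x; apply: p0; near: x; exact: nbhs_pinfty_gt.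
have pr0 : p x @[x --> (0:R)^'+] --> 0 by apply: powR_cvg0.
(* Limit at infinity minus limit at 0: at 0 both arguments of [E] tend to minus infinity, at
   infinity the first one tends to plus infinity instead. *)
have -> : Num.sqrt pi / A * expR (- (2 * A * B)) =
   (A^-1 * (expR (- (2 * A * B)) * Num.sqrt pi - expR (2 * A * B) * 0)) -
   (A^-1 * (expR (- (2 * A * B)) * 0 - expR (2 * A * B) * 0)).
  by field; rewrite gt_eqF.
apply: (@FTC0y_ge0 _ F).
- exact: dF.
- move=> x x0; apply: der_continuous; repeat der_step; rewrite ?gt_eqF//.
- rewrite /F; apply: cvgM; first exact: cvg_cst.
  apply: cvgB; (apply: cvgM; first exact: cvg_cst).
  + apply: (cvg_comp (fun x => A * p x - B * q x) E _ ENy).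
    by apply: (cvgNy_subr B0 _ q0); apply: cvgM pr0; exact: cvg_cst.
  + apply: (cvg_comp (fun x => - (A * p x) - B * q x) E _ ENy).
    by apply: (cvgNy_subr B0 _ q0); apply: cvgN; apply: cvgM pr0; exact: cvg_cst.
- rewrite /F; apply: cvgM; first exact: cvg_cst.
  apply: cvgB; (apply: cvgM; first exact: cvg_cst).
  + apply: (cvg_comp (fun x => A * p x - B * q x) E _ Ey).
    rewrite (_ : (fun x => _) = (fun x => - (B * q x - A * p x))); last first.
      by apply/funext => x; rewrite opprB.
    apply/cvgNry; apply: (cvgNy_subr A0 _ py); apply: cvgM qy; exact: cvg_cst.
  + apply: (cvg_comp (fun x => - (A * p x) - B * q x) E _ ENy).
    rewrite (_ : (fun x => _) = (fun x => - B * q x - A * p x)); last first.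
      by apply/funext => x; rewrite addrC mulNr.
    by apply: (cvgNy_subr A0 _ py); apply: cvgM qy; exact: cvg_cst.
- by move=> x x0; rewrite mulr_ge0 ?powR_ge0 ?expR_ge0.
Unshelve. all: by end_near. Qed.

End cauchy_schlomilch.

(** * Integral representation of the Whittaker function *)

Section kernel_domination.
Variables (R : realType) (s : R) (s0 : 0 < s).
Local Notation leb := (@lebesgue_measure R).
Local Notation hl := (`]0%R, +oo[%classic : set R).
Local Notation D := (hl `*` hl).
Implicit Types (x y v w : R) (z : R * R) (h : R * R -> R).

Definition shiftcosh z : R := cosh z.1 + z.2.
Local Notation B := shiftcosh.

Lemma shiftcosh_ge1 z : 0 < z.2 -> 1 <= B z.
Proof. by move=> z0; rewrite /B; have := cosh_ge1 z.1; lra. Qed.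

Lemma shiftcosh_ge z : z.1 + z.2 <= B z.
Proof. by rewrite /B lerD2r ge_cosh. Qed.

(** First y^m <= m! e^y; then y - x y^2 <= 1/x - y, because the difference is (1 - x y)^2 / x. *)
Lemma exprn_gauss_le m x y : 0 < x -> 0 <= y ->
  y ^+ m * expR (- (x * y ^+ 2)) <= m`!%:R * expR (x^-1) * expR (- y).
Proof.
move=> x0 y0.
rewrite -mulrA -expRD; apply: le_trans (_ : m`!%:R * expR y * expR (- (x * y ^+ 2)) <= _).
  by rewrite ler_wpM2r ?expR_ge0// exprn_le_expR.
rewrite -mulrA -expRD ler_wpM2l// ler_expR -subr_ge0.
have -> : x^-1 - y - (y - x * y ^+ 2) = x^-1 * (1 - x * y) ^+ 2.
  by field; rewrite gt_eqF.
by rewrite mulr_ge0 ?sqr_ge0// invr_ge0 ltW.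
Qed.

(** The growth class of the factors met below: it is stable under sums and products, and a Gaussian
    in [B] makes its members integrable. The weight w^(s-1) may be singular at 0 and is kept
    apart. *)
Definition polybounded h := exists (K : R) (m : nat), 0 <= K /\
  forall z, 0 <= z.1 -> 0 < z.2 -> `|h z| <= K * B z ^+ m.

Lemma pb_le h (g : R * R -> R) : polybounded g ->
  (forall z, 0 <= z.1 -> 0 < z.2 -> `|h z| <= `|g z|) -> polybounded h.
Proof.
move=> [K [m [K0 H]]] hg; exists K, m; split => // z z1 z2.
exact: le_trans (hg z z1 z2) (H z z1 z2).
Qed.

Lemma pb_cst (a : R) : polybounded (fun=> a).
Proof. by exists `|a|, 0; split => // z _ _; rewrite expr0 mulr1. Qed.

Lemma pb_B : polybounded B.
Proof.
exists 1, 1; split => // z _ /shiftcosh_ge1 z2; rewrite expr1 mul1r ger0_norm//; lra.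
Qed.

Lemma pb_add h1 h2 : polybounded h1 -> polybounded h2 ->
  polybounded (fun z => h1 z + h2 z).
Proof.
move=> [K [m [K0 H]]] [L [n [L0 G]]]; exists (K + L), (m + n)%N.
split => [|z z1 z2]; first exact: addr_ge0.
have B1 := shiftcosh_ge1 z2.
rewrite (le_trans (ler_normD _ _))// mulrDl lerD//.
  by rewrite (le_trans (H z z1 z2))// ler_wpM2l// ler_weXn2l// leq_addr.
by rewrite (le_trans (G z z1 z2))// ler_wpM2l// ler_weXn2l// leq_addl.
Qed.

Lemma pb_mul h1 h2 : polybounded h1 -> polybounded h2 ->
  polybounded (fun z => h1 z * h2 z).
Proof.
move=> [K [m [K0 H]]] [L [n [L0 G]]]; exists (K * L), (m + n)%N.
split => [|z z1 z2]; first exact: mulr_ge0.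
by rewrite normrM exprD mulrACA ler_pM// ?H// G.
Qed.

Lemma pb_opp h : polybounded h -> polybounded (fun z => - h z).
Proof. by move/pb_le; apply => z _ _; rewrite normrN. Qed.

Lemma pb_pow h n : polybounded h -> polybounded (fun z => h z ^+ n).
Proof.
move=> hp; elim: n => [|n IH]; first exact: pb_cst.
by under eq_fun do rewrite exprS; exact: pb_mul.
Qed.

Lemma pb_cosh : polybounded (fun z => cosh z.1).
Proof.
apply: (pb_le pb_B) => z _ z2; have := shiftcosh_ge1 z2; have := cosh_gt0 z.1.
by move=> c0 B1; rewrite !ger0_norm /B; lra.
Qed.

Lemma pb_sinh : polybounded (fun z => sinh z.1).
Proof.
apply: (pb_le pb_cosh) => z _ _.
by rewrite [leRHS]ger0_norm ?norm_sinh_le// ltW// cosh_gt0.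
Qed.

Lemma pb_snd : polybounded (fun z => z.2).
Proof.
apply: (pb_le pb_B) => z _ z2; have := shiftcosh_ge1 z2; have := cosh_gt0 z.1.
by move=> c0 B1; rewrite !ger0_norm /B; lra.
Qed.

Lemma pb_powR : polybounded (fun z => z.2 `^ s).
Proof.
have [n sn] : exists n : nat, s <= n%:R.
  by exists (Num.truncn s).+1; rewrite ltW// truncnS_gt.
apply: (pb_le (pb_pow n pb_B)) => z _ z2; have B1 := shiftcosh_ge1 z2.
rewrite !ger0_norm ?powR_ge0 ?exprn_ge0//; try lra.
rewrite -powR_mulrn; last lra.
apply: (@le_trans _ _ (B z `^ s)).
  apply: le_powRl; [exact: ltW|exact: ltW|].
  by rewrite lerDr ltW// cosh_gt0.
exact: ler_powR.
Qed.

Lemma pb_cos (a : R) : polybounded (fun z => cos (a * z.1)).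
Proof. by apply: (pb_le (pb_cst 1)) => z _ _; rewrite normr1 cos_max. Qed.

Lemma pb_sin (a : R) : polybounded (fun z => sin (a * z.1)).
Proof. by apply: (pb_le (pb_cst 1)) => z _ _; rewrite normr1 sin_max. Qed.

(** The decay e^(-B) is traded for e^(-v) e^(-w) through B >= v + w, which yields a majorant of
    product form. *)
Lemma pb_gauss h x : 0 < x -> polybounded h -> exists2 C : R, 0 <= C &
  forall z, 0 <= z.1 -> 0 < z.2 ->
    `|h z * expR (- (x * B z ^+ 2))| <= C * (expR (- z.1) * expR (- z.2)).
Proof.
move=> x0 [K [m [K0 H]]]; exists (K * (m`!%:R * expR x^-1)).
  by rewrite !mulr_ge0// expR_ge0.
move=> z z1 z2; have B1 := shiftcosh_ge1 z2.
rewrite normrM [`|expR _|]ger0_norm ?expR_ge0//.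
apply: (@le_trans _ _ (K * (B z ^+ m * expR (- (x * B z ^+ 2))))).
  by rewrite [leRHS]mulrA ler_wpM2r ?expR_ge0// H.
rewrite -[leRHS]mulrA ler_wpM2l//.
apply: (le_trans (exprn_gauss_le m x0 _)); first lra.
rewrite ler_wpM2l ?mulr_ge0 ?expR_ge0// -expRD ler_expR.
by have := shiftcosh_ge z; lra.
Qed.

Lemma pb_cvg_v h x w : 0 < x -> 0 < w -> polybounded h ->
  h (v, w) * expR (- (x * B (v, w) ^+ 2)) @[v --> +oo] --> (0 : R).
Proof.
move=> x0 w0 /(pb_gauss x0)[C C0 H]; apply: (@expR_cvgy R (C * expR (- w))) => v v0.
by rewrite (le_trans (H (v, w) (ltW v0) w0))//= mulrAC mulrA.
Qed.

Lemma pb_cvg_w h x v : 0 < x -> 0 < v -> polybounded h ->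
  h (v, w) * expR (- (x * B (v, w) ^+ 2)) @[w --> +oo] --> (0 : R).
Proof.
move=> x0 v0 /(pb_gauss x0)[C C0 H]; apply: (@expR_cvgy R (C * expR (- v))) => w w0.
by rewrite (le_trans (H (v, w) (ltW v0) w0))//= mulrA.
Qed.

Lemma pb_integrable_v h x w : 0 < x -> 0 < w -> polybounded h ->
  measurable_fun hl (fun v => h (v, w)) ->
  leb.-integrable hl (EFin \o (fun v => h (v, w) * expR (- (x * B (v, w) ^+ 2)))).
Proof.
move=> x0 w0 /(pb_gauss x0)[C C0 H] mh.
have ie := @integrable_ge0 _ _ R leb hl (fun v => expR (- (1 * v))) 1^-1.
have {}ie := ie (measurable_itv _) _ (fun v _ => expR_ge0 _) (integral_expR_scale ltr01).
apply: (@integrable_le _ _ _ leb hl _ (fun v => C * expR (- w) * expR (- (1 * v)))) => //.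
- by rewrite /B; mfun.
- move=> v /hl_gt0 v0.
  by rewrite (le_trans (H (v, w) (ltW v0) w0))//= mul1r mulrAC mulrA.
- rewrite (_ : _ \o _ = fun v => (C * expR (- w))%:E * (expR (- (1 * v)))%:E)%E//.
  by apply: integrableZl => //; apply: ie; mfun.
Qed.

Lemma pb_integrable_w h x v : 0 < x -> 0 < v -> polybounded h ->
  measurable_fun hl (fun w => h (v, w)) ->
  leb.-integrable hl (EFin \o (fun w => h (v, w) * w `^ (s - 1) * expR (- (x * B (v, w) ^+ 2)))).
Proof.
move=> x0 v0 /(pb_gauss x0)[C C0 H] mh.
apply: (@integrable_le _ _ _ leb hl _ (fun w => C * expR (- v) * (w `^ (s - 1) * expR (- w)))) => //.
- by rewrite /B; mfun.
- move=> w /hl_gt0 w0.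
  rewrite mulrAC normrM [`|_ `^ _|]ger0_norm ?powR_ge0//.
  rewrite [leRHS]mulrA [leRHS]mulrAC ler_wpM2r ?powR_ge0//.
  by rewrite (le_trans (H (v, w) (ltW v0) w0))//= mulrA.
- rewrite (_ : _ \o _ = fun w => (C * expR (- v))%:E * (w `^ (s - 1) * expR (- w))%:E)%E//.
  by apply: integrableZl => //; exact: integrable_gamma.
Qed.

Lemma integrable_exp_gamma :
  (leb \x leb)%E.-integrable D
    (EFin \o (fun z => expR (- z.1) * (z.2 `^ (s - 1) * expR (- z.2)))).
Proof.
apply: (@integrable_ge0 _ _ R _ _ _ (Gamma s)) => //.
- exact: measurableX.
- by mfun.
- by move=> z _; rewrite !mulr_ge0 ?powR_ge0 ?expR_ge0.
- rewrite tonelli12_rect//; last 2 first.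
  + by apply/measurable_EFinP; mfun.
  + by move=> z _; rewrite lee_fin !mulr_ge0 ?powR_ge0 ?expR_ge0.
  have e v : (\int[leb]_(w in hl) (expR (- v) * (w `^ (s - 1) * expR (- w)))%:E =
      (Gamma s)%:E * (expR (- (1 * v)))%:E)%E.
    rewrite mul1r muleC -GammaE// -ge0_integralZl//.
    - by apply/measurable_EFinP; mfun.
    - by move=> w _; rewrite lee_fin mulr_ge0 ?powR_ge0 ?expR_ge0.
  under eq_integral do rewrite /= e.
  rewrite ge0_integralZl// ?integral_expR_scale//.
  + by rewrite invr1 mule1.
  + by apply/measurable_EFinP; mfun.
  + by rewrite lee_fin ltW// Gamma_gt0.
Qed.

Lemma pb_integrable h x : 0 < x -> polybounded h -> measurable_fun D h ->
  (leb \x leb)%E.-integrable D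
    (EFin \o (fun z => h z * z.2 `^ (s - 1) * expR (- (x * B z ^+ 2)))).
Proof.
move=> x0 /(pb_gauss x0)[C C0 H] mh.
apply: (@integrable_le _ (measurableTypeR R * measurableTypeR R)%type R (leb \x leb)%E D _
  (fun z => C * (expR (- z.1) * (z.2 `^ (s - 1) * expR (- z.2))))).
- exact: measurableX.
- by rewrite /B; mfun.
- move=> z [/hl_gt0 z1 /hl_gt0 z2].
  rewrite mulrAC normrM [`|_ `^ _|]ger0_norm ?powR_ge0//.
  rewrite [leRHS](_ : _ = C * (expR (- z.1) * expR (- z.2)) * z.2 `^ (s - 1)); last by ring.
  by rewrite ler_wpM2r ?powR_ge0// H// ltW.
- rewrite (_ : _ \o _ = fun z => C%:E * (expR (- z.1) * (z.2 `^ (s - 1) * expR (- z.2)))%:E)%E//.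
  by apply: integrableZl; [exact: measurableX|exact: integrable_exp_gamma].
Qed.

End kernel_domination.

Ltac pb := repeat first [exact: pb_cst | exact: pb_cos | exact: pb_sin | exact: pb_cosh | exact: pb_sinh | exact: pb_snd | exact: pb_B
  | apply: pb_opp | apply: pb_add | apply: pb_pow | apply: pb_mul | apply: pb_powR].
Lemma integrable_addf d (T : measurableType d) (R : realType) (mu : {measure set T -> \bar R})
    (D : set T) (f g : T -> R) : measurable D ->
  mu.-integrable D (EFin \o f) -> mu.-integrable D (EFin \o g) ->
  mu.-integrable D (EFin \o (fun x => f x + g x)).
Proof. by move=> mD fi gi; exact: (integrableD mD fi gi). Qed.

Lemma integrable_scale d (T : measurableType d) (R : realType) (mu : {measure set T -> \bar R})
    (D : set T) (k : R) (f : T -> R) : measurable D ->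
  mu.-integrable D (EFin \o f) -> mu.-integrable D (EFin \o (fun x => k * f x)).
Proof. by move=> mD fi; exact: (integrableZl mD k fi). Qed.

Section whittaker_integral.
Variables (R : realType) (mu tau : R) (hmu : mu < 1 / 2).
Local Notation leb := (@lebesgue_measure R).
Local Notation hl := (`]0%R, +oo[%classic : set R).
Local Notation D := (hl `*` hl).
Local Notation B := (@shiftcosh R).
Local Notation s := (1 - 2 * mu).
Local Notation c := (1 - mu).
Implicit Types (x y v w : R) (z : R * R) (h : R * R -> R).

Let s0 : 0 < s. Proof. by move: hmu; lra. Qed.

(** The index [j] counts derivatives in x: each one brings a factor -B^2 out of the exponential. *)
Definition Vker j x z : R :=
  cos (tau * z.1) * (B z * (- B z ^+ 2) ^+ j) * z.2 `^ (s - 1) * expR (- (x * B z ^+ 2)).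

Definition Vint j x : R := \int[(leb \x leb)%E]_(z in D) Vker j x z.

Let pbV j : polybounded (fun z => cos (tau * z.1) * (B z * (- B z ^+ 2) ^+ j)).
Proof. by pb. Qed.

Lemma integrable_Vker j x : 0 < x -> (leb \x leb)%E.-integrable D (EFin \o Vker j x).
Proof. by move=> x0; apply: pb_integrable => //; rewrite /shiftcosh; mfun. Qed.

Lemma hasder_Vker j x z : hasder x (Vker j ^~ z) (Vker j.+1 x z).
Proof.
by rewrite /Vker; der => /=; rewrite [(- B z ^+ 2) ^+ j.+1]exprS; ring.
Qed.

(** For y > x/2 the exponential is at most its value at x/2, so the absolute value of the
    differentiated kernel at x/2 is a majorant on a neighbourhood of x. *)
Lemma hasder_Vint j x : 0 < x -> hasder x (Vint j) (Vint j.+1 x).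
Proof.
move=> x0.
have mD : measurable (D : set (measurableTypeR R * measurableTypeR R)%type).
  by apply: measurableX.
pose G z : R := `|Vker j.+1 (x / 2) z|.
have Ix : `]x / 2, x + 1[%classic x by rewrite /= in_itv/=; lra.
have I0 y : `]x / 2, x + 1[%classic y -> x / 2 < y by rewrite /= in_itv/= => /andP[].
have If y : `]x / 2, x + 1[%classic y -> (leb \x leb)%E.-integrable D (EFin \o Vker j y).
  by move=> /I0 xy; apply: integrable_Vker; lra.
have dV y z : derive1 (Vker j ^~ z) y = Vker j.+1 y z.
  by have [_ <-] := hasder_Vker j y z; rewrite derive1E.
have df y z : `]x / 2, x + 1[%classic y -> D z -> derivable (Vker j ^~ z) y 1.
  by move=> _ _; have [] := hasder_Vker j y z.
have iG : (leb \x leb)%E.-integrable D (EFin \o G).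
  have := integrable_norm (@integrable_Vker j.+1 (x / 2) _); apply; lra.
have G0 z : 0 <= G z by rewrite /G normr_ge0.
have GV y z : `]x / 2, x + 1[%classic y -> D z -> `|partial1of2 (Vker j) y z| <= G z.
  move=> /I0 xy _; rewrite /partial1of2 dV /G /Vker !normrM.
  rewrite ler_wpM2l// !ger0_norm ?expR_ge0// ler_expR lerN2 ler_wpM2r ?sqr_ge0//.
  exact: ltW.
split; first exact: (derivable_under_integral mD Ix If df G0 iG GV).
have := differentiation_under_integral mD Ix If df G0 iG GV.
rewrite derive1E => ->; apply: eq_Rintegral => z _.
by rewrite -dV.
Qed.

(* The kernel [k(B) = B e^{-x B^2}] with [B = cosh v + w] satisfies
   [k'' / 4 + x (x d/dx) k + 3/2 x k = 0] and [x d/dx k = (B k' - k) / 2]; the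
   latter, after multiplication by [w^(s-1)], is up to a [w]-derivative a multiple
   of [cosh v k']. This turns Whittaker's operator in [x] into [d^2/dv^2 / 4]
   modulo the [w]-derivative of [Yw]. *)
Let Yw x v w : R := w `^ s *
  ((cosh v / 4 * (1 - 2 * x * B (v, w) ^+ 2) +
    (c * B (v, w) - x * B (v, w) ^+ 3) / 2) * expR (- (x * B (v, w) ^+ 2))).

Let dYw x v w : R :=
  ((s * (cosh v / 4 * (1 - 2 * x * B (v, w) ^+ 2) + (c * B (v, w) - x * B (v, w) ^+ 3) / 2)
   + w * (- 2 * x * B (v, w) * (cosh v / 4 * (1 - 2 * x * B (v, w) ^+ 2) + (c * B (v, w) - x * B (v, w) ^+ 3) / 2)
   - x * cosh v * B (v, w) + (c - 3 * x * B (v, w) ^+ 2) / 2)) * w `^ (s - 1)) *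
  expR (- (x * B (v, w) ^+ 2)).

(** With k = B e^(-x B^2) this is cos (tau v) dk/dv minus k times the derivative of cos (tau v). Its
    own v-derivative is cos (tau v) (d^2k/dv^2 + tau^2 k): two integrations by parts in one. *)
Let Zv x w v : R := (cos (tau * v) * (sinh v * (1 - 2 * x * B (v, w) ^+ 2)) +
   tau * sin (tau * v) * B (v, w)) * expR (- (x * B (v, w) ^+ 2)).

Let dZv x w v : R := (cos (tau * v) * (cosh v * (1 - 2 * x * B (v, w) ^+ 2) +
   sinh v ^+ 2 * (- 6 * x * B (v, w) + 4 * x ^+ 2 * B (v, w) ^+ 3) + tau ^+ 2 * B (v, w))) *
   expR (- (x * B (v, w) ^+ 2)).

Let hasder_Yw x v w : 0 < w -> hasder w (Yw x v) (dYw x v w).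
Proof.
move=> w0; rewrite /Yw /dYw /shiftcosh/=; der => //=.
have -> : w `^ s = w * w `^ (s - 1).
  by rewrite mulr_powRB1// ltW.
by field.
Qed.

Let hasder_Zv x w v : hasder v (Zv x w) (dZv x w v).
Proof. rewrite /Zv /dZv /shiftcosh/=; by der => /=; field. Qed.

(** On the left stands Whittaker's operator, conjugated by the prefactor of [Wfun], applied to the
    kernel. Once sinh^2 is eliminated, field arithmetic decides. *)
Let kernel_identity x v w : 0 < w ->
  x ^+ 2 * Vker 2 x (v, w) + (1 + 2 * c) * (x * Vker 1 x (v, w)) + c ^+ 2 * Vker 0 x (v, w)
  + x ^+ 2 * Vker 1 x (v, w) + 3 / 2 * x * Vker 0 x (v, w) + tau ^+ 2 / 4 * Vker 0 x (v, w)
  = w `^ (s - 1) * dZv x w v / 4 + cos (tau * v) * dYw x v w.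
Proof.
move=> w0; rewrite /Vker /dZv /dYw /= expr0 mulr1 expr1.
have -> : sinh v ^+ 2 = cosh v ^+ 2 - 1 by have := cosh2Bsinh2 v; lra.
rewrite /shiftcosh/=; by field.
Qed.

Let mZ x : measurable_fun D (fun z => z.2 `^ (s - 1) * dZv x z.2 z.1).
Proof. by rewrite /dZv /shiftcosh/=; mfun. Qed.

Let mY x : measurable_fun D (fun z => cos (tau * z.1) * dYw x z.1 z.2).
Proof. by rewrite /dYw /shiftcosh/=; mfun. Qed.

Let pbZ x : polybounded (fun z => cos (tau * z.1) * (cosh z.1 * (1 - 2 * x * B z ^+ 2) +
   sinh z.1 ^+ 2 * (- 6 * x * B z + 4 * x ^+ 2 * B z ^+ 3) + tau ^+ 2 * B z)).
Proof. by pb. Qed.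

Let pbY x : polybounded (fun z =>
  (s * (cosh z.1 / 4 * (1 - 2 * x * B z ^+ 2) + (c * B z - x * B z ^+ 3) / 2)
   + z.2 * (- 2 * x * B z * (cosh z.1 / 4 * (1 - 2 * x * B z ^+ 2) + (c * B z - x * B z ^+ 3) / 2)
   - x * cosh z.1 * B z + (c - 3 * x * B z ^+ 2) / 2))).
Proof. by pb. Qed.

Let integrable_Z x : 0 < x -> (leb \x leb)%E.-integrable D
  (EFin \o (fun z => z.2 `^ (s - 1) * dZv x z.2 z.1)).
Proof.
move=> x0; have := pb_integrable s0 x0 (pbZ x).
set h := (fun z => _ * _ * _).
have -> : h = fun z => z.2 `^ (s - 1) * dZv x z.2 z.1.
  by apply/funext => -[v w]; rewrite /h /dZv/=; ring.
by apply; rewrite /shiftcosh; mfun.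
Qed.

Let integrable_Y x : 0 < x -> (leb \x leb)%E.-integrable D
  (EFin \o (fun z => cos (tau * z.1) * dYw x z.1 z.2)).
Proof.
move=> x0; have := pb_integrable s0 x0 (pb_mul (pb_cos tau) (pbY x)).
set h := (fun z => _ * _ * _).
have -> : h = fun z => cos (tau * z.1) * dYw x z.1 z.2.
  by apply/funext => -[v w]; rewrite /h /dYw/=; ring.
by apply; rewrite /shiftcosh; mfun.
Qed.

(** Both boundary terms vanish: at v = 0 because sinh and sin do, at infinity by Gaussian decay. *)
Let integral_dZv x w : 0 < x -> 0 < w ->
  (\int[leb]_(v in hl) (dZv x w v)%:E = 0)%E.
Proof.
move=> x0 w0; have -> : 0%E = (0 - 0 : R)%:E by rewrite subrr.
apply: (@FTC0y _ (Zv x w)).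
- by move=> v _; exact: hasder_Zv.
- by move=> v _; rewrite /dZv /shiftcosh/=; apply: der_continuous; repeat der_step.
- have := der_cvg_right (hasder_Zv x w 0); apply.
  by rewrite /Zv sinh0 mulr0 sin0 mul0r !mulr0 mul0r addr0 mul0r.
- have := @pb_cvg_v _ (fun z => cos (tau * z.1) * (sinh z.1 * (1 - 2 * x * B z ^+ 2)) +
   tau * sin (tau * z.1) * B z) x w x0 w0; apply; pb.
- have := pb_integrable_v x0 w0 (pbZ x); apply; rewrite /shiftcosh/=; mfun.
Qed.

(** At w = 0 the boundary term is killed by w^s, since s > 0; at infinity by Gaussian decay. *)
Let integral_dYw x v : 0 < x -> 0 < v ->
  (\int[leb]_(w in hl) (dYw x v w)%:E = 0)%E.
Proof.
move=> x0 v0; have -> : 0%E = (0 - 0 : R)%:E by rewrite subrr.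
apply: (@FTC0y _ (Yw x v)).
- by move=> w w0; exact: hasder_Yw.
- move=> w w0; rewrite /dYw /shiftcosh/=; apply: der_continuous; repeat der_step.
- rewrite /Yw -[0 in X in _ --> X](mul0r ((cosh v / 4 * (1 - 2 * x * B (v, 0) ^+ 2) +
    (c * B (v, 0) - x * B (v, 0) ^+ 3) / 2) * expR (- (x * B (v, 0) ^+ 2)))).
  apply: cvgM; first exact: powR_cvg0.
  apply: (der_cvg_right _ erefl); rewrite /shiftcosh/=; repeat der_step.
- have := @pb_cvg_w _ (fun z => z.2 `^ s *
  (cosh z.1 / 4 * (1 - 2 * x * B z ^+ 2) +
    (c * B z - x * B z ^+ 3) / 2)) x v x0 v0.
  rewrite (_ : (fun w => _) = Yw x v); last by apply/funext => w; rewrite /Yw/= -mulrA.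
  by apply; pb.
- have := pb_integrable_w s0 x0 v0 (pbY x).
  by apply; rewrite /shiftcosh/=; mfun.
Qed.

(** Fubini is used in opposite orders: the v-derivative is integrated first in v and the
    w-derivative first in w, so that both inner integrals are 0. *)
Lemma Vint_ode x : 0 < x ->
  x ^+ 2 * Vint 2 x + ((1 + 2 * c) * x + x ^+ 2) * Vint 1 x +
  (c ^+ 2 + 3 / 2 * x + tau ^+ 2 / 4) * Vint 0 x = 0.
Proof.
move=> x0.
have mD : measurable (D : set (measurableTypeR R * measurableTypeR R)%type).
  by apply: measurableX.
have V2 := integrable_Vker 2 x0; have V1 := integrable_Vker 1 x0.
have V0 := integrable_Vker 0 x0.
have iZ := integrable_Z x0; have iY := integrable_Y x0.
rewrite /Vint -!RintegralZl// -!RintegralD//; last 4 first.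
- by apply: integrable_addf => //; apply: integrable_scale.
- exact: integrable_scale.
- exact: integrable_scale.
- exact: integrable_scale.
transitivity (\int[(leb \x leb)%E]_(z in D)
    (4^-1 * (z.2 `^ (s - 1) * dZv x z.2 z.1) + cos (tau * z.1) * dYw x z.1 z.2)).
  apply: eq_Rintegral => -[v w]; rewrite inE => -[_ /hl_gt0/= w0].
  by rewrite [4^-1 * _]mulrC -kernel_identity//; ring.
rewrite RintegralD//; last exact: integrable_scale.
rewrite RintegralZl// /Rintegral -(fubini21_rect _ _ iZ)// -(fubini12_rect _ _ iY)//.
rewrite [X in 4^-1 * fine X]integral0_eq; last first.
  move=> w /hl_gt0 w0 /=.
  under eq_integral do rewrite EFinM.
  rewrite integralZl ?integral_dZv ?mule0//.
  by have := pb_integrable_v x0 w0 (pbZ x); apply; rewrite /shiftcosh/=; mfun.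
rewrite [X in _ + fine X]integral0_eq; last first.
  move=> v /hl_gt0 v0 /=.
  under eq_integral do rewrite EFinM.
  rewrite integralZl ?integral_dYw ?mule0//.
  by have := pb_integrable_w s0 x0 v0 (pbY x); apply; rewrite /shiftcosh/=; mfun.
by rewrite mulr0 addr0.
Qed.

End whittaker_integral.

Section whittaker_solution.
Variables (R : realType) (mu tau : R) (hmu : mu < 1 / 2).
Local Notation leb := (@lebesgue_measure R).
Local Notation hl := (`]0%R, +oo[%classic : set R).
Local Notation D := (hl `*` hl).
Local Notation B := (@shiftcosh R).
Local Notation s := (1 - 2 * mu).
Local Notation be := (3 / 2 - mu).
Local Notation V := (Vint mu tau).
Implicit Types (x y v w : R) (z : R * R) (h : R * R -> R).

Let s0 : 0 < s. Proof. by move: hmu; lra. Qed.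

(** The reciprocal of sqrt(pi)/2 Gamma(s) 2^(-s), the constant that Laplace's method produces; it
    normalises the solution at infinity. *)
Definition Wcst : R := 2 `^ (s + 1) / (Num.sqrt pi * Gamma s).

Definition Wfun x : R := Wcst * (x `^ be * expR (x / 2) * V 0 x).

Definition Wfun1 x : R := Wcst * ((be * x `^ (be - 1) + x `^ be / 2) * expR (x / 2) * V 0 x +
  x `^ be * expR (x / 2) * V 1 x).

Definition Wfun2 x : R := Wcst * ((be * (be - 1) * x `^ (be - 1 - 1) + be * x `^ (be - 1) + x `^ be / 4) * expR (x / 2) * V 0 x +
  (2 * be * x `^ (be - 1) + x `^ be) * expR (x / 2) * V 1 x + x `^ be * expR (x / 2) * V 2 x).

Lemma hasder_Wfun x : 0 < x -> hasder x Wfun (Wfun1 x).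
Proof.
move=> x0; have dV0 := hasder_Vint tau hmu 0 x0.
rewrite /Wfun; der => //=.
by rewrite /Wfun1; field.
Qed.

Lemma hasder_Wfun1 x : 0 < x -> hasder x Wfun1 (Wfun2 x).
Proof.
move=> x0; have dV0 := hasder_Vint tau hmu 0 x0; have dV1 := hasder_Vint tau hmu 1 x0.
rewrite /Wfun1; der => //=.
by rewrite /Wfun2; field.
Qed.

(** This is the equation for V multiplied by [Wcst] x^(be-2) e^(x/2). The term 1/4 + tau^2/4 is 1/4
    - nu^2 at nu = i tau / 2. *)
Lemma Wfun_ode x : 0 < x ->
  Wfun2 x + (- (1 / 4) + mu / x + (1 / 4 + tau ^+ 2 / 4) / x ^+ 2) * Wfun x = 0.
Proof.
move=> x0; have xn0 : x != 0 by rewrite gt_eqF.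
have pS p : x `^ p = x * x `^ (p - 1).
  by rewrite -{2}(powRr1 (ltW x0)) -powRD ?xn0 ?implybT//; congr (_ `^ _); ring.
rewrite -[RHS](mulr0 (Wcst * x `^ (be - 1 - 1) * expR (x / 2))).
rewrite -(Vint_ode tau hmu x0) /Wfun2 /Wfun (pS be) (pS (be - 1)).
by field.
Qed.

End whittaker_solution.

(** * Laplace's method at infinity *)

Lemma cvg_sinh_ratio (R : realType) : sinh y / y @[y --> (0 : R)^'] --> (1 : R).
Proof.
have [d e] := der_sinh (der_id (0 : R)).
have : h^-1 *: (sinh (h *: (1 : R) + 0) - sinh (0 : R)) @[h --> (0 : R)^'] --> (1 : R).
  have e1 : 'D_1 (@sinh R) (0 : R) = 1 by rewrite [LHS]e cosh0 mulr1.
  by rewrite -[X in _ --> X]e1; exact: d.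
apply: cvg_trans; apply: near_eq_cvg; near=> h.
by rewrite sinh0 subr0 addr0 /GRing.scale/= mulr1 mulrC.
Unshelve. all: by end_near. Qed.

Lemma sinh2E (R : realType) (x : R) : sinh x ^+ 2 = cosh x ^+ 2 - 1.
Proof. by have := cosh2Bsinh2 x; lra. Qed.

Section laplace_asymptotics.
Variables (R : realType) (s : R) (s0 : 0 < s) (g : R -> R) (M : R).
Hypotheses (cg : continuous g) (g0 : forall v, 0 <= g v) (gM : forall v, g v <= M).
Local Notation leb := (@lebesgue_measure R).
Local Notation hl := (`]0%R, +oo[%classic : set R).
Local Notation D := (hl `*` hl).
Local Notation B := (@shiftcosh R).
Implicit Types (x y v w : R) (z : R * R).

Definition weighted x z : R := g z.1 * (B z * (z.2 `^ (s - 1) * expR (- (x * B z ^+ 2)))).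

Let l1 x := x `^ (- 2^-1).

(** The substitution v -> x^(-1/2) v, w -> w / x zooms in on the origin, where B takes its minimum
    1; there x (B^2 - 1) tends to v^2 + 2 w. *)
Let rescaled x z : R := g (l1 x * z.1) * B (l1 x * z.1, x^-1 * z.2) * z.2 `^ (s - 1) *
  expR (- (x * (B (l1 x * z.1, x^-1 * z.2) ^+ 2 - 1))).

Let mg : measurable_fun setT g. Proof. exact: continuous_measurable_fun. Qed.

Let mgc d (T : measurableType d) (A : set T) (h : T -> R) : measurable_fun A h ->
  measurable_fun A (fun t => g (h t)).
Proof. exact: measurableT_comp. Qed.

Let mD : measurable (D : set (measurableTypeR R * measurableTypeR R)%type).
Proof. exact: measurableX. Qed.

Let m_weighted x : measurable_fun D (weighted x).
Proof. by rewrite /weighted /shiftcosh; mfun; apply: mgc; mfun. Qed.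

Let m_rescaled x : measurable_fun D (rescaled x).
Proof. by rewrite /rescaled /shiftcosh/=; mfun; apply: mgc; mfun. Qed.

Let B_ge0 z : 0 < z.2 -> 0 <= B z.
Proof. by move/shiftcosh_ge1; lra. Qed.

Let weighted_ge0 x z : 0 < z.2 -> 0 <= weighted x z.
Proof. by move=> z0; rewrite /weighted !mulr_ge0 ?powR_ge0 ?expR_ge0 ?B_ge0. Qed.

Let rescaledE x z : 0 < x -> 0 < z.2 ->
  rescaled x z = x `^ (s + 2^-1) * expR x * (l1 x * (x^-1 * weighted x (l1 x * z.1, x^-1 * z.2))).
Proof.
move=> x0 z0; rewrite /rescaled /weighted/= powRM ?invr_ge0 ?(ltW x0) ?(ltW z0)//.
have -> : - (x * (B (l1 x * z.1, x^-1 * z.2) ^+ 2 - 1)) =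
   x + - (x * B (l1 x * z.1, x^-1 * z.2) ^+ 2) by ring.
rewrite expRD -(powR_inv1 (ltW x0)) -powRrM.
have e : x `^ (s + 2^-1) * l1 x * x `^ (- 1) * x `^ (- 1 * (s - 1)) = 1.
  rewrite /l1 -!powRD ?(gt_eqF x0) ?implybT//.
  by rewrite [X in x `^ X](_ : _ = 0) ?powRr0//; field.
move: e; move: (x `^ (s + 2^-1)) (l1 x) (x `^ (- 1)) (x `^ (- 1 * (s - 1))) => a b d e abde.
by set A := (X in X = _); transitivity (a * b * d * e * A); [rewrite abde mul1r|rewrite /A; ring].
Qed.

(** The Jacobian x^(-3/2), the power x^(1-s) from the weight and the value e^(-x) at the minimum
    combine to the inverse of the prefactor. Nonnegativity allows the variables to be scaled one
    after the other. *)
Let integral_weighted x : 0 < x ->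
  ((x `^ (s + 2^-1) * expR x)%:E * \int[(leb \x leb)%E]_(z in D) (weighted x z)%:E =
   \int[(leb \x leb)%E]_(z in D) (rescaled x z)%:E)%E.
Proof.
move=> x0; have l0 : 0 < l1 x by exact: powR_gt0.
have mw : measurable_fun D (EFin \o weighted x) by exact/measurable_EFinP.
have w0 z : D z -> (0 <= (EFin \o weighted x) z)%E.
  by move=> [_ /hl_gt0 z2]; rewrite lee_fin weighted_ge0.
have mr : measurable_fun D (EFin \o rescaled x) by exact/measurable_EFinP.
have r0 z : D z -> (0 <= (EFin \o rescaled x) z)%E.
  move=> [_ /hl_gt0 z2]; rewrite lee_fin /rescaled.
  by rewrite !mulr_ge0 ?powR_ge0 ?expR_ge0 ?B_ge0//= mulr_gt0 ?invr_gt0.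
rewrite (tonelli12_rect leb leb _ _ mw w0)// (tonelli12_rect leb leb _ _ mr r0)//.
have F0 v : 0 < v -> (0 <= \int[leb]_(w in hl) (EFin \o weighted x) (v, w))%E.
  by move=> v0; apply: integral_ge0 => w w0'; apply: w0; split => //; rewrite /= in_itv/= v0.
have mF : measurable_fun hl (fun v => \int[leb]_(w in hl) (EFin \o weighted x) (v, w))%E.
  by apply: measurable_iter1_rect.
rewrite (integral_scale l0 mF F0).
have mF' : measurable_fun hl (fun v => \int[leb]_(w in hl) (EFin \o weighted x) ((l1 x * v)%R, w))%E.
  have := @measurable_iter1_rect _ _ (measurableTypeR R) (measurableTypeR R) R leb hl hl
    (measurable_itv _) (measurable_itv _) (fun z => (weighted x (l1 x * z.1, z.2))%:E).
  apply.
    by apply/measurable_EFinP; rewrite /weighted /shiftcosh/=; mfun; apply: mgc; mfun.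
  by move=> z [_ /hl_gt0 z2]; rewrite lee_fin weighted_ge0.
have l10 : (0 <= (l1 x)%:E)%E by rewrite lee_fin ltW.
rewrite -(ge0_integralZl leb _ mF' _ l10)//; last first.
  by move=> v /hl_gt0 v0; apply: F0; exact: mulr_gt0.
rewrite -ge0_integralZl//; last 3 first.
- by apply: emeasurable_funM => //.
- move=> v /hl_gt0 v0; apply: mule_ge0 => //; apply: F0; exact: mulr_gt0.
- by rewrite lee_fin mulr_ge0 ?powR_ge0 ?expR_ge0.
apply: eq_integral => v; rewrite inE => /hl_gt0 v0.
have mw1 : measurable_fun hl (fun w => (EFin \o weighted x) ((l1 x * v)%R, w)).
  by apply/measurable_EFinP; rewrite /weighted /shiftcosh/=; mfun.
have w01 w : 0 < w -> (0 <= (EFin \o weighted x) ((l1 x * v)%R, w))%E.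
  by move=> w0'; rewrite lee_fin weighted_ge0.
have xV : 0 < x^-1 by rewrite invr_gt0.
rewrite (integral_scale xV mw1 w01).
have mw2 : measurable_fun hl (fun w => (EFin \o weighted x) ((l1 x * v)%R, (x^-1 * w)%R)).
  by apply/measurable_EFinP; rewrite /weighted /shiftcosh/=; mfun.
have w02 w : hl w -> (0 <= (EFin \o weighted x) ((l1 x * v)%R, (x^-1 * w)%R))%E.
  by move=> /hl_gt0 w0'; rewrite lee_fin weighted_ge0// mulr_gt0.
rewrite muleA muleA -!EFinM -ge0_integralZl//; last first.
  by rewrite lee_fin !mulr_ge0 ?powR_ge0 ?expR_ge0 ?invr_ge0// ltW.
apply: eq_integral => w; rewrite inE => /hl_gt0 w0'.
by rewrite /= -EFinM rescaledE// !mulrA.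
Qed.

Let M0 : 0 <= M. Proof. exact: le_trans (g0 0) (gM 0). Qed.

(* [B <= e^{(B^2 - 1) / 2}] absorbs the prefactor, and [x (B^2 - 1) >= v^2 + 2 w]
   after the rescaling. *)
Let rescaled_le x z : 1 <= x -> 0 < z.1 -> 0 < z.2 ->
  `|rescaled x z| <= M * expR 2^-1 * (expR (- z.1) * (z.2 `^ (s - 1) * expR (- z.2))).
Proof.
move=> x1 z1 z2; have x0 : 0 < x by lra.
have l0 : 0 < l1 x by exact: powR_gt0.
have y0 : 0 < x^-1 * z.2 by rewrite mulr_gt0 ?invr_gt0.
have lz0 : 0 <= l1 x * z.1 by rewrite mulr_ge0// ltW.
have ll : x * l1 x ^+ 2 = 1.
  rewrite /l1 -powR_mulrn ?powR_ge0// -powRrM -{1}(powRr1 (ltW x0)) -powRD ?(gt_eqF x0) ?implybT//.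
  by rewrite [X in x `^ X](_ : _ = 0) ?powRr0//; field.
rewrite /rescaled.
set b := B _; have b1 : 1 <= b by exact: shiftcosh_ge1.
rewrite ger0_norm; last by rewrite !mulr_ge0 ?powR_ge0 ?expR_ge0//; lra.
have bb : z.1 ^+ 2 + 2 * z.2 <= x * (b ^+ 2 - 1).
  have sh : l1 x * z.1 <= sinh (l1 x * z.1) by apply: sinh_ge; rewrite mulr_ge0// ltW.
  have e1 : z.1 ^+ 2 <= x * sinh (l1 x * z.1) ^+ 2.
    rewrite -[leLHS]mul1r -ll -mulrA -exprMn ler_wpM2l ?(ltW x0)//.
    by rewrite ler_sqr// nnegrE// sinh_ge0.
  have e2 : 2 * z.2 <= x * (2 * cosh (l1 x * z.1) * (x^-1 * z.2)).
    rewrite (_ : x * _ = cosh (l1 x * z.1) * (2 * z.2)); last by field; rewrite gt_eqF.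
    by rewrite ler_peMl ?cosh_ge1// mulr_ge0// ltW.
  have e3 : 0 <= x * (x^-1 * z.2) ^+ 2 by rewrite mulr_ge0 ?sqr_ge0// ltW.
  have -> : x * (b ^+ 2 - 1) = x * sinh (l1 x * z.1) ^+ 2 +
      x * (2 * cosh (l1 x * z.1) * (x^-1 * z.2)) + x * (x^-1 * z.2) ^+ 2.
    by rewrite /b /shiftcosh/= sinh2E; ring.
  by move: e1 e2 e3; lra.
have be : b <= expR ((b ^+ 2 - 1) / 2).
  apply: le_trans (expR_ge1Dx _); rewrite -subr_ge0.
  by rewrite (_ : _ - _ = (b - 1) ^+ 2 / 2) ?divr_ge0 ?sqr_ge0//; field.
have key : b * expR (- (x * (b ^+ 2 - 1))) <= expR 2^-1 * (expR (- z.1) * expR (- z.2)).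
  apply: le_trans (ler_wpM2r (expR_ge0 _) be) _.
  rewrite -!expRD ler_expR.
  have h1 : (b ^+ 2 - 1) <= x * (b ^+ 2 - 1).
    rewrite ler_peMl// subr_ge0 -[1](expr1n _ 2) ler_sqr ?nnegrE//; lra.
  have h2 : 0 <= (z.1 - 1) ^+ 2 by exact: sqr_ge0.
  by move: bb h1 h2; rewrite sqrrB; lra.
rewrite (_ : _ * expR _ = g (l1 x * z.1) * (b * expR (- (x * (b ^+ 2 - 1)))) * z.2 `^ (s - 1)); last by ring.
rewrite (_ : M * _ * _ = M * (expR 2^-1 * (expR (- z.1) * expR (- z.2))) * z.2 `^ (s - 1)); last by ring.
rewrite ler_wpM2r ?powR_ge0// ler_pM ?gM ?mulr_ge0 ?expR_ge0//; lra.
Qed.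

Let limit_fun z : R := g 0 * (expR (- z.1 ^+ 2) * (z.2 `^ (s - 1) * expR (- (2 * z.2)))).

Let cvg_rescaled (u : nat -> R) z : (forall n, 1 <= u n) -> u n @[n --> \oo] --> +oo ->
  0 < z.1 -> 0 < z.2 -> rescaled (u n) z @[n --> \oo] --> limit_fun z.
Proof.
move=> u1 uy z1 z2; have u0 n : 0 < u n by have := u1 n; lra.
have uV : (u n)^-1 @[n --> \oo] --> (0 : R).
  by apply/gtr0_cvgV0 => //; apply: nearW.
have l0 : l1 (u n) @[n --> \oo] --> (0 : R).
  rewrite /l1; under eq_fun do rewrite powRN.
  apply/gtr0_cvgV0; first by apply: nearW => n; exact: powR_gt0.
  exact: (cvg_comp u (fun x => x `^ 2^-1) uy (cvgr_powR _)).
have ll x : 0 < x -> x * l1 x ^+ 2 = 1.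
  move=> x0; rewrite /l1 -powR_mulrn ?powR_ge0// -powRrM -{1}(powRr1 (ltW x0)) -powRD ?(gt_eqF x0) ?implybT//.
  by rewrite [X in x `^ X](_ : _ = 0) ?powRr0//; field.
have lz : l1 (u n) * z.1 @[n --> \oo] --> (0 : R).
  by rewrite -(mul0r z.1); apply: cvgM => //; exact: cvg_cst.
have wz : (u n)^-1 * z.2 @[n --> \oo] --> (0 : R).
  by rewrite -(mul0r z.2); apply: cvgM => //; exact: cvg_cst.
have cz : cosh (l1 (u n) * z.1) @[n --> \oo] --> (1 : R).
  by rewrite -(@cosh0 R); apply: (cvg_comp _ (@cosh R) lz); exact: continuous_cosh.
(* Since x [l1] x ^2 = 1, the expression is z.1^2 times the square of sinh y / y at y = [l1] x z.1,
   which tends to 0. *)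
have sz : u n * sinh (l1 (u n) * z.1) ^+ 2 @[n --> \oo] --> z.1 ^+ 2.
  have : (z.1 ^+ 2 * (sinh (l1 (u n) * z.1) / (l1 (u n) * z.1)) ^+ 2) @[n --> \oo] --> z.1 ^+ 2 * 1 ^+ 2.
    apply: cvgM; first exact: cvg_cst.
    apply: (@cvg_comp _ _ _ (fun n => sinh (l1 (u n) * z.1) / (l1 (u n) * z.1)) (fun t : R => t ^+ 2) _ (nbhs (1:R))); last exact: sqr_continuous.
    have := @cvg_sinh_ratio R; move/cvgr_dnbhsP; apply; split => //.
    by move=> n; rewrite mulf_neq0 ?gt_eqF// powR_gt0.
  rewrite expr1n mulr1; apply: cvg_trans; apply: near_eq_cvg; apply: nearW => n /=.
  have ln0 : 0 < l1 (u n) by exact: powR_gt0.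
  have := ll _ (u0 n) => e.
  rewrite -[LHS]mul1r -e; field; rewrite !gt_eqF//.
have Bz : B (l1 (u n) * z.1, (u n)^-1 * z.2) @[n --> \oo] --> (1 : R).
  by rewrite -[1]addr0 /shiftcosh/=; apply: cvgD.
have ez : u n * (B (l1 (u n) * z.1, (u n)^-1 * z.2) ^+ 2 - 1) @[n --> \oo] --> z.1 ^+ 2 + 2 * z.2.
  have : u n * sinh (l1 (u n) * z.1) ^+ 2 + cosh (l1 (u n) * z.1) * (2 * z.2) +
      (u n)^-1 * z.2 * z.2 @[n --> \oo] --> z.1 ^+ 2 + 1 * (2 * z.2) + 0 * z.2.
    apply: cvgD; [apply: cvgD => //|]; apply: cvgM => //; exact: cvg_cst.
  rewrite mul1r mul0r addr0; apply: cvg_trans; apply: near_eq_cvg; apply: nearW => n /=.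
  rewrite /shiftcosh/= sinh2E; field.
  by rewrite gt_eqF.
rewrite (_ : limit_fun z = g 0 * 1 * z.2 `^ (s - 1) * expR (- (z.1 ^+ 2 + 2 * z.2))); last first.
  by rewrite /limit_fun mulr1 opprD expRD; ring.
rewrite /rescaled; apply: cvgM; last first.
  apply: (cvg_comp _ (@expR R) (cvgN ez)); exact: continuous_expR.
apply: cvgM; last exact: cvg_cst.
by apply: cvgM => //; apply: (cvg_comp _ g lz); exact: cg.
Qed.

Let integral_limit : (\int[(leb \x leb)%E]_(z in D) (limit_fun z)%:E =
  (g 0 * (Num.sqrt pi / 2 * (Gamma s * 2 `^ (- s))))%:E)%E.
Proof.
rewrite tonelli12_rect//; last 2 first.
- by apply/measurable_EFinP; rewrite /limit_fun; mfun.
- by move=> z _; rewrite lee_fin !mulr_ge0 ?powR_ge0 ?expR_ge0.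
have e v : (\int[leb]_(w in hl) (limit_fun (v, w))%:E =
    (g 0 * (Gamma s * 2 `^ (- s)))%:E * (expR (- v ^+ 2))%:E)%E.
  rewrite EFinM -integral_gamma_scale// muleAC -EFinM -ge0_integralZl//.
  - by apply: eq_integral => w _; rewrite /limit_fun/= -EFinM mulrA.
  - by apply/measurable_EFinP; mfun.
  - by move=> w _; rewrite lee_fin mulr_ge0 ?powR_ge0 ?expR_ge0.
  - by rewrite lee_fin mulr_ge0 ?expR_ge0.
under eq_integral do rewrite /= e.
rewrite ge0_integralZl//.
- have -> : (\int[leb]_(v in hl) (expR (- v ^+ 2))%:E = (Num.sqrt pi / 2)%:E)%E.
    rewrite -integral0y_gauss integral_itv_obnd_cbnd//.
    by apply/measurable_EFinP; mfun.
  by rewrite -EFinM; congr (_%:E); ring.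
- by apply/measurable_EFinP; mfun.
- by rewrite lee_fin !mulr_ge0 ?powR_ge0// ltW// Gamma_gt0.
Qed.

Lemma integrable_weighted x : 0 < x ->
  (leb \x leb)%E.-integrable D (EFin \o weighted x).
Proof.
move=> x0; have pg : polybounded (fun z => g z.1 * B z).
  apply: pb_mul; last exact: pb_B.
  apply: (pb_le (pb_cst M)) => z _ _.
  by rewrite !ger0_norm.
have := pb_integrable s0 x0 pg.
set h := (fun z => _ * _ * _).
have -> : h = weighted x by apply/funext => z; rewrite /h /weighted; ring.
by apply; rewrite /shiftcosh; mfun; apply: mgc; mfun.
Qed.

Lemma cvg_integral_weighted :
  (x `^ (s + 2^-1) * expR x) * \int[(leb \x leb)%E]_(z in D) weighted x z @[x --> +oo] -->
  g 0 * (Num.sqrt pi / 2 * (Gamma s * 2 `^ (- s))).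
Proof.
have fineE x : 0 < x -> (x `^ (s + 2^-1) * expR x) * \int[(leb \x leb)%E]_(z in D) weighted x z =
    fine (\int[(leb \x leb)%E]_(z in D) (rescaled x z)%:E)%E.
  move=> x0; rewrite -integral_weighted// fineM//.
  by apply: integrable_fin_num => //; exact: integrable_weighted.
(* The majorant holds for x >= 1 only; the maximum with 1 leaves the tail of the sequence
   unchanged. *)
apply/cvg_pinftyP => u uy; pose u' n := Num.max 1 (u n).
have u'1 n : 1 <= u' n by rewrite le_max lexx.
have u'y : u' n @[n --> \oo] --> +oo.
  apply/cvgryPge => A; move/cvgryPge : uy => /(_ A).
  by apply: filterS => n An; rewrite le_max An orbT.
have : fine (\int[(leb \x leb)%E]_(z in D) (rescaled (u' n) z)%:E)%E @[n --> \oo] -->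
    g 0 * (Num.sqrt pi / 2 * (Gamma s * 2 `^ (- s))).
  apply: fine_cvg; rewrite -integral_limit.
  apply: (@dominated_cvgE _ (measurableTypeR R * measurableTypeR R)%type R (leb \x leb)%E D _ limit_fun
    (fun z => M * expR 2^-1 * (expR (- z.1) * (z.2 `^ (s - 1) * expR (- z.2))))) => //.
  - by move=> n; exact: m_rescaled.
  - by move=> z [/hl_gt0 z1 /hl_gt0 z2]; exact: cvg_rescaled.
  - by apply: integrable_scale => //; exact: integrable_exp_gamma.
  - by move=> n z [/hl_gt0 z1 /hl_gt0 z2]; exact: rescaled_le.
apply: cvg_trans; apply: near_eq_cvg; near=> n.
have un : 1 <= u n by near: n; move/cvgryPge : uy; exact.
have un0 : 0 < u n by exact: lt_le_trans un.
by rewrite (fineE _ un0) /u' max_r.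
Unshelve. all: by end_near. Qed.

End laplace_asymptotics.

Section whittaker_asymptotics.
Variables (R : realType) (mu tau : R) (hmu : mu < 1 / 2).
Local Notation leb := (@lebesgue_measure R).
Local Notation hl := (`]0%R, +oo[%classic : set R).
Local Notation D := (hl `*` hl).
Local Notation s := (1 - 2 * mu).
Implicit Types (x : R).

Let s0 : 0 < s. Proof. by move: hmu; lra. Qed.

Lemma Wfun_asymp :
  Wfun mu tau x / (expR (- (x / 2)) * x `^ mu) @[x --> +oo] --> (1 : R).
Proof.
(* The asymptotic lemma takes a nonnegative amplitude, so the cosine is the difference of 1 + cos
   and 1; their values 2 and 1 at v = 0 subtract to 1. *)
pose g1 v : R := 1 + cos (tau * v); pose g2 (v : R) : R := 1.
have cg1 : continuous g1.
  by move=> v; apply: der_continuous; rewrite /g1; repeat der_step.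
have cg2 : continuous g2 by move=> v; exact: cvg_cst.
have g10 v : 0 <= g1 v by rewrite /g1; have := cos_geN1 (tau * v); lra.
have g1M v : g1 v <= 2 by rewrite /g1; have := cos_le1 (tau * v); lra.
have g20 v : 0 <= g2 v by rewrite /g2.
have g2M v : g2 v <= 1 by rewrite /g2.
pose J g x := \int[(leb \x leb)%E]_(z in D) weighted s g x z.
have VE x : 0 < x -> Vint mu tau 0 x = J g1 x - J g2 x.
  move=> x0; rewrite /J -RintegralB//; last 3 first.
  - exact: measurableX.
  - exact: (integrable_weighted s0 cg1 g10 g1M).
  - exact: (integrable_weighted s0 cg2 g20 g2M).
  apply: eq_Rintegral => z _; rewrite /Vker /weighted /g1 /g2 expr0; ring.
have K0 : 0 < Num.sqrt pi / 2 * (Gamma s * 2 `^ (- s)).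
  by rewrite !mulr_gt0// ?Gamma_gt0 ?powR_gt0// ?invr_gt0// sqrtr_gt0 pi_gt0.
have Wc : Wcst mu * (Num.sqrt pi / 2 * (Gamma s * 2 `^ (- s))) = 1.
  have e : 2 `^ (s + 1) * 2 `^ (- s) = 2 :> R.
    rewrite -powRD ?pnatr_eq0 ?implybT//.
    by rewrite [X in 2 `^ X](_ : _ = 1) ?powRr1//; ring.
  rewrite /Wcst (_ : _ * _ = 2 `^ (s + 1) * 2 `^ (- s) / 2).
    by rewrite e mulfV.
  by field; rewrite !gt_eqF// ?Gamma_gt0// sqrtr_gt0 pi_gt0.
have h1 := cvg_integral_weighted s0 cg1 g10 g1M.
have h2 := cvg_integral_weighted s0 cg2 g20 g2M.
have h : Wcst mu * ((x `^ (s + 2^-1) * expR x) * J g1 x - (x `^ (s + 2^-1) * expR x) * J g2 x) @[x --> +oo] --> (1 : R).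
  rewrite -[X in _ --> X]Wc; apply: cvgM; first exact: cvg_cst.
  rewrite (_ : Num.sqrt pi / 2 * _ = g1 0 * (Num.sqrt pi / 2 * (Gamma s * 2 `^ (- s))) - g2 0 * (Num.sqrt pi / 2 * (Gamma s * 2 `^ (- s)))).
    exact: cvgB.
  by rewrite /g1 /g2 mulr0 cos0; ring.
apply: cvg_trans h; apply: near_eq_cvg; near=> x.
have x0 : 0 < x by near: x; exact: nbhs_pinfty_gt.
rewrite /Wfun VE// expRN.
have -> : x `^ (3 / 2 - mu) = x `^ (s + 2^-1) * x `^ mu.
  by rewrite -powRD ?(gt_eqF x0) ?implybT//; congr (_ `^ _); field.
have -> : expR x = expR (x / 2) * expR (x / 2) by rewrite -expRD; congr expR; field.
field.
by rewrite !gt_eqF ?powR_gt0 ?expR_gt0.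
Unshelve. all: by end_near. Qed.

End whittaker_asymptotics.

(** * Fourier sums of a Lipschitz function *)

Section segment.
Variable R : realType.
Local Notation leb := (@lebesgue_measure R).
Implicit Types (f g F : R -> R) (a b : R).

Lemma Rintegral_FTC F f a b : a < b -> (forall x, hasder x F (f x)) -> continuous f ->
  \int[leb]_(x in `[a, b]) f x = F b - F a.
Proof.
move=> ab dF cf.
have cF : continuous F by move=> x; exact: (der_continuous (dF x)).
rewrite /Rintegral (@continuous_FTC2 R f F a b)// -?EFinB//.
- exact: continuous_subspaceT.
- split=> [x _||]; first by have [] := dF x.
  + by apply: cvg_at_right_filter; exact: cF.
  + by apply: cvg_at_left_filter; exact: cF.
- by move=> x _; have [_ <-] := dF x; rewrite derive1E.
Qed.

(** On a set of finite measure these functions form an algebra of integrable functions, so the side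
    conditions of linearity reduce to closure rules. *)
Definition bm (D : set R) f : Prop :=
  measurable_fun (D : set (measurableTypeR R)) f /\ exists M : R, forall x, D x -> `|f x| <= M.

Variable D : set R.
Hypotheses (mD : measurable (D : set (measurableTypeR R))) (fD : (leb D < +oo)%E).

Lemma bm_integrable f : bm D f -> leb.-integrable D (EFin \o f).
Proof.
move=> [mf [M fM]]; apply: measurable_bounded_integrable => //.
exists M; split; first by rewrite num_real.
by move=> N MN x Dx /=; apply: (le_trans (fM x Dx)); exact: ltW.
Qed.

Lemma bm_add f g : bm D f -> bm D g -> bm D (fun x => f x + g x).
Proof.
move=> [mf [M fM]] [mg [N gN]]; split; first exact: mf_add.
exists (M + N) => x Dx; rewrite (le_trans (ler_normD _ _))// lerD//; [exact: fM|exact: gN].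
Qed.

Lemma bm_mul f g : bm D f -> bm D g -> bm D (fun x => f x * g x).
Proof.
move=> [mf [M fM]] [mg [N gN]]; split; first exact: mf_mul.
by exists (M * N) => x Dx; rewrite normrM ler_pM// ?fM// gN.
Qed.

Lemma bm_opp f : bm D f -> bm D (fun x => - f x).
Proof.
move=> [mf [M fM]]; split; first exact: mf_opp.
by exists M => x Dx; rewrite normrN fM.
Qed.

Lemma bm_cst a : bm D (fun=> a).
Proof. by split; [exact: mf_cst|exists `|a|]. Qed.

Lemma bm_sum n (f : nat -> R -> R) : (forall i, bm D (f i)) ->
  bm D (fun x => \sum_(i < n) f i x).
Proof.
move=> fi; elim: n => [|n IH].
  by under eq_fun do rewrite big_ord0; exact: bm_cst.
by under eq_fun do rewrite big_ord_recr/=; exact: bm_add.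
Qed.

Lemma bm_cos (h : R -> R) : measurable_fun (D : set (measurableTypeR R)) h -> bm D (fun x => cos (h x)).
Proof. by move=> mh; split; [mfun|exists 1 => x _; exact: cos_max]. Qed.

Lemma bm_sin (h : R -> R) : measurable_fun (D : set (measurableTypeR R)) h -> bm D (fun x => sin (h x)).
Proof. by move=> mh; split; [mfun|exists 1 => x _; exact: sin_max]. Qed.

Lemma bm_RintegralD f g : bm D f -> bm D g ->
  \int[leb]_(x in D) (f x + g x) = \int[leb]_(x in D) f x + \int[leb]_(x in D) g x.
Proof. by move=> bf bg; apply: RintegralD => //; exact: bm_integrable. Qed.

Lemma bm_RintegralZ k f : bm D f ->
  \int[leb]_(x in D) (k * f x) = k * \int[leb]_(x in D) f x.
Proof. by move=> bf; apply: RintegralZl => //; exact: bm_integrable. Qed.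

Lemma bm_RintegralB f g : bm D f -> bm D g ->
  \int[leb]_(x in D) (f x - g x) = \int[leb]_(x in D) f x - \int[leb]_(x in D) g x.
Proof. by move=> bf bg; apply: RintegralB => //; exact: bm_integrable. Qed.

Lemma bm_Rintegral_sum n (f : nat -> R -> R) : (forall i, bm D (f i)) ->
  \int[leb]_(x in D) (\sum_(i < n) f i x) = \sum_(i < n) \int[leb]_(x in D) f i x.
Proof.
move=> fi; elim: n => [|n IH].
  rewrite big_ord0 (@eq_Rintegral _ _ _ _ _ (fun=> 0)) ?Rintegral_cst ?mul0r//.
  by move=> x _; rewrite big_ord0.
rewrite big_ord_recr/= -IH -bm_RintegralD//; last exact: bm_sum.
by apply: eq_Rintegral => x _; rewrite big_ord_recr.
Qed.

Lemma Rintegral_bound f M : measurable_fun (D : set (measurableTypeR R)) f ->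
  (forall x, D x -> `|f x| <= M) -> `|\int[leb]_(x in D) f x| <= M * fine (leb D).
Proof.
move=> mf fM; have bf : bm D f by split=> //; exists M.
apply: (le_trans (le_normr_Rintegral mD (bm_integrable bf))).
rewrite -Rintegral_cst//; apply: le_Rintegral => //.
- by apply: bm_integrable; split; [exact: mf_norm|exists M => x Dx; rewrite normr_id fM].
- exact: bm_integrable (bm_cst M).
Qed.

End segment.

Section fourier.
Variable R : realType.
Local Notation leb := (@lebesgue_measure R).
Local Notation I := (`[- pi, pi]%classic : set R).
Implicit Types (u v t x y : R).

Let pi0 : 0 < pi :> R. Proof. exact: pi_gt0. Qed.

Lemma Npi_lt_pi : - pi < pi :> R. Proof. by rewrite gtrN. Qed.

Lemma lebI : (leb I = (2 * pi)%:E)%E.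
Proof.
by rewrite lebesgue_measure_itv/= lte_fin Npi_lt_pi -EFinD opprK mulr_natl.
Qed.

Lemma mI : measurable (I : set (measurableTypeR R)). Proof. exact: measurable_itv. Qed.

Lemma fI : (leb I < +oo)%E. Proof. by rewrite lebI ltry. Qed.

Lemma sin_natpi n : sin (n%:R * pi) = 0 :> R.
Proof.
elim: n => [|n IH]; first by rewrite mul0r sin0.
by rewrite -natr1 mulrDl mul1r sinDpi IH oppr0.
Qed.

Lemma cos_natpi n : cos (n%:R * pi) = (- 1) ^+ n :> R.
Proof.
elim: n => [|n IH]; first by rewrite mul0r cos0.
by rewrite -natr1 mulrDl mul1r cosDpi IH exprS mulN1r.
Qed.

Lemma integral_cos_shift n u : \int[leb]_(v in I) cos (n%:R * (u - v)) = if n == 0 then 2 * pi else 0.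
Proof.
case: n => [|n] /=.
  rewrite (@eq_Rintegral _ _ _ _ _ (fun=> 1)) => [|v _]; last by rewrite mul0r cos0.
  by rewrite (@Rintegral_cst _ _ _ leb _ mI) mul1r; exact: (congr1 fine lebI).
have n0 : n.+1%:R != 0 :> R by rewrite pnatr_eq0.
rewrite (@Rintegral_FTC _ (fun v => - (sin (n.+1%:R * (u - v)) / n.+1%:R))).
- rewrite !mulrBr opprK mulrN opprK sinB sinD sin_natpi !mulr0; ring.
- exact: Npi_lt_pi.
- by move=> v; der => /=; field.
- by move=> v; apply: der_continuous; repeat der_step.
Qed.

(** Half-integer sines: by [dirichlet_kernel], the error of a Fourier sum is an integral against one
    of them. *)
Let e_ u n v := sin ((n%:R + 2^-1) * (u - v)).

Let bme u n : bm I (e_ u n).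
Proof. by apply: bm_sin; mfun. Qed.

(** The product formula turns the two half-integers into the integers k - j and j + k + 1, and the
    second is never 0. *)
Let e_orthogonal u j k : (j <= k)%N ->
  \int[leb]_(v in I) (e_ u j v * e_ u k v) = if j == k then pi else 0.
Proof.
move=> jk.
have E v : e_ u j v * e_ u k v =
    2^-1 * (cos ((k - j)%:R * (u - v)) - cos ((j + k).+1%:R * (u - v))).
  rewrite /e_; set a := (j%:R + 2^-1) * _; set b := (k%:R + 2^-1) * _.
  have -> : (k - j)%:R * (u - v) = b - a by rewrite natrB// /a /b; ring.
  have -> : (j + k).+1%:R * (u - v) = b + a by rewrite -natr1 natrD /a /b; field.
  by rewrite cosB cosD; field.
under eq_Rintegral do rewrite E.
have bc n : bm I (fun v => cos (n%:R * (u - v))) by apply: bm_cos; mfun.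
rewrite bm_RintegralZ; [|exact: mI|exact: fI|by apply: bm_add; [|exact: bm_opp]].
rewrite bm_RintegralB; [|exact: mI|exact: fI|exact: bc|exact: bc].
rewrite !integral_cos_shift/= subr0 subn_eq0.
have -> : (k <= j)%N = (j == k) by rewrite eqn_leq jk.
by case: eqP => _; rewrite ?mulr0//; field.
Qed.

Section bessel.
Variables (q : R -> R) (u : R).
Hypothesis bq : bm I q.

Let c k := pi^-1 * \int[leb]_(v in I) (q v * e_ u k v).
Let r N v := q v - \sum_(k < N) (c k * e_ u k v).

Let bmce k : bm I (fun v => c k * e_ u k v).
Proof. by apply: bm_mul; [exact: bm_cst|exact: bme]. Qed.

Let bmr N : bm I (r N).
Proof. by apply: bm_add => //; apply: bm_opp; apply: (@bm_sum _ _ N (fun k v => c k * e_ u k v)). Qed.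

Let r_e N : \int[leb]_(v in I) (r N v * e_ u N v) = pi * c N.
Proof.
have E v : r N v * e_ u N v = q v * e_ u N v - \sum_(k < N) (c k * (e_ u k v * e_ u N v)).
  by rewrite /r mulrBl mulr_suml; congr (_ - _); apply: eq_bigr => k _; rewrite mulrA.
have bee k : bm I (fun v => e_ u k v * e_ u N v) by apply: bm_mul; exact: bme.
have bcee k : bm I (fun v => c k * (e_ u k v * e_ u N v)) by apply: bm_mul => //; exact: bm_cst.
under eq_Rintegral do rewrite E.
rewrite (bm_RintegralB mI fI).
- rewrite (@bm_Rintegral_sum _ _ mI fI N (fun k v => c k * (e_ u k v * e_ u N v)))//.
  rewrite big1 => [|k _]; last first.
    by rewrite (bm_RintegralZ mI fI)// e_orthogonal ?(ltnW (ltn_ord k))// ltn_eqF// mulr0.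
  by rewrite subr0 /c mulrA divff ?mul1r// gt_eqF.
- by apply: bm_mul => //; exact: bme.
- exact: (@bm_sum _ _ N (fun k v => c k * (e_ u k v * e_ u N v))).
Qed.

(** Pythagoras, one orthogonal direction at a time. As the left side is nonnegative, this contains
    Bessel's inequality. *)
Let norm_r N : \int[leb]_(v in I) (r N v * r N v) =
  \int[leb]_(v in I) (q v * q v) - pi * \sum_(k < N) c k ^+ 2.
Proof.
elim: N => [|N IH].
  rewrite big_ord0 mulr0 subr0; apply: eq_Rintegral => v _.
  by rewrite /r big_ord0 subr0.
have E v : r N.+1 v * r N.+1 v = r N v * r N v +
   ((- 2 * c N) * (r N v * e_ u N v) + c N ^+ 2 * (e_ u N v * e_ u N v)).
  have -> : r N.+1 v = r N v - c N * e_ u N v by rewrite /r big_ord_recr/=; ring.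
  ring.
have b1 := bm_mul (bmr N) (bmr N).
have b2 := bm_mul (bmr N) (bme u N).
have b3 := bm_mul (bme u N) (bme u N).
have b4 := bm_mul (bm_cst I (- 2 * c N)) b2.
have b5 := bm_mul (bm_cst I (c N ^+ 2)) b3.
under eq_Rintegral do rewrite E.
rewrite (bm_RintegralD mI fI b1 (bm_add b4 b5)).
rewrite (bm_RintegralD mI fI b4 b5) (bm_RintegralZ mI fI _ b2) (bm_RintegralZ mI fI _ b3).
rewrite IH r_e e_orthogonal// eqxx big_ord_recr/=; ring.
Qed.

(** A Riemann-Lebesgue lemma: by Bessel's inequality the squared coefficients are summable, hence
    tend to 0. *)
Lemma bessel_cvg0 : \int[leb]_(v in I) (q v * sin ((k%:R + 2^-1) * (u - v))) @[k --> \oo] --> (0 : R).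
Proof.
set J := fun k : nat => _.
have JE k : J k = pi * c k by rewrite /c mulrA divff ?mul1r// gt_eqF.
have c2 : c k ^+ 2 @[k --> \oo] --> (0 : R).
  apply: cvg_series_cvg_0; apply: nondecreasing_is_cvgn.
    by apply: nondecreasing_series => k _ _; exact: sqr_ge0.
  exists (pi^-1 * \int[leb]_(v in I) (q v * q v)) => _ [N _ <-].
  rewrite /series/= big_mkord -(ler_pM2l pi0) mulrA divff ?gt_eqF// mul1r -subr_ge0 -norm_r.
  by apply: Rintegral_ge0 => v _; rewrite -expr2 sqr_ge0.
have c0 : c k @[k --> \oo] --> (0 : R).
  apply/cvgr0Pnorm_lt => e e0.
  have e2 : 0 < e ^+ 2 by rewrite exprn_gt0.
  move/cvgr0Pnorm_lt : c2 => /(_ _ e2); apply: filterS => k.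
  by rewrite normrX ltr_pXn2r// nnegrE ?normr_ge0// ltW.
rewrite (_ : J = fun k => pi * c k); last by apply/funext => k; rewrite JE.
rewrite -(mulr0 (pi : R)); exact: cvgMr.
Qed.
End bessel.

Lemma dirichlet_kernel N t : (1 + 2 * \sum_(k < N) cos (k.+1%:R * t)) * sin (t / 2) = sin ((N%:R + 2^-1) * t).
Proof.
elim: N => [|N IH].
  by rewrite big_ord0 mulr0 addr0 mul1r add0r mulrC.
rewrite big_ord_recr/= mulrDr addrA mulrDl IH.
have -> : (N%:R + 2^-1) * t = N.+1%:R * t - t / 2 by rewrite -natr1; field.
have -> : (N.+1%:R + 2^-1) * t = N.+1%:R * t + t / 2 by field.
rewrite sinB sinD; ring.
Qed.

(** Up to pi/4 the mean value theorem gives sin y >= y cos (pi/4); beyond, sin y >= sin (pi/4) while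
    y <= pi/2. The sum of the two constants serves both cases. *)
Lemma le_sin_halfpi : exists2 K : R, 0 < K & forall y : R, 0 <= y <= pi / 2 -> y <= K * sin y.
Proof.
set a : R := pi / 4.
have sa : 0 < sin a by apply: sin_gt0_pihalf; move: pi0; rewrite /a; lra.
have ca : 0 < cos a by apply: cos_gt0_pihalf; move: pi0; rewrite /a; lra.
have K1 : 0 < (cos a)^-1 by rewrite invr_gt0.
have K2 : 0 < (pi / 2) / sin a :> R by rewrite !divr_gt0.
exists ((cos a)^-1 + (pi / 2) / sin a) => [|y /andP[y0 y1]]; first exact: addr_gt0.
have sy : 0 <= sin y by apply: sin_ge0_pi; move: pi0 y0 y1; lra.
rewrite mulrDl; have [ya|ay] := leP y a.
  have [c] := @MVT_segment R sin cos 0 y y0 (fun x _ => is_derive_sin x)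
    (continuous_subspaceT (@continuous_sin R)).
  rewrite in_itv/= sin0 !subr0 => /andP[c0 cy] e.
  have cac : cos a <= cos c.
    by rewrite leNgt ltr_cos ?in_itv/= -?leNgt; move: pi0 c0 cy ya; rewrite /a; lra.
  apply: (@le_trans _ _ ((cos a)^-1 * sin y)); last by rewrite lerDl mulr_ge0// ltW.
  by rewrite mulrC ler_pdivlMr// e mulrC ler_wpM2r.
have say : sin a <= sin y.
  by rewrite leNgt ltr_sin ?in_itv/= -?leNgt; move: pi0 y0 y1 ay; rewrite /a; lra.
apply: (@le_trans _ _ (pi / 2 / sin a * sin y)); last by rewrite lerDr mulr_ge0// ltW.
rewrite mulrAC ler_pdivlMr//; apply: ler_pM => //; exact: ltW.
Qed.

Section lipschitz.
Variables (psi : R -> R) (C : R).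
Hypothesis C0 : 0 < C.
Hypothesis psi_lip : forall u v, - pi <= u <= pi -> - pi <= v <= pi -> `|psi u - psi v| <= C * `|u - v|.
Hypothesis psi_pi : psi (- pi) = psi pi.

Lemma measurable_lipschitz : measurable_fun (I : set (measurableTypeR R)) psi.
Proof.
apply: subspace_continuous_measurable_fun; first exact: mI.
apply/subspace_continuousP => x; rewrite /= in_itv/= => Ix.
apply/cvgrPdist_lt => e e0; rewrite near_withinE; near=> v => /=; rewrite in_itv/= => Iv.
apply: (le_lt_trans (psi_lip Ix Iv)); rewrite mulrC -ltr_pdivlMr//.
near: v; apply: cvgr_dist_lt => //; exact: divr_gt0.
Unshelve. all: by end_near. Qed.

Lemma lipschitz_bound : exists M : R, forall u, I u -> `|psi u| <= M.
Proof.
exists (C * (2 * pi) + `|psi pi|) => u; rewrite /= in_itv/= => /andP[u1 u2].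
have -> : psi u = (psi u - psi pi) + psi pi by rewrite subrK.
apply: (le_trans (ler_normD _ _)); rewrite lerD2r.
apply: le_trans (psi_lip _ _) _; rewrite ?u1 ?u2 ?lexx ?(ltW Npi_lt_pi)//.
rewrite ler_pM2l// ler_norml; move: pi0 u1 u2; lra.
Qed.

(** When u - v exceeds pi, the sine decreases again towards u - v = 2 pi. The comparison then goes
    from u to pi and from -pi to v, a path of length 2 pi - (u - v), because [psi_pi] identifies the
    endpoints. *)
Lemma lipschitz_sin : exists2 M : R, 0 <= M & forall u v, I u -> I v ->
  `|psi u - psi v| <= M * `|sin ((u - v) / 2)|.
Proof.
have [K K0 Ksin] := le_sin_halfpi.
exists (2 * C * K); first by rewrite !mulr_ge0// ltW.
move=> u v; wlog vu : u v / v <= u.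
  move=> H Iu Iv; have [vu|/ltW uv] := leP v u; first exact: H.
  rewrite distrC (le_trans (H _ _ uv Iv Iu))// -normrN -sinN.
  by rewrite (_ : - ((v - u) / 2) = (u - v) / 2)//; field.
rewrite /= !in_itv/= => Iu Iv; move: (Iu) (Iv) => /andP[u1 u2] /andP[v1 v2].
have [w|w] := leP (u - v) pi.
  have y : 0 <= (u - v) / 2 <= pi / 2 by move: w vu; lra.
  apply: (le_trans (psi_lip Iu Iv)).
  have s0 : 0 <= sin ((u - v) / 2) by apply: sin_ge0_pi; move: pi0 w vu; lra.
  rewrite ger0_norm ?subr_ge0// ger0_norm//.
  have := Ksin _ y; rewrite -(ler_pM2l C0); move: (sin _) => z; move: C0; lra.
have y : 0 <= pi - (u - v) / 2 <= pi / 2 by move: w u1 u2 v1 v2; lra.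
have -> : psi u - psi v = (psi u - psi pi) + (psi (- pi) - psi v) by rewrite psi_pi; ring.
apply: (le_trans (ler_normD _ _)).
have e1 : `|psi u - psi pi| <= C * (pi - u).
  apply: le_trans (psi_lip Iu _) _; first by rewrite lexx ltW// Npi_lt_pi.
  by rewrite distrC ger0_norm ?subr_ge0.
have e2 : `|psi (- pi) - psi v| <= C * (v + pi).
  apply: le_trans (psi_lip _ Iv) _; first by rewrite lexx ltW// Npi_lt_pi.
  by rewrite distrC opprK ger0_norm// -(subrK pi v); move: v1; lra.
have s0 : 0 <= sin ((u - v) / 2) by apply: sin_ge0_pi; move: pi0 w u1 u2 v1 v2; lra.
have := Ksin _ y; rewrite sinB sinpi cospi mul0r sub0r mulN1r opprK -(ler_pM2l C0) (ger0_norm s0).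
by move: (sin _) s0 e1 e2 => z; lra.
Qed.

Definition fourier_sum (N : nat) u : R := (2 * pi)^-1 *
  \int[leb]_(v in I) (psi v * (1 + 2 * \sum_(k < N) cos (k.+1%:R * (u - v)))).

Let bpsi : bm I psi.
Proof. by split; [exact: measurable_lipschitz|exact: lipschitz_bound]. Qed.

Let bmcos u k : bm I (fun v => cos (k%:R * (u - v))).
Proof. by apply: bm_cos; mfun. Qed.

Let bker u N : bm I (fun v => 1 + 2 * \sum_(k < N) cos (k.+1%:R * (u - v))).
Proof.
apply: bm_add; first exact: bm_cst; apply: bm_mul; first exact: bm_cst.
exact: (@bm_sum _ _ N (fun k v => cos (k.+1%:R * (u - v)))).
Qed.

Let integral_ker u N : \int[leb]_(v in I) (1 + 2 * \sum_(k < N) cos (k.+1%:R * (u - v))) = 2 * pi.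
Proof.
have bs : bm I (fun v => \sum_(k < N) cos (k.+1%:R * (u - v))).
  exact: (@bm_sum _ _ N (fun k v => cos (k.+1%:R * (u - v)))).
rewrite (bm_RintegralD mI fI (bm_cst _ _) (bm_mul (bm_cst _ _) bs)) (bm_RintegralZ mI fI _ bs).
rewrite (@bm_Rintegral_sum _ _ mI fI N (fun k v => cos (k.+1%:R * (u - v))))//.
rewrite big1 => [|k _]; last by rewrite integral_cos_shift.
rewrite mulr0 addr0; have := integral_cos_shift 0 u; rewrite /= => <-.
by apply: eq_Rintegral => v _; rewrite mul0r cos0.
Qed.

(** Where the sine vanishes, the quotient is 0 by convention; [lipschitz_sin] makes the numerator 0
    there as well, so multiplying back is exact. *)
Let q u v := (psi u - psi v) / sin ((u - v) / 2).

Let bq : exists2 M : R, 0 <= M & forall u, I u -> bm I (q u) /\ forall v, I v -> `|q u v| <= M.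
Proof.
have [M M0 Msin] := lipschitz_sin; exists M => // u Iu.
have qM v : I v -> `|q u v| <= M.
  move=> Iv; have [s0|s0] := eqVneq (sin ((u - v) / 2)) 0; first by rewrite /q s0 invr0 mulr0 normr0.
  by rewrite normrM normfV ler_pdivrMr ?normr_gt0// Msin.
split=> //; split; last by exists M.
by have mpsi := measurable_lipschitz; rewrite /q; mfun.
Qed.

(** The value psi u is written as an integral against the Dirichlet kernel, whose mass is 2 pi;
    dividing the difference by sin ((u - v) / 2) leaves a half-integer sine. *)
Lemma fourier_sumE N u : I u -> psi u - fourier_sum N u =
  (2 * pi)^-1 * \int[leb]_(v in I) (q u v * sin ((N%:R + 2^-1) * (u - v))).
Proof.
move=> Iu; have [M M0 Msin] := lipschitz_sin.
have p2 : 2 * pi != 0 :> R by rewrite mulf_neq0// gt_eqF.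
have -> : psi u = (2 * pi)^-1 * (psi u * \int[leb]_(v in I) (1 + 2 * \sum_(k < N) cos (k.+1%:R * (u - v)))).
  by rewrite integral_ker mulrCA mulVf// mulr1.
rewrite -mulrBr -(bm_RintegralZ mI fI _ (bker u N)).
rewrite -(bm_RintegralB mI fI (bm_mul (bm_cst _ _) (bker u N)) (bm_mul bpsi (bker u N))).
congr (_ * _); apply: eq_Rintegral => v; rewrite inE => Iv.
rewrite -mulrBl -dirichlet_kernel.
have d : psi u - psi v = q u v * sin ((u - v) / 2).
  have [s0|s0] := eqVneq (sin ((u - v) / 2)) 0; last by rewrite mulfVK.
  rewrite s0 mulr0; apply/eqP; rewrite -normr_le0.
  by have := Msin u v Iu Iv; rewrite s0 normr0 mulr0.
by rewrite {1}d; ring.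
Qed.

Lemma fourier_sum_cvg u : I u -> fourier_sum N u @[N --> \oo] --> psi u.
Proof.
move=> Iu; have [M _ /(_ u Iu) [bqu _]] := bq.
rewrite (_ : fourier_sum ^~ u = fun N => psi u -
  (2 * pi)^-1 * \int[leb]_(v in I) (q u v * sin ((N%:R + 2^-1) * (u - v)))); last first.
  by apply/funext => N; rewrite -(fourier_sumE N Iu) subKr.
rewrite -[X in _ --> X]subr0 -[X in _ --> _ - X](mulr0 (2 * pi)^-1).
by apply: cvgB; [exact: cvg_cst|apply: cvgM; [exact: cvg_cst|exact: bessel_cvg0]].
Qed.

(** The same representation of the error, in absolute value: the bound on [q] depends neither on u
    nor on N. *)
Lemma fourier_sum_bound : exists M : R, forall N u, I u -> `|fourier_sum N u| <= M.
Proof.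
have [P psiP] := lipschitz_bound; have [M M0 qM] := bq.
exists (P + M) => N u Iu; have [bqu quM] := qM u Iu.
have -> : fourier_sum N u = psi u - (psi u - fourier_sum N u) by rewrite subKr.
rewrite (le_trans (ler_normB _ _))// lerD ?psiP// fourier_sumE//.
have p2 : 0 < (2 * pi)^-1 :> R by rewrite invr_gt0 mulr_gt0.
rewrite normrM (gtr0_norm p2) mulrC ler_pdivrMr ?mulr_gt0//.
have -> : 2 * pi = fine (leb I) by rewrite lebI.
apply: (Rintegral_bound mI fI).
  by apply: mf_mul; [have [] := bqu|have [] := bme u N].
move=> v Iv; rewrite normrM -[leRHS]mulr1 ler_pM ?quM//; exact: sin_max.
Qed.

(** The constant term cancels, and cos k (u - v) - cos k (u + v) = 2 sin k u sin k v retains the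
    sine terms only. *)
Lemma fourier_sum_odd N u : (fourier_sum N u - fourier_sum N (- u)) / 2 =
  \sum_(k < N) (pi^-1 * \int[leb]_(v in I) (psi v * sin (k.+1%:R * v))) * sin (k.+1%:R * u).
Proof.
have p0 : pi != 0 :> R by rewrite gt_eqF.
rewrite /fourier_sum -mulrBr -(bm_RintegralB mI fI (bm_mul bpsi (bker _ _)) (bm_mul bpsi (bker _ _))).
have bps k : bm I (fun v => psi v * sin (k%:R * v)) by apply: bm_mul => //; apply: bm_sin; mfun.
have bpss k : bm I (fun v => 4 * sin (k%:R * u) * (psi v * sin (k%:R * v))).
  by apply: bm_mul => //; exact: bm_cst.
have E v : psi v * (1 + 2 * \sum_(k < N) cos (k.+1%:R * (u - v))) -
    psi v * (1 + 2 * \sum_(k < N) cos (k.+1%:R * (- u - v))) =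
    \sum_(k < N) (4 * sin (k.+1%:R * u) * (psi v * sin (k.+1%:R * v))).
  rewrite -mulrBr opprD addrACA subrr add0r -mulrBr -sumrB mulrA mulr_sumr.
  apply: eq_bigr => k _; have -> : k.+1%:R * (- u - v) = - (k.+1%:R * u + k.+1%:R * v) by ring.
  by rewrite [_ * (u - v)]mulrBr cosB cosN cosD; ring.
under eq_Rintegral do rewrite E.
rewrite (@bm_Rintegral_sum _ _ mI fI N (fun k v => 4 * sin (k.+1%:R * u) * (psi v * sin (k.+1%:R * v))))//.
rewrite mulr_sumr mulr_suml; apply: eq_bigr => k _.
rewrite (bm_RintegralZ mI fI _ (bps k.+1)).
set J := \int[_]_(_ in _) _.
by move: J (pi : R) p0 => J p p0; field.
Qed.
End lipschitz.
End fourier.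

(** * The integral of cos(n v) sinh u / (cosh u + cosh v) *)

Section residue_integral.
Variable R : realType.
Local Notation leb := (@lebesgue_measure R).
Local Notation hl := (`]0%R, +oo[%classic : set R).
Implicit Types u v w x y : R.

Let g w := (1 + cosh w)^-1.

Let D0 w : 0 < 1 + cosh w. Proof. by have := cosh_gt0 w; lra. Qed.
Let g0 w : 0 < g w. Proof. by rewrite invr_gt0. Qed.
Let E0 w : 0 < 1 + expR (- w). Proof. by have := expR_gt0 (- w); lra. Qed.

Let cg : continuous g.
Proof.
by move=> w; apply: der_continuous; rewrite /g; repeat der_step; rewrite gt_eqF.
Qed.

Lemma cosh_invE w : (1 + cosh w)^-1 = 2 * expR (- w) / (1 + expR (- w)) ^+ 2.
Proof.
rewrite /cosh; have e := expRN w; have p := expR_gt0 w; have q := E0 w.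
have := D0 w; rewrite /cosh; move: q; rewrite e; move: p; move: (expR w) => z z0 z1 z2.
by field; rewrite ?gt_eqF//; nra.
Qed.

Lemma integrable_cosh_inv : leb.-integrable setT (EFin \o g).
Proof.
apply: (@integrable_ge0 _ (measurableTypeR R) R leb setT g 2).
- exact: measurableT.
- exact: continuous_measurable_fun.
- by move=> x _; exact: ltW.
rewrite ge0_symfun_integralT; last 3 first.
- by move=> x; exact: ltW.
- exact: cg.
- by move=> x; rewrite /= /g coshN.
rewrite (_ : [set x | _] = `[0, +oo[%classic); last first.
  by apply/seteqP; split => x/=; rewrite in_itv/= andbT.
rewrite -integral_itv_obnd_cbnd; last first.
  by apply/measurable_EFinP; apply: measurable_funTS; exact: continuous_measurable_fun.
rewrite (@FTC0y_ge0 _ (fun w => - (2 * expR (- w)) / (1 + expR (- w)) + 1) g 0 1).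
- by rewrite subr0 -EFinM mulr1.
- move=> x x0; der; first by rewrite gt_eqF.
  by rewrite /g cosh_invE; field; rewrite gt_eqF.
- by move=> x _; exact: cg.
- apply: der_cvg_right; last by rewrite oppr0 expR0; field.
  by repeat der_step; rewrite gt_eqF.
- rewrite -[X in _ --> X]add0r; apply: cvgD; last exact: cvg_cst.
  apply: (@expR_cvgy R 2) => v v0; have := E0 v; have := expR_gt0 (- v); move: (expR (- v)) => z z0 z1.
  by rewrite mulNr normrN normrM normfV !gtr0_norm ?mulr_gt0// ler_pdivrMr//; nra.
- by move=> x _; exact: ltW.
Qed.

Variable n : nat.
Hypothesis n0 : (0 < n)%N.
Let nu : R := n%:R.
Let nu0 : 0 < nu. Proof. by rewrite ltr0n. Qed.

Let gc w := cos (nu * w) * g w.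
Let gs w := sin (nu * w) * g w.

Let cgc : continuous gc.
Proof.
by move=> w; apply: der_continuous; rewrite /gc /g; repeat der_step; rewrite gt_eqF.
Qed.
Let cgs : continuous gs.
Proof.
by move=> w; apply: der_continuous; rewrite /gs /g; repeat der_step; rewrite gt_eqF.
Qed.

Let igc : leb.-integrable setT (EFin \o gc).
Proof.
apply: (@integrable_le _ (measurableTypeR R) R leb setT gc g) => //; first exact: continuous_measurable_fun.
  by move=> x _; rewrite normrM (gtr0_norm (g0 x)) ler_piMl ?(ltW (g0 x))// cos_max.
exact: integrable_cosh_inv.
Qed.
Let igs : leb.-integrable setT (EFin \o gs).
Proof.
apply: (@integrable_le _ (measurableTypeR R) R leb setT gs g) => //; first exact: continuous_measurable_fun.
  by move=> x _; rewrite normrM (gtr0_norm (g0 x)) ler_piMl ?(ltW (g0 x))// sin_max.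
exact: integrable_cosh_inv.
Qed.

Let J := \int[leb]_t gc t.
Let G := primitive gc.
Let S := primitive gs.

Let dG w : hasder w G (gc w). Proof. exact: hasder_primitive. Qed.
Let dS w : hasder w S (gs w). Proof. exact: hasder_primitive. Qed.

Let gcN w : gc (- w) = gc w. Proof. by rewrite /gc /g coshN mulrN cosN. Qed.
Let gsN w : gs (- w) = - gs w. Proof. by rewrite /gs /g coshN mulrN sinN mulNr. Qed.

Let dGN w : hasder w (fun x => G (- x)) (- gc w).
Proof.
apply: (@der_eq _ _ _ (gc (- w) * - 1)); first exact: (der_comp (dG (- w)) (der_opp (der_id w))).
by rewrite gcN mulrN1.
Qed.
Let dSN w : hasder w (fun x => S (- x)) (gs w).
Proof.
apply: (@der_eq _ _ _ (gs (- w) * - 1)); first exact: (der_comp (dS (- w)) (der_opp (der_id w))).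
by rewrite gsN mulrN1 opprK.
Qed.

(** [gc] is even, so the sum has derivative 0; its constant value is the limit at infinity. *)
Let GGN u : G u + G (- u) = J.
Proof.
have cst x y : G x + G (- x) = G y + G (- y).
  apply: (@is_derive_0_is_cst R (fun x => G x + G (- x))) => z.
  by have := der_add (dG z) (dGN z); rewrite subrr.
have h : G x + G (- x) @[x --> +oo] --> J + 0.
  apply: cvgD; first exact: primitive_cvgy.
  exact: ((cvgNy_compNP G _).1 (primitive_cvgNy igc cgc)).
rewrite -[RHS]addr0; apply: (cvg_unique _ _ h) => //.
rewrite (_ : (fun x => _) = fun=> G u + G (- u)); first exact: cvg_cst.
by apply/funext => x; exact: cst.
Qed.

Let SSN u : S u - S (- u) = 0.
Proof.
have -> : S u - S (- u) = S 0 - S (- 0).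
  apply: (@is_derive_0_is_cst R (fun x => S x - S (- x))) => z.
  by have := der_add (dS z) (der_opp (dSN z)); rewrite subrr.
by rewrite oppr0 subrr.
Qed.

Let D1 u v : 0 < cosh u + cosh v. Proof. by rewrite addr_gt0// cosh_gt0. Qed.

Lemma poisson_kernel_bound c u v : `|c| <= 1 -> `|c * (cosh u + cosh v)^-1| <= 2 * expR (- v).
Proof.
move=> h; rewrite normrM normfV (gtr0_norm (D1 u v)) ler_pdivrMr//.
have := expR_le_cosh v; have := cosh_gt0 u.
rewrite expRN; have := expR_gt0 v; move: (expR v) (cosh u) (cosh v) => z a b z0 a0 zb.
apply: (le_trans h); rewrite -mulrA mulrCA mulrC ler_pdivlMr//; lra.
Qed.

Lemma integrable_expRN : leb.-integrable hl (EFin \o (fun v => expR (- v))).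
Proof.
apply: (@integrable_ge0 _ (measurableTypeR R) R leb hl _ 1^-1).
- exact: measurable_itv.
- by apply: measurable_funTS; mfun.
- by move=> v _; exact: expR_ge0.
- by rewrite -(@integral_expR_scale R 1 ltr01); apply: eq_integral => v _; rewrite mul1r.
Qed.

(** Both sides are the v-derivative of T (v + u) - T (v - u) = 2 sinh u / (cosh u + cosh v) with T =
    tanh (. / 2). *)
Let gE u v : g (v + u) - g (v - u) = - 2 * (sinh u * sinh v / (cosh u + cosh v) ^+ 2).
Proof.
have := D1 u v; rewrite /g !cosh_invE /cosh /sinh opprD opprB expRD [expR (u - v)]expRD !expRN.
have := expR_gt0 u; have := expR_gt0 v; move: (expR u) (expR v) => a b b0 a0 h.
have ab : a * b != 0 by rewrite mulf_neq0// gt_eqF.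
field; apply/and5P; split; rewrite gt_eqF//; do ?[apply: addr_gt0|apply: mulr_gt0|exact: ltr01]; done.
Qed.

(* The integrand is [cos (nu v) (T (v + u) - T (v - u)) / 2] with [T = tanh (. / 2)]
   and [T' = g]; [A] is its antiderivative by parts. *)
Let A u v := nu^-1 * (sin (nu * v) * (sinh u / (cosh u + cosh v)) -
  2^-1 * (cos (nu * u) * (S (v + u) - S (v - u)) - sin (nu * u) * (G (v + u) + G (v - u)))).

Let dA u v : hasder v (A u) (cos (nu * v) * (sinh u / (cosh u + cosh v))).
Proof.
have dGp w : hasder v (fun v => G (v + w)) (gc (v + w)).
  apply: (@der_eq _ _ _ (gc (v + w) * (1 + 0))); last by rewrite addr0 mulr1.
  exact: (@der_comp R v G (fun x => x + w) _ _ (dG (v + w)) (der_add (der_id v) (der_cst v w))).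
have dSp w : hasder v (fun v => S (v + w)) (gs (v + w)).
  apply: (@der_eq _ _ _ (gs (v + w) * (1 + 0))); last by rewrite addr0 mulr1.
  exact: (@der_comp R v S (fun x => x + w) _ _ (dS (v + w)) (der_add (der_id v) (der_cst v w))).
have G1 := dGp u; have G2 := dGp (- u); have S1 := dSp u; have S2 := dSp (- u).
rewrite /A; der; first by rewrite gt_eqF.
(* Writing v as (v + u) - u and as (v - u) + u, the addition formulas reduce the coefficients of
   both values of [g] to sin (nu v). *)
have e1 : cos (nu * u) * sin (nu * (v + u)) - sin (nu * u) * cos (nu * (v + u)) = sin (nu * v).
  by rewrite mulrC -[sin (nu * u) * _]mulrC -sinB; congr sin; ring.
have e2 : cos (nu * u) * sin (nu * (v - u)) + sin (nu * u) * cos (nu * (v - u)) = sin (nu * v).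
  by rewrite mulrC -[sin (nu * u) * _]mulrC -sinD; congr sin; ring.
have d0 : cosh u + cosh v != 0 by rewrite gt_eqF.
have nu1 : nu != 0 by rewrite gt_eqF.
transitivity (nu^-1 * (sin (nu * v) * - (sinh u * sinh v / (cosh u + cosh v) ^+ 2) -
   2^-1 * (g (v + u) * (cos (nu * u) * sin (nu * (v + u)) - sin (nu * u) * cos (nu * (v + u))) -
      g (v - u) * (cos (nu * u) * sin (nu * (v - u)) + sin (nu * u) * cos (nu * (v - u))))) +
   cos (nu * v) * (sinh u / (cosh u + cosh v))).
  rewrite /gs /gc; move: (G _) (G _) (S _) (S _) (g _) (g _) nu nu1 (cosh u + cosh v) d0.
  by move=> a1 a2 a3 a4 a5 a6 n1 n1' d d0; field; rewrite ?n1' ?d0.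
rewrite e1 e2 -mulrBl; have := gE u v; move: (g _ - g _) => z ->.
rewrite -[RHS]add0r; congr (_ + _); rewrite -[RHS](mulr0 nu^-1); congr (_ * _).
by move: (_ / _ ^+ 2) => y; field.
Qed.

(** At infinity the two [S] terms cancel and the [G] terms add up to 2 J; at 0 the [G] terms add up
    to J. So u enters through sin (nu u) alone, and J remains to be found. *)
Lemma integral_poisson_kernel0 u : (\int[leb]_(v in hl) (cos (nu * v) * (sinh u / (cosh u + cosh v)))%:E =
   (sin (nu * u) * (J / (2 * nu)))%:E)%E.
Proof.
have nu1 : nu != 0 by rewrite gt_eqF.
have -> : sin (nu * u) * (J / (2 * nu)) =
  nu^-1 * (0 - 2^-1 * (cos (nu * u) * (\int[leb]_t gs t - \int[leb]_t gs t) - sin (nu * u) * (J + J))) -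
  A u 0.
  have -> : A u 0 = nu^-1 * (0 - 2^-1 * (cos (nu * u) * 0 - sin (nu * u) * J)).
    by rewrite /A mulr0 sin0 mul0r (add0r u) (sub0r u) GGN SSN.
  by move: J nu nu1 => j n1 n1'; field.
have shift w : v + w @[v --> +oo] --> +oo.
  by apply/cvgryPge => M; near=> v; rewrite -lerBlDr; near: v; apply: nbhs_pinfty_ge; exact: num_real.
have pG w : G (v + w) @[v --> +oo] --> J.
  exact: cvg_comp (shift w) (primitive_cvgy igc cgc).
have pS w : S (v + w) @[v --> +oo] --> \int[leb]_t gs t.
  exact: cvg_comp (shift w) (primitive_cvgy igs cgs).
apply: (@FTC0y _ (A u)).
- by move=> v _; exact: dA.
- by move=> v _; apply: der_continuous; repeat der_step; rewrite gt_eqF.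
- by apply: der_cvg_right; [exact: dA|].
- apply: cvgM; first exact: cvg_cst.
  apply: cvgB; last first.
    apply: cvgM; first exact: cvg_cst.
    apply: cvgB; apply: cvgM; try exact: cvg_cst.
      apply: cvgB; [exact: pS|exact: pS].
    apply: cvgD; [exact: pG|exact: pG].
  apply: (@expR_cvgy R (`|sinh u| * 2)) => v v0.
  by rewrite mulrCA normrM -mulrA ler_wpM2l// poisson_kernel_bound// sin_max.
apply: (@integrable_le _ (measurableTypeR R) R leb hl _ (fun v => `|sinh u| * 2 * expR (- v))).
- exact: measurable_itv.
- apply: measurable_funTS; apply: continuous_measurable_fun => v.
  by apply: der_continuous; repeat der_step; rewrite gt_eqF.
- move=> v v0; rewrite mulrCA normrM -mulrA ler_wpM2l// poisson_kernel_bound// cos_max//.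
- exact: (@integrableZl _ _ R leb hl (measurable_itv _) (`|sinh u| * 2) _ integrable_expRN).
Unshelve. all: by end_near. Qed.

(** Partial sums for J / 2: parts against 1 - tanh (w / 2), expanded in powers of e^(-w). The
    leading 1 is the boundary term at w = 0. *)
Let E N : R := 1 + 2 * nu ^+ 2 * \sum_(k < N) ((- 1) ^+ k.+1 / (nu ^+ 2 + k.+1%:R ^+ 2)).
(* [1 - T w = 2 sum_(k < N) (-1)^k e^(-(k+1) w) + rem N w]. *)
Let rem N w : R := (- 1) ^+ N * (2 * expR (- (N.+1%:R * w)) / (1 + expR (- w))).
Let term k w : R := (- 1) ^+ k * expR (- (k.+1%:R * w)) *
  (nu * cos (nu * w) + k.+1%:R * sin (nu * w)) / (nu ^+ 2 + k.+1%:R ^+ 2).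
(** The first summand is the boundary function of the integration by parts; [term k] is a primitive
    of (-1)^(k+1) e^(-(k+1) w) sin (nu w). *)
Let F N w : R := - cos (nu * w) * (2 * expR (- w) / (1 + expR (- w))) + 2 * nu * \sum_(k < N) term k w.

Let kn0 k : 0 < nu ^+ 2 + k%:R ^+ 2 :> R.
Proof. by rewrite ltr_pwDl ?exprn_gt0// sqr_ge0. Qed.

Let dterm k w : hasder w (term k) (- ((- 1) ^+ k * expR (- (k.+1%:R * w)) * sin (nu * w))).
Proof.
rewrite /term; der => /=.
by have := kn0 k.+1; move: ((- 1) ^+ k) => s h; field; rewrite gt_eqF.
Qed.

Let dF N w : hasder w (F N) (gc w + nu * sin (nu * w) * rem N w).
Proof.
elim: N => [|N IH].
  have -> : F 0 = fun w => - cos (nu * w) * (2 * expR (- w) / (1 + expR (- w))).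
    by apply/funext => v; rewrite /F big_ord0 mulr0 addr0.
  have := E0 w => h; der => /=; first by rewrite gt_eqF.
  by rewrite /gc /g cosh_invE /rem expr0 !mul1r; field; rewrite gt_eqF.
have -> : F N.+1 = fun w => F N w + 2 * nu * term N w.
  by apply/funext => v; rewrite /F big_ord_recr/= mulrDr addrA.
apply: der_eq; first by apply: der_add IH (der_mul (der_cst w (2 * nu)) (dterm N w)).
(* The induction step is the geometric identity [rem N w] - [rem N.+1 w] = 2 (-1)^N e^(-(N+1) w). *)
rewrite mulr0 addr0 -addrA; congr (_ + _); rewrite /rem.
have -> : expR (- (N.+2%:R * w)) = expR (- (N.+1%:R * w)) * expR (- w).
  by rewrite -expRD; congr expR; ring.
rewrite exprS; have := E0 w; move: (expR (- w)) => z h.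
by field; rewrite gt_eqF.
Qed.

Let igchl : leb.-integrable hl (EFin \o gc).
Proof. by apply: (integrableS _ _ _ igc) => //; exact: measurable_itv. Qed.

Let integral_gc : (\int[leb]_(w in hl) (gc w)%:E = (J / 2)%:E)%E.
Proof.
have GG0 : G 0 = J / 2 by have := GGN 0; rewrite oppr0; lra.
have -> : J / 2 = J - G 0 by rewrite GG0; field.
apply: (@FTC0y _ G).
- by move=> w _; exact: dG.
- by move=> w _; exact: cgc.
- by apply: der_cvg_right; [exact: dG|].
- exact: (primitive_cvgy igc cgc).
- exact: igchl.
Qed.

Let rem_bound N w : 0 < w -> `|nu * sin (nu * w) * rem N w| <= 2 * nu * expR (- (N.+1%:R * w)).
Proof.
move=> w0; rewrite /rem !normrM normrX normrN1 expr1n mul1r normfV (gtr0_norm nu0) (gtr0_norm (E0 w)).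
have s1 := sin_max (nu * w); have s0 := normr_ge0 (sin (nu * w)).
rewrite (gtr0_norm (expR_gt0 _)) (@gtr0_norm _ 2)//.
rewrite mulrA ler_pdivrMr//; have := expR_gt0 (- w); have := expR_gt0 (- (N.+1%:R * w)).
move: (expR (- (N.+1%:R * w))) (expR (- w)) `|_| s0 s1 => y z s s0 s1 y0 z0.
have : 0 < nu * y by rewrite mulr_gt0. have : nu * y * s <= nu * y by rewrite ler_piMr// mulr_ge0// ltW.
nra.
Qed.

Let mrem N : measurable_fun (hl : set (measurableTypeR R)) (fun w => nu * sin (nu * w) * rem N w).
Proof. by apply: measurable_funTS; rewrite /rem; mfun. Qed.

Let integrable_expRN' N : leb.-integrable hl (EFin \o (fun w => expR (- (N.+1%:R * w)))).
Proof.
apply: (@integrable_ge0 _ (measurableTypeR R) R leb hl _ N.+1%:R^-1).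
- exact: measurable_itv.
- by apply: measurable_funTS; mfun.
- by move=> v _; exact: expR_ge0.
- exact: integral_expR_scale.
Qed.

Let integrable_expRS N : leb.-integrable hl (EFin \o (fun w => 2 * nu * expR (- (N.+1%:R * w)))).
Proof. exact: (@integrableZl _ _ R leb hl (measurable_itv _) (2 * nu) _ (integrable_expRN' N)). Qed.

Let irem N : leb.-integrable hl (EFin \o (fun w => nu * sin (nu * w) * rem N w)).
Proof.
apply: (integrable_le _ (mrem N) _ (integrable_expRS N)); first exact: measurable_itv.
by move=> w /hl_gt0; exact: rem_bound.
Qed.

Let integral_F N : (\int[leb]_(w in hl) (gc w + nu * sin (nu * w) * rem N w)%:E = (E N)%:E)%E.
Proof.
have <- : 0 - F N 0 = E N.
  rewrite /F mulr0 cos0 oppr0 expR0 /E /term.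
  have -> : \sum_(k < N) ((- 1) ^+ k * expR (- (k.+1%:R * 0)) *
      (nu * cos (nu * 0) + k.+1%:R * sin (nu * 0)) / (nu ^+ 2 + k.+1%:R ^+ 2)) =
      - nu * \sum_(k < N) ((- 1) ^+ k.+1 / (nu ^+ 2 + k.+1%:R ^+ 2)).
    rewrite mulr_sumr; apply: eq_bigr => k _.
    rewrite !mulr0 oppr0 expR0 cos0 sin0 [(- 1) ^+ k.+1]exprS.
    by move: (nu ^+ 2 + _)^-1 ((- 1) ^+ k) => d s; ring.
  by move: (\sum_(k < N) _) => s; field.
have F0 : F N w @[w --> +oo] --> (0 : R).
  elim: N => [|N IH].
    apply: (@expR_cvgy R 2) => w w0; rewrite /F big_ord0 mulr0 addr0 normrM normrN normrM normfV.
    rewrite (gtr0_norm (E0 w)) normrM (gtr0_norm (expR_gt0 _)) (@gtr0_norm _ 2)//.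
    have := E0 w; have := cos_max (nu * w); have := normr_ge0 (cos (nu * w)); have := expR_gt0 (- w).
    move: (expR (- w)) `|cos _| => y z y0 z0 z1 y1.
    by rewrite mulrA ler_pdivrMr//; nra.
  have -> : F N.+1 = fun w => F N w + 2 * nu * term N w.
    by apply/funext => v; rewrite /F big_ord_recr/= mulrDr addrA.
  rewrite -[X in _ --> X]addr0 -[X in _ --> _ + X](mulr0 (2 * nu)).
  apply: cvgD => //; apply: cvgM; first exact: cvg_cst.
  apply: (@expR_cvgy R ((nu + N.+1%:R) / (nu ^+ 2 + N.+1%:R ^+ 2))) => w w0; rewrite /term.
  rewrite !normrM normrX normrN1 expr1n mul1r normfV (gtr0_norm (kn0 _)) (gtr0_norm (expR_gt0 _)).
  rewrite [leRHS]mulrAC ler_wpM2r ?invr_ge0 ?(ltW (kn0 _))//.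
  rewrite mulrC; apply: ler_pM; rewrite ?normr_ge0 ?expR_ge0//.
    apply: (le_trans (ler_normD _ _)); rewrite !normrM (gtr0_norm nu0) (@ger0_norm _ N.+1%:R)//.
    by rewrite lerD// ler_piMr ?cos_max ?sin_max// ltW.
  by rewrite ler_expR lerN2 ler_peMl ?(ltW w0)// ler1n.
apply: (@FTC0y _ (F N)).
- by move=> w _; exact: dF.
- move=> w _; apply: der_continuous; rewrite /gc /g /rem; repeat der_step; rewrite gt_eqF//.
- by apply: der_cvg_right; [exact: dF|].
- exact: F0.
- exact: (integrableD _ igchl (irem N)).
Qed.

(** The remainder is at most 2 nu times the integral of e^(-(N+1) w), that is 2 nu / (N + 1). *)
Let cvg_E : E N @[N --> \oo] --> J / 2.
Proof.
have JE N : J / 2 = E N - \int[leb]_(w in hl) (nu * sin (nu * w) * rem N w).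
  have -> : J / 2 = \int[leb]_(w in hl) gc w by rewrite /Rintegral integral_gc.
  have -> : E N = \int[leb]_(w in hl) (gc w + nu * sin (nu * w) * rem N w) by rewrite /Rintegral integral_F.
  by rewrite (@RintegralD _ (measurableTypeR R) R leb hl _ _ (measurable_itv _) igchl (irem N)) addrK.
have bnd N : `|\int[leb]_(w in hl) (nu * sin (nu * w) * rem N w)| <= 2 * nu * N.+1%:R^-1.
  apply: (le_trans (@le_normr_Rintegral _ (measurableTypeR R) R leb hl _ (measurable_itv _) (irem N))).
  have -> : 2 * nu * N.+1%:R^-1 = \int[leb]_(w in hl) (2 * nu * expR (- (N.+1%:R * w))).
    rewrite (@RintegralZl _ (measurableTypeR R) R leb hl _ _ (measurable_itv _) (integrable_expRN' N)).
    by rewrite /Rintegral integral_expR_scale.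
  apply: (@le_Rintegral _ (measurableTypeR R) R leb hl _ _ (measurable_itv _) _ (integrable_expRS N)).
    exact: (integrable_abse (irem N)).
  by move=> w /hl_gt0; exact: rem_bound.
have h0 : (\int[leb]_(w in hl) (nu * sin (nu * w) * rem N w)) @[N --> \oo] --> (0 : R).
  apply/norm_cvg0P; apply: (squeeze_cvgr (f := fun=> 0) (h := fun N => 2 * nu * N.+1%:R^-1)).
  - by near=> N; rewrite normr_ge0 bnd.
  - exact: cvg_cst.
  - rewrite -(mulr0 (2 * nu)); apply: cvgM; first exact: cvg_cst.
    exact: cvg_harmonic.
rewrite -[X in _ --> X]addr0.
rewrite (_ : E = fun N => J / 2 + \int[leb]_(w in hl) (nu * sin (nu * w) * rem N w)); last first.
  by apply/funext => N; rewrite (JE N) subrK.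
by apply: cvgD => //; exact: cvg_cst.
Unshelve. all: by end_near. Qed.

Lemma cosh_le_expR x y : `|x| <= y -> cosh x <= expR y.
Proof.
rewrite ler_norml lerNl => /andP[h1 h2].
have e1 : expR (- x) <= expR y by rewrite ler_expR.
have e2 : expR x <= expR y by rewrite ler_expR.
by move: e1 e2; rewrite /cosh; lra.
Qed.

Let cosh_lip : forall u v, - pi <= u <= pi -> - pi <= v <= pi ->
  `|cosh (nu * u) - cosh (nu * v)| <= nu * expR (nu * pi) * `|u - v|.
Proof.
move=> u v; wlog vu : u v / v <= u.
  move=> H Iu Iv; have [vu|/ltW uv] := leP v u; first exact: H.
  by rewrite distrC [X in _ <= _ * X]distrC H.
move=> /andP[u1 u2] /andP[v1 v2].
have dc x : hasder x (fun x => cosh (nu * x)) (nu * sinh (nu * x)) by der => /=; ring.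
have cc : {within `[v, u], continuous (fun x => cosh (nu * x))}.
  by apply: continuous_subspaceT => x; exact: (der_continuous (dc x)).
have [c] := @MVT_segment R (fun x => cosh (nu * x)) _ v u vu (fun x _ => dc x) cc.
rewrite in_itv/= => /andP[vc cu] ->; rewrite normrM (normrM nu) (gtr0_norm nu0) ler_wpM2r//.
rewrite ler_wpM2l ?(ltW nu0)//; apply: (le_trans (norm_sinh_le _)); apply: cosh_le_expR.
rewrite normrM (gtr0_norm nu0) ler_wpM2l ?(ltW nu0)//.
by rewrite ler_norml; move: vc cu u1 u2 v1 v2; lra.
Qed.

Let integral_cosh_cos k : \int[leb]_(v in `[- pi, pi]) (cosh (nu * v) * cos (k%:R * v)) =
  2 * nu * (- 1) ^+ k * sinh (nu * pi) / (nu ^+ 2 + k%:R ^+ 2).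
Proof.
rewrite (@Rintegral_FTC _ (fun v => (nu * (sinh (nu * v) * cos (k%:R * v)) +
   k%:R * (cosh (nu * v) * sin (k%:R * v))) / (nu ^+ 2 + k%:R ^+ 2))).
- rewrite !mulrN sinhN coshN cosN sinN sin_natpi cos_natpi.
  by move: (_^-1) ((- 1) ^+ k) => d s; ring.
- exact: Npi_lt_pi.
- move=> v; der => /=; have := kn0 k; move: (k%:R : R) => c h; field; rewrite gt_eqF//.
- by move=> v; apply: der_continuous; repeat der_step.
Qed.

(** The cosine coefficients of cosh (nu v) are proportional to (-1)^k / (nu^2 + k^2), the terms of
    [E]; at the point 0 every cosine of the Fourier sum is 1. *)
Let fourier_cosh N : fourier_sum (fun v => cosh (nu * v)) N 0 = sinh (nu * pi) / (pi * nu) * E N.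
Proof.
have bch k : bm (`[- pi, pi]%classic : set R) (fun v => cosh (nu * v) * cos (k%:R * v)).
  apply: bm_mul; last by apply: bm_cos; mfun.
  split; first by mfun.
  exists (expR (nu * pi)) => v; rewrite /= in_itv/= => Iv.
  rewrite (gtr0_norm (cosh_gt0 _)); apply: cosh_le_expR.
  by rewrite normrM (gtr0_norm nu0) ler_wpM2l ?(ltW nu0)// ler_norml.
have bch2 k : bm (`[- pi, pi]%classic : set R) (fun v => 2 * (cosh (nu * v) * cos (k%:R * v))).
  by apply: bm_mul => //; exact: bm_cst.
have e v : cosh (nu * v) * (1 + 2 * \sum_(k < N) cos (k.+1%:R * (0 - v))) =
    cosh (nu * v) * cos (0%:R * v) + \sum_(k < N) (2 * (cosh (nu * v) * cos (k.+1%:R * v))).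
  rewrite mul0r cos0 mulrDr; congr (_ + _); rewrite !mulr_sumr; apply: eq_bigr => k _.
  by rewrite sub0r mulrN cosN; ring.
rewrite /fourier_sum; under eq_Rintegral do rewrite e.
rewrite (bm_RintegralD (@mI R) (@fI R) (bch 0%N)); last first.
  exact: (@bm_sum _ _ N (fun k v => 2 * (cosh (nu * v) * cos (k.+1%:R * v)))).
rewrite (@bm_Rintegral_sum _ _ (@mI R) (@fI R) N (fun k v => 2 * (cosh (nu * v) * cos (k.+1%:R * v))))//.
rewrite integral_cosh_cos.
have -> : \sum_(k < N) \int[leb]_(v in `[- pi, pi]) (2 * (cosh (nu * v) * cos (k.+1%:R * v))) =
   4 * nu * sinh (nu * pi) * \sum_(k < N) ((- 1) ^+ k.+1 / (nu ^+ 2 + k.+1%:R ^+ 2)).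
  rewrite mulr_sumr; apply: eq_bigr => k _.
  rewrite (bm_RintegralZ (@mI R) (@fI R) _ (bch _)) integral_cosh_cos.
  by move: (_^-1) ((- 1) ^+ k.+1) => d s; ring.
have p0 : pi != 0 :> R by rewrite gt_eqF// pi_gt0.
rewrite /E expr0 (_ : 0%:R = 0)// expr0n addr0.
have nu1 : nu != 0 by rewrite gt_eqF.
move: nu nu1 (pi : R) p0 (sinh _) (\sum_(k < N) _) => m m0 p p0 h s.
by field; rewrite ?p0 ?m0.
Qed.

(** The Fourier sums of cosh (nu v) at 0 tend to cosh 0 = 1, which forces J / 2 = pi nu / sinh (pi
    nu). *)
Lemma integral_poisson_kernel u :
  (\int[leb]_(v in hl) (cos (n%:R * v) * (sinh u / (cosh u + cosh v)))%:E =
   (pi * sin (n%:R * u) / sinh (n%:R * pi))%:E)%E.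
Proof.
rewrite integral_poisson_kernel0.
have npi : 0 < nu * pi by rewrite mulr_gt0// pi_gt0.
have np := sinh_gt0 npi.
have c0 : cosh (nu * (- pi)) = cosh (nu * pi) by rewrite mulrN coshN.
have I0 : (`[- pi, pi]%classic : set R) 0.
  by rewrite /= in_itv/= oppr_le0; have := pi_gt0 R => /ltW ->.
have C0 : 0 < nu * expR (nu * pi) by rewrite mulr_gt0// expR_gt0.
have := @fourier_sum_cvg R (fun v => cosh (nu * v)) _ C0 cosh_lip c0 0 I0.
rewrite mulr0 cosh0 => h1.
have h2 : fourier_sum (fun v => cosh (nu * v)) N 0 @[N --> \oo] --> sinh (nu * pi) / (pi * nu) * (J / 2).
  rewrite (_ : (fun N => _) = fun N => sinh (nu * pi) / (pi * nu) * E N).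
    by apply: cvgM; [exact: cvg_cst|exact: cvg_E].
  by apply/funext => N; exact: fourier_cosh.
have : 1 = sinh (nu * pi) / (pi * nu) * (J / 2) by exact: (cvg_unique _ h1 h2).
have p0 : pi != 0 :> R by rewrite gt_eqF// pi_gt0.
rewrite -/nu; move: nu nu0 (pi : R) p0 (sinh _) np J (sin _) => m m0 p p0 h h0 j s e; congr (_%:E).
by rewrite -[RHS]mulr1 [X in _ = _ * X]e; field; rewrite p0 !gt_eqF.
Qed.

End residue_integral.

(** * The Whittaker coefficients *)

Section sigma_finite_product.
Context d1 d2 (T1 : measurableType d1) (T2 : measurableType d2) (R : realType).
Variables (m1 : {sigma_finite_measure set T1 -> \bar R})
  (m2 : {sigma_finite_measure set T2 -> \bar R}).

(* The library attaches to [m1 \x m2] the structure of a product of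
   subprobabilities, which hides its sigma-finiteness; hence this copy. *)
Definition sigma_finite_product : set (T1 * T2) -> \bar R := (m1 \x m2)%E.

Let sigma_finite_productT : sigma_finite setT sigma_finite_product.
Proof.
have [F FT Foo] := sigma_finiteT m1; have [G GT Goo] := sigma_finiteT m2.
exists (fun n => if unpickle n is Some (i, j) then F i `*` G j else set0) => [|n].
  apply/seteqP; split=> // -[x y] _.
  have [i _ Fx] : (\bigcup_i F i) x by rewrite -FT.
  have [j _ Gy] : (\bigcup_j G j) y by rewrite -GT.
  by exists (pickle (i, j)) => //; rewrite pickleK.
case: (unpickle n) => [[i j]|]; last first.
  by split=> //; rewrite /sigma_finite_product measure0 ltry.
have [mF fF] := Foo i; have [mG fG] := Goo j.
split; first exact: measurableX.
by rewrite /sigma_finite_product product_measure1E// lte_mul_pinfty// ge0_fin_numE.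
Qed.

HB.instance Definition _ := Measure.on sigma_finite_product.
HB.instance Definition _ := Measure_isSigmaFinite.Build _ _ _ sigma_finite_product
  sigma_finite_productT.
End sigma_finite_product.

Lemma measurable_Rintegral_iter1 d1 d2 (T1 : measurableType d1) (T2 : measurableType d2)
    (R : realType) (m2 : {sigma_finite_measure set T2 -> \bar R}) (D1 : set T1) (D2 : set T2)
    (f : T1 * T2 -> R) : measurable D1 -> measurable D2 ->
  measurable_fun (D1 `*` D2) f -> (forall z, (D1 `*` D2) z -> 0 <= f z) ->
  measurable_fun D1 (fun x => \int[m2]_(y in D2) f (x, y)).
Proof.
move=> mD1 mD2 mf f0; rewrite /Rintegral.
apply: (measurableT_comp (fine_measurable measurableT)).
apply: (measurable_iter1_rect m2 mD1 mD2 (f := EFin \o f)).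
  exact/measurable_EFinP.
by move=> z Dz; rewrite lee_fin f0.
Qed.

Section transform.
Variables (R : realType) (mu : R) (hmu : mu < 1 / 2).
Local Notation leb := (@lebesgue_measure R).
Local Notation hl := (`]0%R, +oo[%classic : set R).
Local Notation D := (hl `*` hl).
Local Notation plane := (sigma_finite_product leb leb).
Local Notation s := (1 - 2 * mu).
Local Notation B := (@shiftcosh R).
Implicit Types (x t u v w : R) (z : R * R).

Let s0 : 0 < s. Proof. by move: hmu; lra. Qed.
Let s1 : 0 < s + 1. Proof. by move: s0; lra. Qed.

Let mhl : measurable (hl : set (measurableTypeR R)). Proof. exact: measurable_itv. Qed.
Let mD : measurable (D : set (measurableTypeR R * measurableTypeR R)).
Proof. exact: measurableX. Qed.

(** The kernel of f with its prefactor, see [kint_parcylD]. In this form x occurs in the Gaussian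
    only, which suits the integration over x. *)
Definition kint x u : R := \int[leb]_(t in hl) (t `^ s * expR (- (t ^+ 2 / (4 * x)) - t * cosh u)).

Let kfun_ge0 x u t : 0 <= t `^ s * expR (- (t ^+ 2 / (4 * x)) - t * cosh u).
Proof. by rewrite mulr_ge0 ?powR_ge0 ?expR_ge0. Qed.

Lemma kint_ge0 x u : 0 <= kint x u.
Proof. by apply: Rintegral_ge0 => t _; exact: kfun_ge0. Qed.

Let integral_gamma1 l : 0 < l ->
  (\int[leb]_(t in hl) (t `^ s * expR (- (l * t)))%:E = (Gamma (s + 1) * l `^ (- (s + 1)))%:E)%E.
Proof. by move=> l0; rewrite -(integral_gamma_scale s1 l0) addrK. Qed.

Let ikfun x u : 0 < x -> leb.-integrable hl (EFin \o (fun t => t `^ s * expR (- (t ^+ 2 / (4 * x)) - t * cosh u))).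
Proof.
move=> x0; apply: (@integrable_le _ (measurableTypeR R) R leb hl _ (fun t => t `^ s * expR (- (cosh u * t)))) => //.
- by mfun.
- move=> t t0; rewrite ger0_norm ?kfun_ge0// ler_wpM2l ?powR_ge0// ler_expR [t * _]mulrC gerDr oppr_le0.
  by rewrite divr_ge0 ?sqr_ge0// mulr_ge0// ltW.
- apply: (@integrable_ge0 _ (measurableTypeR R) R leb hl _ (Gamma (s + 1) * cosh u `^ (- (s + 1)))) => //.
  + by mfun.
  + by move=> t _; rewrite mulr_ge0 ?powR_ge0 ?expR_ge0.
  + by apply: integral_gamma1; exact: cosh_gt0.
Qed.

Let kintE x u : 0 < x ->
  (\int[leb]_(t in hl) (t `^ s * expR (- (t ^+ 2 / (4 * x)) - t * cosh u))%:E = (kint x u)%:E)%E.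
Proof.
by move=> x0; rewrite /kint /Rintegral fineK//; apply: integrable_fin_num => //; exact: ikfun.
Qed.

Lemma kint_le x u : 0 < x -> kint x u <= kint x 0.
Proof.
move=> x0; apply: (@le_Rintegral _ (measurableTypeR R) R leb hl _ _ mhl (ikfun u x0) (ikfun 0 x0)).
move=> t /hl_gt0 t0; rewrite ler_wpM2l ?powR_ge0// ler_expR lerD2l lerN2 ler_pM2l//.
by rewrite cosh0 cosh_ge1.
Qed.

Lemma measurable_kint : measurable_fun (hl `*` [set: R] : set (measurableTypeR R * measurableTypeR R))
  (fun z => kint z.1 z.2).
Proof.
apply: (@measurable_Rintegral_iter1 _ _ (measurableTypeR R * measurableTypeR R)%type (measurableTypeR R) R leb (hl `*` [set: R]) hl
  (fun p => p.2 `^ s * expR (- (p.2 ^+ 2 / (4 * p.1.1)) - p.2 * cosh p.1.2))) => //.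
- exact: measurableX.
- have m11 : measurable_fun ((hl `*` [set: R]) `*` hl : set ((measurableTypeR R * measurableTypeR R) * measurableTypeR R))
      (fun p => p.1.1 : R).
    by apply: measurable_funTS; apply: measurableT_comp measurable_fst measurable_fst.
  have m12 : measurable_fun ((hl `*` [set: R]) `*` hl : set ((measurableTypeR R * measurableTypeR R) * measurableTypeR R))
      (fun p => p.1.2 : R).
    by apply: measurable_funTS; apply: measurableT_comp measurable_snd measurable_fst.
  by mfun.
Qed.

Lemma measurable_kintl u : measurable_fun (hl : set (measurableTypeR R)) (kint ^~ u).
Proof.
apply: (@measurable_Rintegral_iter1 _ _ (measurableTypeR R) (measurableTypeR R) R leb hl hl
  (fun p => p.2 `^ s * expR (- (p.2 ^+ 2 / (4 * p.1)) - p.2 * cosh u))) => //.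
by mfun.
Qed.

(** For fixed t the x-integral is Cauchy-Schloemilch with A = b and B = t / 2, which leaves e^(-b
    t); the t-integral is then a Gamma integral with rate b + cosh u. *)
Lemma integral_kint_gauss b u : 0 < b ->
  (\int[leb]_(x in hl) (x `^ (- 2^-1) * kint x u * expR (- (x * b ^+ 2)))%:E =
   (Num.sqrt pi / b * (Gamma (s + 1) * (b + cosh u) `^ (- (s + 1))))%:E)%E.
Proof.
move=> b0; pose g x t := x `^ (- 2^-1) * expR (- (x * b ^+ 2)) * (t `^ s * expR (- (t ^+ 2 / (4 * x)) - t * cosh u)).
have g0 x t : 0 <= g x t by rewrite mulr_ge0 ?kfun_ge0// mulr_ge0 ?powR_ge0 ?expR_ge0.
have mg : measurable_fun (D : set (measurableTypeR R * measurableTypeR R)) (fun p => g p.1 p.2).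
  by rewrite /g; mfun.
transitivity (\int[leb]_(x in hl) \int[leb]_(t in hl) (g x t)%:E)%E.
  apply: eq_integral => x; rewrite inE => /hl_gt0 x0.
  rewrite mulrAC EFinM -(kintE u x0) -ge0_integralZl//.
  - by apply/measurable_EFinP; mfun.
  - by move=> t _; rewrite lee_fin kfun_ge0.
  - by rewrite lee_fin mulr_ge0 ?powR_ge0 ?expR_ge0.
transitivity (\int[leb]_(t in hl) \int[leb]_(x in hl) (g x t)%:E)%E.
  rewrite -(tonelli12_rect leb leb mhl mhl (f := fun p => (g p.1 p.2)%:E)); last 2 first.
  - exact/measurable_EFinP.
  - by move=> p _; rewrite lee_fin.
  apply: (tonelli21_rect leb leb mhl mhl (f := fun p => (g p.1 p.2)%:E)).
  - exact/measurable_EFinP.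
  - by move=> p _; rewrite lee_fin.
transitivity (\int[leb]_(t in hl) ((Num.sqrt pi / b)%:E * (t `^ s * expR (- ((b + cosh u) * t)))%:E))%E.
  apply: eq_integral => t; rewrite inE => /hl_gt0 t0.
  have t2 : 0 < t / 2 by rewrite divr_gt0.
  transitivity (\int[leb]_(x in hl) ((t `^ s * expR (- (t * cosh u)))%:E *
      (x `^ (- 2^-1) * expR (- (x * b ^+ 2) - (t / 2) ^+ 2 / x))%:E))%E.
    apply: eq_integral => x; rewrite inE => /hl_gt0 x0; rewrite -EFinM /g; congr (_%:E).
    rewrite [in LHS]mulrACA [in RHS]mulrACA -!expRD [x `^ _ * _]mulrC; congr (_ * expR _).
    by field; rewrite gt_eqF.
  rewrite ge0_integralZl//; last 3 first.
  - by apply/measurable_EFinP; mfun.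
  - by move=> x _; rewrite lee_fin mulr_ge0 ?powR_ge0 ?expR_ge0.
  - by rewrite lee_fin mulr_ge0 ?powR_ge0 ?expR_ge0.
  rewrite (cauchy_schlomilch b0 t2) -!EFinM; congr (_%:E).
  have -> : expR (- ((b + cosh u) * t)) = expR (- (t * cosh u)) * expR (- (2 * b * (t / 2))).
    by rewrite -expRD; congr expR; field.
  by rewrite mulrCA !mulrA.
rewrite ge0_integralZl//; last 3 first.
- by apply/measurable_EFinP; mfun.
- by move=> x _; rewrite lee_fin mulr_ge0 ?powR_ge0 ?expR_ge0.
- by rewrite lee_fin divr_ge0 ?sqrtr_ge0// ltW.
by rewrite integral_gamma1 ?EFinM// addr_gt0// cosh_gt0.
Qed.

(** The shifted power is opened as a Gamma integral over t. After the exchange the w-integral is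
    Gamma(s) t^(-s), which cancels t^s and leaves the integral of e^(-c t). *)
Lemma integral_power_shift c : 0 < c ->
  (\int[leb]_(w in hl) (w `^ (s - 1) * (Gamma (s + 1) * (c + w) `^ (- (s + 1))))%:E =
   (Gamma s / c)%:E)%E.
Proof.
move=> c0; pose g w t := w `^ (s - 1) * (t `^ s * expR (- ((c + w) * t))).
have g0 w t : 0 <= g w t by rewrite !mulr_ge0 ?powR_ge0 ?expR_ge0.
have mg : measurable_fun (D : set (measurableTypeR R * measurableTypeR R)) (fun p => g p.1 p.2).
  by rewrite /g; mfun.
transitivity (\int[leb]_(w in hl) \int[leb]_(t in hl) (g w t)%:E)%E.
  apply: eq_integral => w; rewrite inE => /hl_gt0 w0.
  rewrite EFinM -integral_gamma1 ?addr_gt0// -ge0_integralZl//.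
  - by apply/measurable_EFinP; mfun.
  - by move=> t _; rewrite lee_fin mulr_ge0 ?powR_ge0 ?expR_ge0.
  - by rewrite lee_fin powR_ge0.
transitivity (\int[leb]_(t in hl) \int[leb]_(w in hl) (g w t)%:E)%E.
  rewrite -(tonelli12_rect leb leb mhl mhl (f := fun p => (g p.1 p.2)%:E)); last 2 first.
  - exact/measurable_EFinP.
  - by move=> p _; rewrite lee_fin.
  apply: (tonelli21_rect leb leb mhl mhl (f := fun p => (g p.1 p.2)%:E)).
  - exact/measurable_EFinP.
  - by move=> p _; rewrite lee_fin.
transitivity (\int[leb]_(t in hl) ((Gamma s)%:E * (expR (- (c * t)))%:E))%E.
  apply: eq_integral => t; rewrite inE => /hl_gt0 t0.
  transitivity (\int[leb]_(w in hl) ((t `^ s * expR (- (c * t)))%:E * (w `^ (s - 1) * expR (- (t * w)))%:E))%E.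
    apply: eq_integral => w; rewrite inE => /hl_gt0 w0; rewrite -EFinM /g; congr (_%:E).
    rewrite [in RHS]mulrACA -expRD [in LHS]mulrCA mulrA; congr (_ * expR _); ring.
  rewrite ge0_integralZl//; last 3 first.
  - by apply/measurable_EFinP; mfun.
  - by move=> x _; rewrite lee_fin mulr_ge0 ?powR_ge0 ?expR_ge0.
  - by rewrite lee_fin mulr_ge0 ?powR_ge0 ?expR_ge0.
  rewrite (integral_gamma_scale s0 t0) -!EFinM; congr (_%:E).
  by rewrite powRN mulrC -mulrA; congr (_ * _); rewrite mulrA mulVf ?mul1r// gt_eqF// powR_gt0.
rewrite ge0_integralZl//; last 2 first.
- by apply/measurable_EFinP; mfun.
- by rewrite lee_fin ltW// Gamma_gt0.
by rewrite integral_expR_scale.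
Qed.

Section whittaker_transform.
Variables (tau u : R).

Let pig : 0 < Num.sqrt pi * Gamma s :> R.
Proof. by rewrite mulr_gt0 ?Gamma_gt0// sqrtr_gt0 pi_gt0. Qed.

(** [G] is the signed integrand and [g] its positive majorant, from which it differs by the cosine;
    [iota] is the x-integral of [g], and [d] is the w-integral of [iota]. *)
Let G x z := x `^ (- 2^-1) * kint x u * Vker mu tau 0 x z.
Let g x z := z.2 `^ (s - 1) * B z * (x `^ (- 2^-1) * kint x u * expR (- (x * B z ^+ 2))).
Let iota z := Num.sqrt pi * (z.2 `^ (s - 1) * (Gamma (s + 1) * (cosh u + cosh z.1 + z.2) `^ (- (s + 1)))).
Let d v := Num.sqrt pi * Gamma s / (cosh u + cosh v).

Let B0 z : D z -> 0 < B z.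
Proof. by move=> [_ /hl_gt0 z2]; have := shiftcosh_ge1 z2; lra. Qed.

Let g0 x z : D z -> 0 <= g x z.
Proof.
by move=> /B0 /ltW z0; rewrite mulr_ge0 ?mulr_ge0 ?powR_ge0 ?expR_ge0// kint_ge0.
Qed.

Let iota0 z : 0 <= iota z.
Proof. by rewrite !mulr_ge0 ?sqrtr_ge0 ?powR_ge0// ltW// Gamma_gt0. Qed.

Let d0 v : 0 <= d v.
Proof. by rewrite divr_ge0 ?ltW// addr_gt0// cosh_gt0. Qed.

Let mdv : measurable_fun (hl : set (measurableTypeR R)) d.
Proof. by apply: mf_mul; [exact: mf_cst|mfun]. Qed.

Let miota : measurable_fun (D : set (measurableTypeR R * measurableTypeR R)) iota.
Proof. by rewrite /iota; mfun. Qed.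

Let inner_iota v : (\int[leb]_(w in hl) (iota (v, w))%:E = (d v)%:E)%E.
Proof.
rewrite /iota /=; under eq_integral do rewrite EFinM.
rewrite ge0_integralZl//; last 2 first.
- by apply/measurable_EFinP; mfun.
- by move=> x _; rewrite lee_fin !mulr_ge0 ?powR_ge0// ltW// Gamma_gt0.
rewrite /= integral_power_shift ?addr_gt0 ?cosh_gt0// -EFinM /d.
by congr (_%:E); rewrite mulrA.
Qed.

Let id : leb.-integrable hl (EFin \o d).
Proof.
apply: (@integrable_le _ (measurableTypeR R) R leb hl d (fun v => Num.sqrt pi * Gamma s * 2 * expR (- v))) => //.
- move=> v _; rewrite /d normrM (gtr0_norm pig) -!mulrA ler_wpM2l ?sqrtr_ge0// ler_wpM2l ?(ltW (Gamma_gt0 s0))//.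
  by have := @poisson_kernel_bound R 1 u v; rewrite mul1r normr1; apply.
- by apply: (@integrable_scale _ (measurableTypeR R) R leb hl) => //; exact: integrable_expRN.
Qed.

Let fd : (\int[leb]_(v in hl) (d v)%:E = (\int[leb]_(v in hl) d v)%:E)%E.
Proof. by rewrite /Rintegral fineK//; exact: integrable_fin_num. Qed.

Let mkx := measurable_kintl u.

Let mk : measurable_fun (hl `*` D : set (measurableTypeR R * (measurableTypeR R * measurableTypeR R)))
  (fun p => kint p.1 u).
Proof.
apply: (measurable_comp (F := hl : set (measurableTypeR R)) mhl) mkx _.
  by move=> _ [p [p1 _] <-].
by apply: measurable_funTS; exact: measurable_fst.
Qed.

Let mBp : measurable_fun (hl `*` D : set (measurableTypeR R * (measurableTypeR R * measurableTypeR R)))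
  (fun p => B p.2).
Proof.
apply: measurable_funTS; apply: (measurableT_comp (f := B)); last exact: measurable_snd.
by rewrite /shiftcosh; mfun.
Qed.

Let m22 : measurable_fun (hl `*` D : set (measurableTypeR R * (measurableTypeR R * measurableTypeR R)))
  (fun p => p.2.2 : R).
Proof. by apply: measurable_funTS; apply: measurableT_comp measurable_snd measurable_snd. Qed.

Let m21 : measurable_fun (hl `*` D : set (measurableTypeR R * (measurableTypeR R * measurableTypeR R)))
  (fun p => p.2.1 : R).
Proof. by apply: measurable_funTS; apply: measurableT_comp measurable_fst measurable_snd. Qed.

Let mg : measurable_fun (hl `*` D : set (measurableTypeR R * (measurableTypeR R * measurableTypeR R)))
  (fun p => g p.1 p.2).
Proof. by rewrite /g; mfun. Qed.

Let mG : measurable_fun (hl `*` D : set (measurableTypeR R * (measurableTypeR R * measurableTypeR R)))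
  (fun p => G p.1 p.2).
Proof. by rewrite /G /Vker; mfun. Qed.

Let mgz z : measurable_fun (hl : set (measurableTypeR R)) (g ^~ z).
Proof. by have h := mkx; rewrite /g; mfun. Qed.

Let inner_g z : D z -> (\int[leb]_(x in hl) (g x z)%:E = (iota z)%:E)%E.
Proof.
move=> Dz; have z0 := B0 Dz; have h := mkx.
rewrite /g; under eq_integral do rewrite EFinM.
rewrite ge0_integralZl//; last 3 first.
- by apply/measurable_EFinP; mfun.
- by move=> x _; rewrite lee_fin !mulr_ge0 ?powR_ge0 ?expR_ge0// kint_ge0.
- by rewrite lee_fin mulr_ge0 ?powR_ge0// ltW.
rewrite integral_kint_gauss// -EFinM; congr (_%:E).
rewrite /iota; have -> : cosh u + cosh z.1 + z.2 = B z + cosh u by rewrite /shiftcosh; ring.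
by move: (B z) z0 => b b0; field; rewrite gt_eqF.
Qed.

Let integral_iota : (\int[plane]_(z in D) (iota z)%:E = (\int[leb]_(v in hl) d v)%:E)%E.
Proof.
rewrite [LHS](tonelli12_rect leb leb mhl mhl (f := fun p => (iota p)%:E)).
- by under eq_integral do rewrite inner_iota.
- exact/measurable_EFinP.
- by move=> z _; rewrite lee_fin.
Qed.

Let iiota : plane.-integrable D (EFin \o iota).
Proof.
apply: (@integrable_ge0 _ (measurableTypeR R * measurableTypeR R)%type R plane D _ (\int[leb]_(v in hl) d v)) => //.
Qed.

Let ig : (leb \x plane)%E.-integrable (hl `*` D) (EFin \o (fun p => g p.1 p.2)).
Proof.
apply: (integrable_ge0 (r := \int[leb]_(v in hl) d v)).
- by apply: measurableX.
- exact: mg.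
- by move=> p [_ /g0].
rewrite (tonelli21_rect leb plane mhl mD (f := fun p => (g p.1 p.2)%:E)).
- transitivity (\int[plane]_(z in D) (iota z)%:E)%E; last exact: integral_iota.
  by apply: eq_integral => z; rewrite inE; exact: inner_g.
- exact/measurable_EFinP.
- by move=> p [_ /g0]; rewrite lee_fin.
Qed.

Let normVker x z : D z -> `|Vker mu tau 0 x z| <= z.2 `^ (s - 1) * B z * expR (- (x * B z ^+ 2)).
Proof.
move=> /B0 z0; rewrite /Vker expr0 mulr1 !normrM (gtr0_norm z0) (ger0_norm (powR_ge0 _ _)).
rewrite (gtr0_norm (expR_gt0 _)) ler_wpM2r ?expR_ge0// mulrC ler_wpM2l ?powR_ge0//.
by rewrite ler_piMl ?cos_max// ltW.
Qed.

Let iG : (leb \x plane)%E.-integrable (hl `*` D) (EFin \o (fun p => G p.1 p.2)).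
Proof.
apply: (integrable_le _ mG _ ig); first exact: measurableX.
move=> p [_ pD]; rewrite /G normrM ger0_norm ?mulr_ge0 ?powR_ge0 ?kint_ge0//.
rewrite /g mulrCA ler_wpM2l ?mulr_ge0 ?powR_ge0 ?kint_ge0//; exact: normVker.
Qed.

Let GE x z : G x z = cos (tau * z.1) * g x z.
Proof. by rewrite /G /g /Vker expr0 mulr1; ring. Qed.

Let iciota : plane.-integrable D (EFin \o (fun z => cos (tau * z.1) * iota z)).
Proof.
apply: (@integrable_le _ (measurableTypeR R * measurableTypeR R)%type R plane D _ iota) => //.
- by apply: mf_mul => //; mfun.
- by move=> z _; rewrite normrM (ger0_norm (iota0 z)) ler_piMl ?cos_max.
Qed.

Lemma integrable_quotient_cosh :
  leb.-integrable hl (EFin \o (fun v => Num.sqrt pi * Gamma s / (cosh u + cosh v))).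
Proof. exact: id. Qed.

(** Integrability of the majorant [g] permits Fubini with x innermost; the cosine involves v alone
    and passes through both inner integrals. *)
Lemma integral_kint_Vint :
  (\int[leb]_(x in hl) (x `^ (- 2^-1) * kint x u * Vint mu tau 0 x)%:E =
   \int[leb]_(v in hl) (cos (tau * v) * (Num.sqrt pi * Gamma s / (cosh u + cosh v)))%:E)%E.
Proof.
transitivity (\int[leb]_(x in hl) \int[plane]_(z in D) (G x z)%:E)%E.
  apply: eq_integral => x; rewrite inE => /hl_gt0 x0.
  have iV : plane.-integrable D (EFin \o Vker mu tau 0 x) := integrable_Vker tau hmu 0 x0.
  rewrite EFinM; have -> : (Vint mu tau 0 x)%:E = (\int[plane]_(z in D) (Vker mu tau 0 x z)%:E)%E.
    by rewrite -[RHS]fineK//; exact: (integrable_fin_num mD iV).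
  by rewrite -integralZl.
transitivity (\int[plane]_(z in D) \int[leb]_(x in hl) (G x z)%:E)%E.
  rewrite (fubini12_rect mhl mD (f := fun p => (G p.1 p.2)%:E))//.
  by rewrite -(fubini21_rect mhl mD (f := fun p => (G p.1 p.2)%:E)).
transitivity (\int[plane]_(z in D) (cos (tau * z.1) * iota z)%:E)%E.
  apply: eq_integral => z; rewrite inE => zD.
  have igz : leb.-integrable hl (EFin \o g ^~ z).
    apply: (@integrable_ge0 _ (measurableTypeR R) R leb hl _ (iota z)) => //.
    - by move=> x _; exact: g0.
    - exact: inner_g.
  under eq_integral do rewrite GE EFinM.
  by rewrite integralZl// inner_g.
rewrite -(fubini12_rect mhl mhl (f := fun z => (cos (tau * z.1) * iota z)%:E))//.
apply: eq_integral => v _ /=.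
have iw : leb.-integrable hl (EFin \o (fun w => iota (v, w))).
  apply: (@integrable_ge0 _ (measurableTypeR R) R leb hl _ (d v)) => //.
  by apply: mf_mul; [exact: mf_cst|apply: mf_mul; [mfun|apply: mf_mul; [exact: mf_cst|mfun]]].
under eq_integral do rewrite EFinM.
by rewrite integralZl// inner_iota.
Qed.

End whittaker_transform.
(** Substitute t -> sqrt(2x) t. As s + 1 = 2 (1 - mu), the Jacobian and t^s give sqrt(2x)^(s+1) =
    (2x)^(1-mu), and the exponential cancels the one in [parcylD]. *)
Lemma kint_parcylD x u : 0 < x ->
  Gamma (2 * (1 - mu)) * (2 * x) `^ (1 - mu) *
  (expR (x * cosh u ^+ 2 / 2) * parcylD (2 * (mu - 1)) (Num.sqrt (2 * x) * cosh u)) = kint x u.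
Proof.
move=> x0; have x2 : 0 < 2 * x by rewrite mulr_gt0.
pose l := Num.sqrt (2 * x); have l0 : 0 < l by rewrite sqrtr_gt0.
have l2 : l ^+ 2 = 2 * x by rewrite sqr_sqrtr// ltW.
have ek : kint x u = l `^ (s + 1) *
    \int[leb]_(t in hl) (t `^ s * expR (- (t ^+ 2 / 2) - l * cosh u * t)).
  have h : forall t, 0 < t -> (l * t) `^ s * expR (- ((l * t) ^+ 2 / (4 * x)) - l * t * cosh u) =
      l `^ s * (t `^ s * expR (- (t ^+ 2 / 2) - l * cosh u * t)).
    move=> t t0; rewrite powRM ?(ltW l0) ?(ltW t0)// -mulrA exprMn l2; congr (_ * (_ * expR _)).
    by field; rewrite gt_eqF.
  rewrite {1}/kint /Rintegral (integral_scale l0); last 2 first.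
  - by apply/measurable_EFinP; mfun.
  - by move=> t t0; rewrite lee_fin kfun_ge0.
  have -> : (\int[leb]_(t in hl) ((l * t) `^ s * expR (- ((l * t) ^+ 2 / (4 * x)) - l * t * cosh u))%:E =
      \int[leb]_(t in hl) ((l `^ s)%:E * (t `^ s * expR (- (t ^+ 2 / 2) - l * cosh u * t))%:E))%E.
    by apply: eq_integral => t; rewrite inE => /hl_gt0 t0; rewrite h.
  rewrite ge0_integralZl//; last 3 first.
  - by apply/measurable_EFinP; mfun.
  - by move=> t _; rewrite lee_fin mulr_ge0 ?powR_ge0 ?expR_ge0.
  - by rewrite lee_fin powR_ge0.
  have ls : 0 < l `^ s by rewrite powR_gt0.
  have -> : l `^ (s + 1) = l * l `^ s.
    by rewrite (@powRD _ l s 1) ?(gt_eqF l0) ?implybT// powRr1 ?(ltW l0)// mulrC.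
  rewrite muleA -EFinM.
  have c0 : 0 < l * l `^ s by rewrite mulr_gt0.
  case: (integral _ _ _) => [r //||]; rewrite ?gt0_muley ?gt0_muleNy ?lte_fin//= ?mulr0//.
rewrite ek /parcylD -/l.
have -> : - (2 * (mu - 1)) = s + 1 by ring.
have -> : 2 * (1 - mu) = s + 1 by ring.
rewrite addrK.
have -> : (2 * x) `^ (1 - mu) = l `^ (s + 1).
  rewrite /l -powR12_sqrt ?(ltW x2)// -powRrM; congr (_ `^ _); by field.
have G0 := Gamma_gt0 s1.
have -> : expR (- ((l * cosh u) ^+ 2 / 4)) = (expR (x * cosh u ^+ 2 / 2))^-1.
  by rewrite -expRN exprMn l2; congr expR; field.
have := expR_gt0 (x * cosh u ^+ 2 / 2); move: (expR _) => y y0.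
by move: (\int[_]_(_ in _) _) => J; field; rewrite !gt_eqF.
Qed.

(** * The coefficients as sine integrals of psi *)

Section coefficient.
Variables (n : nat) (n0 : (0 < n)%N) (psi : R -> R).
Local Notation I := (`[- pi, pi]%classic : set R).
Hypothesis bpsi : bm I psi.
Let tau : R := n%:R.

Let phi u := Wcst mu * (psi u * sinh u).
Let fr x := \int[leb]_(u in I) (kint x u * phi u).

Let bpsinh : bm I (fun u => psi u * sinh u).
Proof.
apply: bm_mul => //; split.
  by apply: measurable_funTS; apply: continuous_measurable_fun; exact: continuous_sinh.
exists (expR pi) => u; rewrite /= in_itv/= => Iu.
by rewrite (le_trans (norm_sinh_le _))// cosh_le_expR// ler_norml.
Qed.

Let bphi : bm I phi.
Proof. by apply: bm_mul => //; exact: bm_cst. Qed.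

(** A majorant uniform in u and n: the cosine is at most 1 and [kint] is largest at u = 0. Its
    integral is the transform of frequency 0 at u = 0, which is finite. *)
Let p x := x `^ (- 2^-1) * kint x 0 * Vint mu 0 0 x.

Let mV t : measurable_fun (hl : set (measurableTypeR R)) (Vint mu t 0).
Proof.
apply: open_continuous_measurable_fun; first exact: interval_open.
by move=> x; rewrite inE => /hl_gt0 x0; exact: (der_continuous (hasder_Vint t hmu 0 x0)).
Qed.

Let V_le x : 0 < x -> `|Vint mu tau 0 x| <= Vint mu 0 0 x.
Proof.
move=> x0; have i1 := integrable_Vker tau hmu 0 x0; have i2 := integrable_Vker 0 hmu 0 x0.
apply: (le_trans (le_normr_Rintegral mD i1)); apply: le_Rintegral mD (integrable_abse i1) i2 _.
move=> z [_ /hl_gt0 /shiftcosh_ge1 z1].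
have B1 : 0 <= B z by move: z1; lra.
rewrite /Vker !expr0 !mulr1 mul0r cos0 mul1r !normrM (ger0_norm B1) (ger0_norm (powR_ge0 _ _)).
rewrite (gtr0_norm (expR_gt0 _)) -!mulrA ler_piMl ?cos_max// !mulr_ge0 ?powR_ge0 ?expR_ge0//.
Qed.

Let V_ge0 x : 0 < x -> 0 <= Vint mu 0 0 x.
Proof. by move=> x0; apply: le_trans (V_le x0). Qed.

Let mkint := measurable_kintl.

Let ip : leb.-integrable hl (EFin \o p).
Proof.
have iq := integrable_quotient_cosh 0.
apply: (@integrable_ge0 _ (measurableTypeR R) R leb hl p
  (\int[leb]_(v in hl) (Num.sqrt pi * Gamma s / (cosh 0 + cosh v)))) => //.
- by have h := mkint 0; have h2 := mV 0; rewrite /p; mfun.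
- by move=> x /hl_gt0 x0; rewrite !mulr_ge0 ?powR_ge0 ?kint_ge0 ?V_ge0.
rewrite /p integral_kint_Vint /Rintegral fineK; last exact: integrable_fin_num.
by apply: eq_integral => v _; rewrite mul0r cos0 mul1r.
Qed.

Let F x u := x `^ (- 2^-1) * Vint mu tau 0 x * (kint x u * phi u).

Let mIR : measurable (I : set (measurableTypeR R)). Proof. exact: mI. Qed.
Let hlI : measurable (hl `*` I : set (measurableTypeR R * measurableTypeR R)).
Proof. exact: measurableX. Qed.

Let mF : measurable_fun (hl `*` I : set (measurableTypeR R * measurableTypeR R)) (fun q => F q.1 q.2).
Proof.
have m1 : measurable_fun (hl `*` I : set (measurableTypeR R * measurableTypeR R)) (fun q => kint q.1 q.2).
  by apply: measurable_funS measurable_kint; [exact: measurableX|move=> q []].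
have m2 : measurable_fun (hl `*` I : set (measurableTypeR R * measurableTypeR R)) (fun q => phi q.2).
  apply: (measurable_comp (F := I : set (measurableTypeR R)) mIR) (proj1 bphi) _.
    by move=> _ [q [_ q2] <-].
  by apply: measurable_funTS; exact: measurable_snd.
have m3 : measurable_fun (hl `*` I : set (measurableTypeR R * measurableTypeR R)) (fun q => Vint mu tau 0 q.1).
  apply: (measurable_comp (F := hl : set (measurableTypeR R)) mhl) (mV tau) _.
    by move=> _ [q [q1 _] <-].
  by apply: measurable_funTS; exact: measurable_fst.
by rewrite /F; mfun.
Qed.

Let F_le M x u : (forall u, I u -> `|phi u| <= M) -> 0 < x -> I u -> `|F x u| <= p x * M.
Proof.
move=> phiM x0 Iu.
have -> : F x u = x `^ (- 2^-1) * Vint mu tau 0 x * kint x u * phi u by rewrite /F mulrA.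
rewrite normrM; apply: ler_pM; rewrite ?normr_ge0 ?phiM//.
have := V_le x0; have := kint_le u x0; have := kint_ge0 x u; have := powR_ge0 x (- 2^-1).
rewrite /p !normrM; move: (x `^ _) (kint x u) (kint x 0) (Vint mu tau 0 x) (Vint mu 0 0 x).
move=> y k k0 V V0 y0 k1 k2 V1; rewrite (ger0_norm y0) (ger0_norm k1) -!mulrA ler_wpM2l//.
by rewrite [k0 * _]mulrC ler_pM.
Qed.

Let iF : (leb \x leb)%E.-integrable (hl `*` I) (EFin \o (fun q => F q.1 q.2)).
Proof.
have [_ [M phiM]] := bphi.
have M0 : 0 <= M.
  apply: le_trans (phiM 0 _); first exact: normr_ge0.
  by rewrite /= in_itv/= oppr_le0 (ltW (pi_gt0 R)).
apply: (@integrable_le _ (measurableTypeR R * measurableTypeR R)%type R (leb \x leb)%E (hl `*` I)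
  (fun q => F q.1 q.2) (fun q => p q.1 * M)) => //.
  by move=> q [/hl_gt0 q1 q2]; exact: F_le.
have mp : measurable_fun (hl : set (measurableTypeR R)) p.
  by have h := mkint 0; have h2 := mV 0; rewrite /p; mfun.
have p0 x : 0 < x -> 0 <= p x.
  by move=> x0; rewrite !mulr_ge0 ?powR_ge0 ?kint_ge0 ?V_ge0.
have mpM : measurable_fun (hl `*` I : set (measurableTypeR R * measurableTypeR R)) (fun q => p q.1 * M).
  apply: mf_mul; last exact: mf_cst.
  apply: (measurable_comp (F := hl : set (measurableTypeR R)) mhl) mp _.
    by move=> _ [q [q1 _] <-].
  by apply: measurable_funTS; exact: measurable_fst.
apply: (@integrable_ge0 _ (measurableTypeR R * measurableTypeR R)%type R (leb \x leb)%E (hl `*` I)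
  _ (\int[leb]_(x in hl) (p x * M * (2 * pi)))) => //.
  by move=> q [/hl_gt0 q1 _]; rewrite mulr_ge0// p0.
rewrite (tonelli12_rect leb leb mhl mIR (f := fun q => (p q.1 * M)%:E)); last 2 first.
- exact/measurable_EFinP.
- by move=> q [/hl_gt0 q1 _]; rewrite lee_fin mulr_ge0// p0.
transitivity (\int[leb]_(x in hl) (p x * M * (2 * pi))%:E)%E.
  apply: eq_integral => x _; by rewrite /= integral_cst// [RHS]EFinM -lebI.
have ipM : leb.-integrable hl (EFin \o (fun x => p x * M * (2 * pi))).
  rewrite (_ : (fun x => p x * M * (2 * pi)) = fun x => M * (2 * pi) * p x).
    exact: (@integrable_scale _ (measurableTypeR R) R leb hl (M * (2 * pi)) p mhl ip).
  by apply/funext => x; ring.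
by rewrite -[LHS]fineK//; exact: (integrable_fin_num mhl ipM).
Qed.

Lemma bm_kint f x : 0 < x -> bm I f -> bm I (fun u => kint x u * f u).
Proof.
move=> x0 bf; apply: bm_mul => //; split.
  apply: (@measurable_Rintegral_iter1 _ _ (measurableTypeR R) (measurableTypeR R) R leb I hl
    (fun p => p.2 `^ s * expR (- (p.2 ^+ 2 / (4 * x)) - p.2 * cosh p.1))) => //.
  by mfun.
exists (kint x 0) => u _; rewrite (ger0_norm (kint_ge0 x u)); exact: kint_le.
Qed.

Let inner_u x : 0 < x -> (\int[leb]_(u in I) (F x u)%:E = (x `^ (- 2^-1) * Vint mu tau 0 x * fr x)%:E)%E.
Proof.
move=> x0; have ik := bm_integrable mIR (@fI R) (bm_kint x0 bphi).
rewrite /F; under eq_integral do rewrite EFinM.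
rewrite integralZl// [in RHS]EFinM; congr (_ * _)%E.
by rewrite /fr /Rintegral fineK//; exact: integrable_fin_num.
Qed.

Let inner_x u : (\int[leb]_(x in hl) (F x u)%:E =
  (Wcst mu * (Num.sqrt pi * Gamma s) * pi / sinh (n%:R * pi) * (psi u * sin (n%:R * u)))%:E)%E.
Proof.
have ix : leb.-integrable hl (EFin \o (fun x => x `^ (- 2^-1) * kint x u * Vint mu tau 0 x)).
  apply: (@integrable_le _ (measurableTypeR R) R leb hl _ p) => //.
  - by have h := mkint u; have h2 := mV tau; mfun.
  - move=> x /hl_gt0 x0; have := V_le x0; have := kint_le u x0; have := kint_ge0 x u; have := powR_ge0 x (- 2^-1).
    rewrite /p !normrM; move: (x `^ _) (kint x u) (kint x 0) (Vint mu tau 0 x) (Vint mu 0 0 x).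
    move=> y k k0 V V0 y0 k1 k2 V1; rewrite (ger0_norm y0) (ger0_norm k1) -!mulrA ler_wpM2l//.
    by rewrite ler_pM.
transitivity (\int[leb]_(x in hl) ((phi u)%:E * (x `^ (- 2^-1) * kint x u * Vint mu tau 0 x)%:E))%E.
  by apply: eq_integral => x _; rewrite -EFinM /F; congr (_%:E); ring.
rewrite integralZl// integral_kint_Vint.
have iq : leb.-integrable hl (EFin \o (fun v => cos (tau * v) * (Num.sqrt pi * Gamma s / (cosh u + cosh v)))).
  apply: (@integrable_le _ (measurableTypeR R) R leb hl _ _ _ _ _ (integrable_quotient_cosh u)) => //.
    by apply: mf_mul; [mfun|apply: mf_mul; [exact: mf_cst|mfun]].
  move=> v _; rewrite normrM.
  have q0 : 0 <= Num.sqrt pi * Gamma s / (cosh u + cosh v).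
    by rewrite divr_ge0 ?mulr_ge0 ?sqrtr_ge0 ?(ltW (Gamma_gt0 s0))// addr_ge0// ltW// cosh_gt0.
  by rewrite (ger0_norm q0) ler_piMl// cos_max.
rewrite -integralZl//.
have iq2 : leb.-integrable hl (EFin \o (fun v => cos (n%:R * v) * (sinh u / (cosh u + cosh v)))).
  apply: (@integrable_le _ (measurableTypeR R) R leb hl _ (fun v => `|sinh u| * 2 * expR (- v))) => //.
  - by mfun.
  - by move=> v _; rewrite mulrCA normrM -[leRHS]mulrA ler_wpM2l// poisson_kernel_bound// cos_max.
  - by apply: (@integrable_scale _ (measurableTypeR R) R leb hl) => //; exact: integrable_expRN.
transitivity (\int[leb]_(v in hl) ((Wcst mu * (Num.sqrt pi * Gamma s) * psi u)%:E * (cos (n%:R * v) * (sinh u / (cosh u + cosh v)))%:E))%E.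
  by apply: eq_integral => v _; rewrite -!EFinM /phi /tau; congr (_%:E); ring.
rewrite integralZl// integral_poisson_kernel// -EFinM; congr (_%:E); ring.
Qed.

(** Exchanging x and u leaves, for fixed u, the transform of the kernel; the factor sinh u completes
    its v-integral to the one evaluated in [integral_poisson_kernel]. *)
Lemma whittaker_coefficient :
  \int[leb]_(x in hl) (expR (- (x / 2)) * Wfun mu n%:R x *
     (\int[leb]_(u in I) (kint x u * (psi u * sinh u))) * x `^ (mu - 2)) =
  2 `^ (s + 1) * pi / sinh (n%:R * pi) * \int[leb]_(u in I) (psi u * sin (n%:R * u)).
Proof.
(* The normalisation of W cancels the factor sqrt(pi) Gamma(s) that the transform produces. *)
have s2 : Wcst mu * (Num.sqrt pi * Gamma s) = 2 `^ (s + 1).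
  by rewrite /Wcst mulfVK// gt_eqF// mulr_gt0 ?Gamma_gt0// sqrtr_gt0 pi_gt0.
have frE x : 0 < x -> fr x = Wcst mu * \int[leb]_(u in I) (kint x u * (psi u * sinh u)).
  move=> x0; rewrite -(bm_RintegralZ mIR (@fI R) _ (bm_kint x0 bpsinh)).
  by apply: eq_Rintegral => u _; rewrite /phi mulrCA.
have e x : 0 < x -> expR (- (x / 2)) * Wfun mu n%:R x *
    (\int[leb]_(u in I) (kint x u * (psi u * sinh u))) * x `^ (mu - 2) =
    x `^ (- 2^-1) * Vint mu tau 0 x * fr x.
  move=> x0; rewrite frE// /Wfun; have -> : x `^ (- 2^-1) = x `^ (3 / 2 - mu) * x `^ (mu - 2).
    by rewrite -powRD ?(gt_eqF x0) ?implybT//; congr (_ `^ _); field.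
  have := expR_gt0 (x / 2); rewrite expRN /tau.
  move: (expR _) (\int[_]_(_ in _) _) => y J y0.
  by field; rewrite gt_eqF.
have bs : bm I (fun u => psi u * sin (n%:R * u)).
  by apply: bm_mul => //; apply: bm_sin; mfun.
have ibs := bm_integrable mIR (@fI R) bs.
rewrite -s2 [LHS]/Rintegral -[RHS]/(fine (_%:E)); congr fine.
transitivity (\int[leb]_(x in hl) \int[leb]_(u in I) (F x u)%:E)%E.
  by apply: eq_integral => x; rewrite inE => /hl_gt0 x0; rewrite inner_u// e.
rewrite (fubini12_rect mhl mIR (f := fun q => (F q.1 q.2)%:E))//.
rewrite -(fubini21_rect mhl mIR (f := fun q => (F q.1 q.2)%:E))//=.
under eq_integral do rewrite inner_x EFinM.
transitivity ((Wcst mu * (Num.sqrt pi * Gamma s) * pi / sinh (n%:R * pi))%:E *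
   \int[leb]_(u in I) (psi u * sin (n%:R * u))%:E)%E.
  exact: (@integralZl _ (measurableTypeR R) R leb I mIR _ ibs).
rewrite [RHS]EFinM /Rintegral fineK//; exact: (integrable_fin_num mIR ibs).
Qed.

End coefficient.
End transform.

Local Open Scope complex_scope.

(** * Uniqueness of the recessive solution *)

Section complex_limits.
Variables (R : realType) (T : Type) (F : set_system T).
Context {FF : Filter F}.
Implicit Types (f : T -> R[i]) (l : R[i]).

Lemma normc_le_ReIm (z : R[i]) : `|z| <= (`|complex.Re z| + `|complex.Im z|)%:C.
Proof.
rewrite [leLHS](_ : _ = `|(complex.Re z)%:C + 'i%C * (complex.Im z)%:C|); last by rewrite -complexE.
rewrite (le_trans (ler_normD _ _))// rmorphD/= lerD// ?normrM !normc_def/=.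
  by rewrite expr0n addr0 sqrtr_sqr.
by rewrite !expr0n/= !expr1n addr0 add0r !sqrtr1 mul1r sqrtr_sqr.
Qed.

Lemma normc_ge_Im (z : R[i]) : `|complex.Im z|%:C <= `|z|.
Proof.
by rewrite normc_def lecR -sqrtr_sqr ler_wsqrtr// lerDr sqr_ge0.
Qed.

Lemma cvg_Re f l : f x @[x --> F] --> (l : R[i]^o) ->
  complex.Re (f x) @[x --> F] --> complex.Re l.
Proof.
move=> H; apply/cvgrPdist_lt => e e0.
have ec : 0 < e%:C :> R[i]^o by rewrite ltcR.
have := (@cvgrPdist_lt _ R[i]^o T F FF f l).1 H _ ec.
apply: filterS => t Ht.
by rewrite -ltcR (le_lt_trans _ Ht)// -raddfB normc_ge_Re.
Qed.

Lemma cvg_Im f l : f x @[x --> F] --> (l : R[i]^o) ->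
  complex.Im (f x) @[x --> F] --> complex.Im l.
Proof.
move=> H; apply/cvgrPdist_lt => e e0.
have ec : 0 < e%:C :> R[i]^o by rewrite ltcR.
have := (@cvgrPdist_lt _ R[i]^o T F FF f l).1 H _ ec.
apply: filterS => t Ht.
by rewrite -ltcR (le_lt_trans _ Ht)// -raddfB normc_ge_Im.
Qed.

Lemma cvg_complex f l : complex.Re (f x) @[x --> F] --> complex.Re l ->
  complex.Im (f x) @[x --> F] --> complex.Im l ->
  f x @[x --> F] --> (l : R[i]^o).
Proof.
move=> /cvgrPdist_lt H1 /cvgrPdist_lt H2; apply/(@cvgrPdist_lt _ R[i]^o T F FF f l) => e e0.
(* A positive element of R[i] is real, so epsilon equals its real part. *)
have [e1 e2] : 0 < complex.Re e /\ e = (complex.Re e)%:C.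
  by move: e0; rewrite ltcE/=; case: e => a b /= /andP[/eqP -> ->].
have h : 0 < complex.Re e / 2 by rewrite divr_gt0.
near=> t; rewrite e2 (le_lt_trans (normc_le_ReIm _))// ltcR.
have a1 : `|complex.Re l - complex.Re (f t)| < complex.Re e / 2 by near: t; exact: H1.
have a2 : `|complex.Im l - complex.Im (f t)| < complex.Re e / 2 by near: t; exact: H2.
by rewrite !raddfB/=; lra.
Unshelve. all: by end_near. Qed.

End complex_limits.

Section linear_ode.
Variable R : realType.
Implicit Types (f : R -> R) (a b x y : R).

Lemma mean_value_pos f f' a b : (forall x, 0 < x -> hasder x f (f' x)) ->
  0 < a -> a < b -> exists2 c, a < c < b & f b - f a = f' c * (b - a).
Proof.
move=> df a0 ab; have [||c] := @MVT R f f' a b ab.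
- by move=> x; rewrite in_itv/= => /andP[ax _]; apply: df; exact: lt_trans ax.
- apply: derivable_within_continuous => x; rewrite in_itv/= => /andP[ax _].
  by have [] := df x (lt_le_trans a0 ax).
- by rewrite in_itv/= => cab e; exists c.
Qed.

Lemma hasder0_cst f : (forall x, 0 < x -> hasder x f 0) ->
  forall x y, 0 < x -> 0 < y -> f x = f y.
Proof.
move=> df; suff H x y : 0 < x -> x < y -> f x = f y.
  by move=> x y x0 y0; have [/H->|/H->|->] := ltgtP x y.
move=> x0 xy; have [c _] := mean_value_pos df x0 xy.
by rewrite mul0r => /subr0_eq.
Qed.

Variables (q : R -> R).

(* Gronwall for the energy [d^2 + d'^2], run backwards from [b]. *)
Lemma ode_zero_backward (d d1 : R -> R) a b M :
  (forall x, 0 < x -> hasder x d (d1 x)) ->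
  (forall x, 0 < x -> hasder x d1 (- (q x * d x))) ->
  0 < a -> a < b -> (forall x, a <= x <= b -> `|q x| <= M) ->
  d b = 0 -> d1 b = 0 -> d a = 0.
Proof.
move=> dd dd1 a0 ab qM db d1b.
pose E x := (d x ^+ 2 + d1 x ^+ 2) * expR ((1 + M) * x).
pose E' x := (2 * d x * d1 x * (1 - q x) + (1 + M) * (d x ^+ 2 + d1 x ^+ 2)) * expR ((1 + M) * x).
have dE x : 0 < x -> hasder x E (E' x).
  move=> x0; have h1 := dd x x0; have h2 := dd1 x x0.
  by rewrite /E; der => /=; rewrite /E'; ring.
have [c /andP[ac cb] e] := mean_value_pos dE a0 ab.
(* The mixed term 2 d d1 (1 - q) is at most (1 + M) (d^2 + d1^2) in absolute value. *)
have E'0 : 0 <= E' c.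
  rewrite mulr_ge0 ?expR_ge0//.
  have : `|q c| <= M by apply: qM; rewrite !ltW.
  rewrite ler_norml => /andP[q1 q2].
  have s1 : 0 <= (d c - d1 c) ^+ 2 by exact: sqr_ge0.
  have s2 : 0 <= (d c + d1 c) ^+ 2 by exact: sqr_ge0.
  have p1 : 0 <= M + q c by lra.
  have p2 : 0 <= M - q c by lra.
  have := mulr_ge0 p1 s1; have := mulr_ge0 p2 s2; move: s1 s2; nra.
have Eb : E b = 0 by rewrite /E db d1b expr0n addr0 mul0r.
have Ea : E a <= 0.
  have : 0 <= E' c * (b - a) by rewrite mulr_ge0// subr_ge0 ltW.
  by rewrite -e Eb; lra.
have da : d a ^+ 2 <= 0.
  move: Ea; rewrite /E pmulr_lle0 ?expR_gt0//; have := sqr_ge0 (d1 a); lra.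
by apply/eqP; rewrite -(sqrf_eq0 (d a)) eq_le da sqr_ge0.
Qed.

(* If [w > 0] and [d / w -> 0] with [w] bounded, the Wronskian [W] of [d] and [w]
   vanishes because [(d / w)' = W / w^2]; so [d] is [0] near infinity. *)
Lemma ode_recessive_zero (d d1 w w1 : R -> R) (K : R) :
  (forall x, 0 < x -> hasder x d (d1 x)) ->
  (forall x, 0 < x -> hasder x d1 (- (q x * d x))) ->
  (forall x, 0 < x -> hasder x w (w1 x)) ->
  (forall x, 0 < x -> hasder x w1 (- (q x * w x))) ->
  (forall a b, 0 < a -> exists M : R, forall x, a <= x <= b -> `|q x| <= M) ->
  (\forall x \near +oo, 0 < w x <= K) ->
  d x / w x @[x --> +oo] --> (0 : R) ->
  forall x, 0 < x -> d x = 0.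
Proof.
move=> dd dd1 dw dw1 qb [X [_ wX]] dw0.
pose Wr x := d1 x * w x - d x * w1 x.
have Wr0 x : 0 < x -> hasder x Wr 0.
  move=> x0; have := dd x x0; have := dd1 x x0; have := dw x x0; have := dw1 x x0 => h1 h2 h3 h4.
  by rewrite /Wr; der => /=; ring.
pose C := Wr 1.
have WC x : 0 < x -> Wr x = C by move=> x0; apply: hasder0_cst.
have lt1 (y : R) : y < y + 1 by rewrite ltrDl.
have ltm (y z : R) : y < Num.max y z + 1 /\ z < Num.max y z + 1.
  by split; apply: le_lt_trans (lt1 _); rewrite le_max lexx ?orbT.
pose Y := Num.max X 1.
have wY x : Y < x -> [/\ 0 < x, 0 < w x & w x <= K].
  rewrite gt_max => /andP[Xx x1]; have /andP[? ?] := wX _ Xx; split => //.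
  exact: lt_trans x1.
have dr x : Y < x -> hasder x (fun t => d t / w t) (C / w x ^+ 2).
  move=> /wY[x0 w0 _]; have := dd x x0; have := dw x x0 => h1 h2.
  der; first by rewrite gt_eqF.
  by rewrite /= -(WC x)// /Wr; field; rewrite gt_eqF.
have step x : Y < x -> exists2 c, Y < c & d (x + 1) / w (x + 1) - d x / w x = C / w c ^+ 2.
  move=> Yx; have xx : x < x + 1 by rewrite ltrDl.
  have [||c] := @MVT R (fun t => d t / w t) (fun t => C / w t ^+ 2) x (x + 1) xx.
  - by move=> y; rewrite in_itv/= => /andP[xy _]; apply: dr; exact: lt_trans xy.
  - apply: derivable_within_continuous => y; rewrite in_itv/= => /andP[xy _].
    by have [] := dr y (lt_le_trans Yx xy).
  - rewrite in_itv/= => /andP[xc _] e; exists c; first exact: lt_trans xc.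
    by rewrite e [x + 1]addrC addrK mulr1.
(* Over a unit step d / w changes by C / w^2 taken at some point, hence by at least |C| / K^2 in
   size, while both ends of the step tend to 0. *)
have C0 : C = 0.
  apply/eqP/negPn/negP => Cn0.
  have K0 : 0 < K by have [_ a b] := wY (Y + 1) (lt1 _); exact: lt_le_trans b.
  pose e := `|C| / K ^+ 2 / 2.
  have e0 : 0 < e by rewrite !divr_gt0// ?normr_gt0// exprn_gt0.
  move/cvgrPdist_lt : dw0 => /(_ _ e0)[Z [_ HZ]].
  pose x := Num.max Y Z + 1.
  have [Yx Zx] : Y < x /\ Z < x by exact: ltm.
  have h1 := HZ _ Zx; have h2 := HZ (x + 1) (lt_trans Zx (lt1 _)).
  have [c Yc ec] := step x Yx.
  have [_ wc wK] := wY c Yc.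
  have : `|C / w c ^+ 2| < 2 * e.
    rewrite -ec; move: h1 h2; rewrite !sub0r !normrN => h1 h2.
    by apply: le_lt_trans (ler_normB _ _) _; lra.
  rewrite ltNge => /negP; apply.
  rewrite /e mulrC divfK// normrM ler_wpM2l// normfV ger0_norm ?sqr_ge0//.
  by rewrite lef_pV2 ?posrE ?exprn_gt0// ler_sqr ?nnegrE ?(ltW K0) ?(ltW wc).
(* With C = 0 the quotient is constant along x + n, hence equal to its limit 0. *)
have d0 x : Y < x -> d x = 0.
  move=> Yx; have [x0 w0 _] := wY x Yx.
  suff : d x / w x = 0 by move/eqP; rewrite mulf_eq0 invr_eq0 (gt_eqF w0) orbF => /eqP.
  have cst n : d (x + n%:R) / w (x + n%:R) = d x / w x.
    elim: n => [|n IH]; first by rewrite addr0.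
    have [|c _] := step (x + n%:R); first by rewrite (lt_le_trans Yx)// lerDl.
    by rewrite C0 mul0r => /subr0_eq; rewrite -addrA -natr1 => ->.
  have l1 : d (x + n%:R) / w (x + n%:R) @[n --> \oo] --> (0 : R).
    apply: (cvg_comp (fun n : nat => x + n%:R) (fun t => d t / w t) _ dw0).
    apply/cvgryPge => A; near=> n.
    rewrite -lerBlDl; near: n; exact: nbhs_infty_ger.
  have l2 : d (x + n%:R) / w (x + n%:R) @[n --> \oo] --> d x / w x.
    by under eq_fun do rewrite cst; exact: cvg_cst.
  exact: (cvg_unique _ l2 l1).
have d10 x : Y < x -> d1 x = 0.
  move=> Yx; have [x0 w0 _] := wY x Yx.
  have := WC x x0; rewrite C0 /Wr d0// mul0r subr0 => /eqP.
  by rewrite mulf_eq0 (gt_eqF w0) orbF => /eqP.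
move=> x x0; pose b := Num.max Y x + 1.
have [Yb xb] : Y < b /\ x < b by exact: ltm.
have [M HM] := qb x b x0.
by apply: (ode_zero_backward dd dd1 x0 xb HM); [exact: d0|exact: d10].
Unshelve. all: by end_near. Qed.

End linear_ode.
Lemma ReD (R : realType) (z t : R[i]) : complex.Re (z + t) = complex.Re z + complex.Re t.
Proof. by case: z; case: t. Qed.

Lemma ImD (R : realType) (z t : R[i]) : complex.Im (z + t) = complex.Im z + complex.Im t.
Proof. by case: z; case: t. Qed.

Lemma ReMr (R : realType) (a : R) (z : R[i]) : complex.Re (a%:C * z) = a * complex.Re z.
Proof. by case: z => x y /=; rewrite mul0r subr0. Qed.

Lemma ImMr (R : realType) (a : R) (z : R[i]) : complex.Im (a%:C * z) = a * complex.Im z.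
Proof. by case: z => x y /=; rewrite mul0r addr0. Qed.

Section whittakerW.
Variables (R : realType) (mu tau : R) (hmu : mu < 1 / 2).
Implicit Types (x : R).
Local Notation nu := (0 +i* (tau / 2)).

Let q x : R := - (1 / 4) + mu / x + (1 / 4 + tau ^+ 2 / 4) / x ^+ 2.

(** nu is imaginary, so nu^2 = - tau^2 / 4 and the coefficient is real: the real and imaginary parts
    of a solution solve the equation separately. *)
Let qE x : - (1 / 4) + mu%:C / x%:C + (1 / 4 - nu ^+ 2) / x%:C ^+ 2 = (q x)%:C.
Proof.
have e4 : (1 / 4 : R[i]) = (1 / 4)%:C by rewrite fmorph_div rmorph1 rmorph_nat.
have e2 : nu ^+ 2 = (- (tau ^+ 2 / 4))%:C.
  apply/eqP; rewrite expr2 eq_complex/= !mul0r !mulr0 addr0 sub0r eqxx andbT.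
  by apply/eqP; field.
by rewrite e4 e2 /q !(rmorphD, rmorphN, fmorph_div, rmorphXn)/= opprK.
Qed.

Let q_bounded (a b : R) : 0 < a -> exists M : R, forall x, a <= x <= b -> `|q x| <= M.
Proof.
move=> a0; exists (1 / 4 + `|mu| / a + (1 / 4 + tau ^+ 2 / 4) / a ^+ 2) => x /andP[ax _].
have x0 : 0 < x by exact: lt_le_trans ax.
rewrite /q (le_trans (ler_normD _ _))// lerD//.
  rewrite (le_trans (ler_normD _ _))// lerD//; first by rewrite normrN ger0_norm.
  by rewrite normrM ler_wpM2l// normfV gtr0_norm// lef_pV2.
rewrite normrM [X in X * _]ger0_norm; last by rewrite addr_ge0// divr_ge0// sqr_ge0.
rewrite ler_wpM2l//; first by rewrite addr_ge0// divr_ge0// sqr_ge0.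
rewrite normfV ger0_norm ?sqr_ge0// lef_pV2 ?posrE ?exprn_gt0//.
by rewrite ler_sqr// nnegrE ltW.
Qed.

Let hasder_derive1 f x : derivable f x 1 -> hasder x f (derive1 f x).
Proof. by move=> df; rewrite derive1E; split. Qed.

Let derive1_hasder f a x : hasder x f a -> derive1 f x = a.
Proof. by move=> [_ <-]; rewrite derive1E. Qed.

Let near_pos x : 0 < x -> \forall t \near x, 0 < t.
Proof. exact: lt_nbhsr. Qed.

Let derive1_Wfun x : 0 < x -> derive1 (Wfun mu tau) x = Wfun1 mu tau x.
Proof. by move=> x0; apply: derive1_hasder; exact: hasder_Wfun. Qed.

Let hasder_derive1_Wfun x : 0 < x -> hasder x (derive1 (Wfun mu tau)) (Wfun2 mu tau x).
Proof.
move=> x0; apply: near_eq_is_derive (hasder_Wfun1 tau hmu x0).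
by apply: filterS (near_pos x0) => t t0; rewrite derive1_Wfun.
Qed.

Let Wfun_eq x : 0 < x -> Wfun2 mu tau x = - (q x * Wfun mu tau x).
Proof. by move=> x0; have := Wfun_ode tau hmu x0; rewrite -/(q x) => /eqP; rewrite addr_eq0 => /eqP. Qed.

Lemma is_whittakerW_Wfun : is_whittakerW mu nu (fun x => (Wfun mu tau x)%:C).
Proof.
have d1 : cderive1 (fun x => (Wfun mu tau x)%:C) = (fun x => (derive1 (Wfun mu tau) x)%:C).
  by apply/funext => x; rewrite /cderive1/= (derive1_hasder (der_cst x 0)).
split=> [x x0|].
  rewrite d1; split.
  - by split => /=; [have [] := hasder_Wfun tau hmu x0|exact: derivable_cst].
  - by split => /=; [have [] := hasder_derive1_Wfun x0|exact: derivable_cst].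
  - rewrite /cderive1/= (derive1_hasder (hasder_derive1_Wfun x0)).
    rewrite (derive1_hasder (der_cst x 0)).
    rewrite qE -[_ +i* 0]/((Wfun2 mu tau x)%:C) -rmorphM -rmorphD/= Wfun_eq//.
    by rewrite addNr.
have e : (fun x => (Wfun mu tau x)%:C / (expR (- (x / 2)) * x `^ mu)%:C) =
   (fun x => (Wfun mu tau x / (expR (- (x / 2)) * x `^ mu))%:C).
  by apply/funext => x; rewrite fmorph_div.
rewrite e; apply: cvg_complex => /=; first exact: Wfun_asymp.
exact: cvg_cst.
Qed.

Let scale_pos x : 0 < x -> 0 < expR (- (x / 2)) * x `^ mu.
Proof. by move=> x0; rewrite mulr_gt0 ?expR_gt0 ?powR_gt0. Qed.

(** Eventually the ratio to e^(-x/2) x^mu is within 1/2 of 1, and that scale is at most 2 since x^mu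
    <= x and e^(x/2) >= 1 + x / 2. *)
Let Wfun_bounded : \forall x \near +oo, 0 < Wfun mu tau x <= 4.
Proof.
have := Wfun_asymp tau hmu; move/cvgrPdist_lt => /(_ 2^-1 _) H.
have {H}H := H (ltac:(by rewrite invr_gt0)).
near=> x.
have x1 : 1 <= x by near: x; exact: nbhs_pinfty_ge.
have x0 : 0 < x by lra.
have h : `|1 - Wfun mu tau x / (expR (- (x / 2)) * x `^ mu)| < 2^-1 by near: x.
have p0 := scale_pos x0.
have p2 : expR (- (x / 2)) * x `^ mu <= 2.
  have xm : x `^ mu <= x.
    by rewrite -[leRHS]powRr1 ?(ltW x0)//; apply: ler_powR => //; move: hmu; lra.
  rewrite expRN mulrC ler_pdivrMr ?expR_gt0// (le_trans xm)//.
  by have := expR_ge1Dx (x / 2); lra.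
move: h p0 p2; set p := expR _ * _; rewrite ltr_norml => /andP[h1 h2] p0 p2.
have : Wfun mu tau x = (Wfun mu tau x / p) * p by rewrite divfK// gt_eqF.
move: h1 h2; set r := Wfun mu tau x / p => h1 h2 ->.
by apply/andP; split; nra.
Unshelve. all: by end_near. Qed.

(** The imaginary part of w, and its real part minus [Wfun], are solutions whose quotient by [Wfun]
    tends to 0; [ode_recessive_zero] makes both vanish. *)
Lemma whittakerW_unique (w : R -> R[i]) : is_whittakerW mu nu w ->
  forall x, 0 < x -> w x = (Wfun mu tau x)%:C.
Proof.
move=> [ode wlim].
pose u t := complex.Re (w t); pose v t := complex.Im (w t).
have uode x : 0 < x -> [/\ derivable u x 1, derivable (derive1 u) x 1 &
    derive1 (derive1 u) x + q x * u x = 0].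
  move=> x0; case: (ode x x0) => -[a _] [b _] e; split; [exact: a|exact: b|].
  by move: e; rewrite qE => /(congr1 (@complex.Re R)); rewrite ReD ReMr.
have vode x : 0 < x -> [/\ derivable v x 1, derivable (derive1 v) x 1 &
    derive1 (derive1 v) x + q x * v x = 0].
  move=> x0; case: (ode x x0) => -[_ a] [_ b] e; split; [exact: a|exact: b|].
  by move: e; rewrite qE => /(congr1 (@complex.Im R)); rewrite ImD ImMr.
have p1 x : 0 < x -> hasder x u (derive1 u x).
  by move=> /uode[a _ _]; exact: hasder_derive1.
have p2 x : 0 < x -> hasder x v (derive1 v x).
  by move=> /vode[a _ _]; exact: hasder_derive1.
have p3 x : 0 < x -> hasder x (derive1 u) (- (q x * u x)).
  move=> /uode[_ a /eqP]; rewrite addr_eq0 => /eqP <-; exact: hasder_derive1.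
have p4 x : 0 < x -> hasder x (derive1 v) (- (q x * v x)).
  move=> /vode[_ a /eqP]; rewrite addr_eq0 => /eqP <-; exact: hasder_derive1.
have w1 x : 0 < x -> hasder x (Wfun1 mu tau) (- (q x * Wfun mu tau x)).
  by move=> x0; rewrite -(Wfun_eq x0); exact: (hasder_Wfun1 tau hmu x0).
have w0 x : 0 < x -> hasder x (Wfun mu tau) (Wfun1 mu tau x) by move=> x0; exact: (hasder_Wfun tau hmu x0).
have lim1 := Wfun_asymp tau hmu.
have limR : u x / (expR (- (x / 2)) * x `^ mu) @[x --> +oo] --> (1 : R).
  have e : (fun x => complex.Re (w x / (expR (- (x / 2)) * x `^ mu)%:C)) =
      fun x => u x / (expR (- (x / 2)) * x `^ mu).
    by apply/funext => x; rewrite -fmorphV mulrC ReMr mulrC.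
  by rewrite -e; exact: (cvg_Re wlim).
have limI : v x / (expR (- (x / 2)) * x `^ mu) @[x --> +oo] --> (0 : R).
  have e : (fun x => complex.Im (w x / (expR (- (x / 2)) * x `^ mu)%:C)) =
      fun x => v x / (expR (- (x / 2)) * x `^ mu).
    by apply/funext => x; rewrite -fmorphV mulrC ImMr mulrC.
  by rewrite -e; exact: (cvg_Im wlim).
have ratio (d : R -> R) : d x / (expR (- (x / 2)) * x `^ mu) @[x --> +oo] --> (0 : R) ->
    d x / Wfun mu tau x @[x --> +oo] --> (0 : R).
  move=> d0; have h : (d x / (expR (- (x / 2)) * x `^ mu)) / (Wfun mu tau x / (expR (- (x / 2)) * x `^ mu)) @[x --> +oo] --> 0 / (1 : R).
    by apply: cvgM => //; apply: cvgV => //; exact: oner_neq0.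
  rewrite mul0r in h; apply: cvg_trans h; apply: near_eq_cvg; near=> x.
  have x0 : 0 < x by near: x; exact: nbhs_pinfty_gt.
  have p0 := scale_pos x0.
  have /andP[w00 _] : 0 < Wfun mu tau x <= 4 by near: x.
  move: w00 p0; move: (Wfun mu tau x) (expR _ * _) => W p W0 p0.
  by field; rewrite !gt_eqF.
move=> x x0.
have hI : v x = 0.
  exact: (ode_recessive_zero p2 p4 w0 w1 q_bounded Wfun_bounded (ratio _ limI) x0).
have hR : u x - Wfun mu tau x = 0.
  apply: (@ode_recessive_zero _ q (fun t => u t - Wfun mu tau t)
    (fun t => derive1 u t - Wfun1 mu tau t) _ _ _ _ _ w0 w1 q_bounded Wfun_bounded _ x x0).
  - by move=> t t0; apply: der_add; [exact: p1|apply: der_opp; exact: w0].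
  - move=> t t0; apply: (@der_eq _ _ _ (- (q t * u t) + - (- (q t * Wfun mu tau t)))).
      by apply: der_add; [exact: p3|apply: der_opp; exact: w1].
    by ring.
  - apply: ratio; rewrite -(subrr (1 : R)).
    by under eq_fun do rewrite mulrBl; exact: cvgB.
by rewrite [LHS]complexE -/(u x) -/(v x) hI mulr0 addr0; congr (_%:C); apply/eqP; rewrite -subr_eq0 hR.
Unshelve. all: by end_near. Qed.

Lemma whittakerW_Wfun x : 0 < x -> whittakerW mu nu x = (Wfun mu tau x)%:C.
Proof.
move=> x0; apply: whittakerW_unique => //; rewrite /whittakerW.
by have := xgetPex (fun=> 0) (ex_intro _ _ is_whittakerW_Wfun).
Qed.

End whittakerW.

(** * Inversion formula *)

Section inversion.
Variables (R : realType) (mu : R) (hmu : mu < 1 / 2).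
Local Notation leb := (@lebesgue_measure R).
Local Notation hl := (`]0%R, +oo[%classic : set R).
Local Notation I := (`[- pi, pi]%classic : set R).
Local Notation s := (1 - 2 * mu).
Implicit Types (x u v : R).

Let mIR : measurable (I : set (measurableTypeR R)). Proof. exact: mI. Qed.

Let IN u : I u -> I (- u).
Proof. by rewrite /= !in_itv/= lerN2 lerNl andbC. Qed.

Lemma bm_reflect (h : R -> R) : bm I h -> bm I (fun u => h (- u)).
Proof.
move=> [mh [M hM]]; split; last by exists M => u Iu; exact/hM/IN.
apply: (measurable_comp (F := I : set (measurableTypeR R)) mIR) mh _.
  by move=> _ [u Iu <-]; exact: IN.
by apply: measurable_funTS; apply: mf_opp; exact: measurable_id.
Qed.

(** Lebesgue measure is its own image under negation; the integrand is extended by zero in order to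
    be measurable on the whole line. *)
Lemma Rintegral_reflect (h : R -> R) : bm I h ->
  \int[leb]_(u in I) h (- u) = \int[leb]_(u in I) h u.
Proof.
move=> bh; rewrite /Rintegral; congr fine.
have NI : (-%R : measurableTypeR R -> measurableTypeR R) @^-1` I = I.
  by apply/seteqP; split=> x; [move=> /IN; rewrite opprK|exact: IN].
have mN : measurable_fun [set: measurableTypeR R] (-%R : measurableTypeR R -> measurableTypeR R).
  by apply: mf_opp; exact: measurable_id.
pose h' : measurableTypeR R -> \bar R := EFin \o (h \_ I).
have mh' : measurable_fun [set: measurableTypeR R] h'.
  by apply/measurable_EFinP; apply/(measurable_restrictT _ _).1 => //; exact: (proj1 bh).
have h'E u : I u -> h' u = (h u)%:E by move=> Iu; rewrite /h' /= patchE mem_set.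
transitivity (\int[leb]_(u in (-%R : measurableTypeR R -> measurableTypeR R) @^-1` I) (h' \o -%R) u)%E.
  by rewrite NI; apply: eq_integral => u; rewrite inE => Iu /=; rewrite h'E//; exact: IN.
have ih' : leb.-integrable ((-%R : measurableTypeR R -> measurableTypeR R) @^-1` I) (h' \o -%R).
  rewrite NI; apply: eq_integrable (bm_integrable mIR (@fI R) (bm_reflect bh)) => //.
  by move=> u; rewrite inE => Iu /=; rewrite h'E//; exact: IN.
rewrite -(integral_pushforward mN mh' ih' mIR).
transitivity (\int[leb]_(u in I) h' u)%E.
  by apply: eq_measure_integral => A mA _; exact: lebesgue_measureN.
by apply: eq_integral => u; rewrite inE => Iu; rewrite h'E.
Qed.

Section real_series.
Variables (psi : R -> R) (C : R) (C0 : 0 < C).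
Hypothesis psi_lip : forall u v, - pi <= u <= pi -> - pi <= v <= pi -> `|psi u - psi v| <= C * `|u - v|.
Hypothesis psi_pi : psi (- pi) = psi pi.
Variables (x : R) (x0 : 0 < x).

Let bpsi : bm I psi.
Proof. by split; [exact: measurable_lipschitz C0 psi_lip|exact: lipschitz_bound psi_lip]. Qed.

Definition coefficient n : R := 2 `^ (s + 1) * pi / sinh (n%:R * pi) *
  \int[leb]_(u in I) (psi u * sin (n%:R * u)).

Let c0 : 0 < Gamma (2 * (1 - mu)) * (2 * x) `^ (1 - mu).
Proof.
by rewrite mulr_gt0 ?powR_gt0 ?mulr_gt0// Gamma_gt0//; move: hmu; lra.
Qed.

(** Collects 2^(s+1) pi from [coefficient], another pi from the normalisation of sine coefficients,
    and the prefactor between [Psi] and [kint]. *)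
Let K : R := 2 `^ (s + 1) * pi ^+ 2 / (Gamma (2 * (1 - mu)) * (2 * x) `^ (1 - mu)).

Let g u := kint mu x u * sinh u.

Let bg : bm I g.
Proof.
apply: bm_kint => //; split.
  by apply: measurable_funTS; apply: continuous_measurable_fun; exact: continuous_sinh.
exists (expR pi) => u; rewrite /= in_itv/= => Iu.
by rewrite (le_trans (norm_sinh_le _))// cosh_le_expR// ler_norml.
Qed.

Let PsiE n : Gamma (2 * (1 - mu)) * (2 * x) `^ (1 - mu) * Psi mu n x =
  \int[leb]_(u in I) (g u * sin (n%:R * u)).
Proof.
have bgs : bm I (fun u => g u * sin (n%:R * u)) by apply: bm_mul => //; apply: bm_sin; mfun.
have c1 := gt_eqF c0.
have -> : Psi mu n x = (Gamma (2 * (1 - mu)) * (2 * x) `^ (1 - mu))^-1 *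
    \int[leb]_(u in I) (g u * sin (n%:R * u)).
  rewrite -(bm_RintegralZ mIR (@fI R) _ bgs); apply: eq_Rintegral => u _.
  rewrite /g -(kint_parcylD hmu u x0); move: c1; move: (Gamma _ * _) => c c1.
  by rewrite -!mulrA mulKf// c1.
by rewrite mulVKf// c1.
Qed.

Let T := fourier_sum psi.

(** The factor sinh (pi n) cancels the one in [coefficient], so each term is a product of sine
    integrals of psi and of [g]; [fourier_sum_odd] sums them under the integral. *)
Let sumE N : \sum_(k < N) (sinh (pi * k.+1%:R) * Psi mu k.+1 x * coefficient k.+1) =
  K * \int[leb]_(u in I) (g u * ((T N u - T N (- u)) / 2)).
Proof.
have bgs n : bm I (fun u => g u * sin (n%:R * u)) by apply: bm_mul => //; apply: bm_sin; mfun.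
pose J n := \int[leb]_(u in I) (psi u * sin (n%:R * u)).
have bgss n : bm I (fun u => pi^-1 * J n * (g u * sin (n%:R * u))) by apply: bm_mul => //; exact: bm_cst.
have -> : \int[leb]_(u in I) (g u * ((T N u - T N (- u)) / 2)) =
    \int[leb]_(u in I) (\sum_(k < N) (pi^-1 * J k.+1 * (g u * sin (k.+1%:R * u)))).
  apply: eq_Rintegral => u _; rewrite (fourier_sum_odd C0 psi_lip) mulr_sumr.
  by apply: eq_bigr => k _; rewrite mulrCA.
rewrite (@bm_Rintegral_sum _ _ mIR (@fI R) N (fun k u => pi^-1 * J k.+1 * (g u * sin (k.+1%:R * u))))//.
rewrite mulr_sumr; apply: eq_bigr => k _.
rewrite (bm_RintegralZ mIR (@fI R) _ (bgs k.+1)) -PsiE /coefficient -/(J k.+1) [pi * k.+1%:R]mulrC /K.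
have sk : 0 < sinh (k.+1%:R * pi) :> R by rewrite sinh_gt0// mulr_gt0// pi_gt0.
have p0 := pi_gt0 R; move: c0 sk p0 (J k.+1); move: (Gamma _ * _) (sinh _) (2 `^ _) => c h z c1 h0.
by move: (Psi _ _ _) (pi : R) => P p p0 j; field; rewrite !gt_eqF.
Qed.

Lemma real_series_cvg :
  \sum_(k < N) (sinh (pi * k.+1%:R) * Psi mu k.+1 x * coefficient k.+1) @[N --> \oo] -->
  K * \int[leb]_(u in I) (kint mu x u * (psi u * sinh u)).
Proof.
rewrite (_ : (fun N => _) = fun N => K * \int[leb]_(u in I) (g u * ((T N u - T N (- u)) / 2))); last first.
  by apply/funext => N; exact: sumE.
apply: cvgM; first exact: cvg_cst.
(* [g] is odd, being the even [kint] times sinh, so psi may be replaced by its odd part. *)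
have -> : \int[leb]_(u in I) (kint mu x u * (psi u * sinh u)) =
    \int[leb]_(u in I) (g u * ((psi u - psi (- u)) / 2)).
  have b1 : bm I (fun u => g u * psi u) by exact: bm_mul.
  have b2 := bm_reflect b1.
  have e : \int[leb]_(u in I) (g u * psi u) =
      2^-1 * (\int[leb]_(u in I) (g u * psi u) + \int[leb]_(u in I) (g (- u) * psi (- u))).
    by rewrite (Rintegral_reflect b1); field.
  transitivity (\int[leb]_(u in I) (g u * psi u)).
    by apply: eq_Rintegral => u _; rewrite /g; ring.
  rewrite e -(bm_RintegralD mIR (@fI R) b1 b2) -(bm_RintegralZ mIR (@fI R) _ (bm_add b1 b2)).
  by apply: eq_Rintegral => u _; rewrite /g /kint coshN sinhN -/(kint mu x u); ring.
have [M TM] := fourier_sum_bound C0 psi_lip psi_pi; have [mg [P gP]] := bg.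
(* The odd part of a Fourier sum is a finite sum of sines, hence bounded and measurable. *)
have bf N : bm I (fun u => g u * ((T N u - T N (- u)) / 2)).
  apply: bm_mul => //; rewrite (_ : (fun u => _) = fun u => \sum_(k < N)
    (pi^-1 * \int[leb]_(v in I) (psi v * sin (k.+1%:R * v)) * sin (k.+1%:R * u))).
    apply: (@bm_sum _ _ N (fun k u => pi^-1 * \int[leb]_(v in I) (psi v * sin (k.+1%:R * v)) * sin (k.+1%:R * u))).
    by move=> k; apply: bm_mul; [exact: bm_cst|apply: bm_sin; mfun].
  by apply/funext => u; rewrite (fourier_sum_odd C0 psi_lip).
have bl : bm I (fun u => g u * ((psi u - psi (- u)) / 2)).
  apply: bm_mul => //; apply: bm_mul; last exact: bm_cst.
  by apply: bm_add => //; apply: bm_opp; exact: bm_reflect.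
have il := bm_integrable mIR (@fI R) bl.
have H : (\int[leb]_(u in I) (g u * ((T N u - T N (- u)) / 2))%:E)%E @[N --> \oo] -->
    (\int[leb]_(u in I) (g u * ((psi u - psi (- u)) / 2)))%:E.
  rewrite [X in _ --> X](_ : _ = \int[leb]_(u in I) (g u * ((psi u - psi (- u)) / 2))%:E)%E; last first.
    by rewrite /Rintegral fineK//; exact: (integrable_fin_num mIR il).
  apply: (@dominated_cvgE _ (measurableTypeR R) R leb I _ _ (fun=> P * M)) => //.
  - by move=> N; exact: (proj1 (bf N)).
  - move=> u Iu; apply: cvgM; first exact: cvg_cst.
    apply: cvgM; last exact: cvg_cst.
    by apply: cvgB; apply: (fourier_sum_cvg C0 psi_lip psi_pi) => //; exact: IN.
  - exact: (bm_integrable mIR (@fI R) (bm_cst I (P * M))).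
  - move=> N u Iu; rewrite normrM ler_pM ?gP//.
    have h1 : `|T N u| <= M := TM N u Iu; have h2 : `|T N (- u)| <= M := TM N (- u) (IN Iu).
    by move: (T N u) (T N (- u)) h1 h2 => y z; rewrite !ler_norml; lra.
by have [_] := (fine_cvgP _ _).1 H.
Qed.

End real_series.
End inversion.

Lemma Re_sum (R : realType) (F : nat -> R[i]) N :
  complex.Re (\sum_(k < N) F k) = \sum_(k < N) complex.Re (F k).
Proof.
elim: N => [|N IH]; first by rewrite !big_ord0.
by rewrite !big_ord_recr/= ReD IH.
Qed.

Lemma Im_sum (R : realType) (F : nat -> R[i]) N :
  complex.Im (\sum_(k < N) F k) = \sum_(k < N) complex.Im (F k).
Proof.
elim: N => [|N IH]; first by rewrite !big_ord0.
by rewrite !big_ord_recr/= ImD IH.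
Qed.

Theorem theorem2 (R : realType) (mu : R) (hmu : mu < 1 / 2)
    (f phi psi : R -> R[i]) (a : nat -> R[i])
    (hphi : forall u : R, phi u = psi u * (sinh u)%:C)
    (psi_periodic : periodic psi (2 * pi))
    (psi_lipschitz : exists2 C : R, 0 < C &
       forall u v : R, - pi <= u <= pi -> - pi <= v <= pi ->
         `|psi u - psi v| <= (C * `|u - v|)%:C)
    (hf : forall x : R, 0 < x ->
       f x = (Gamma (2 * (1 - mu)) * (2 * x) `^ (1 - mu))%:C *
             Cintegral `[- pi, pi] (fun u =>
               (expR (x * cosh u ^+ 2 / 2) *
                parcylD (2 * (mu - 1)) (Num.sqrt (2 * x) * cosh u))%:C *
               phi u))
    (ha : forall n : nat, (1 <= n)%N ->
       a n = Cintegral `]0, +oo[ (fun x =>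
               (expR (- (x / 2)))%:C * whittakerW mu (0 +i* (n%:R / 2)) x *
               f x * (x `^ (mu - 2))%:C)) :
  forall x : R, 0 < x ->
    exists2 S : R[i],
      (\sum_(1 <= n < N.+1)
          (sinh (pi * n%:R))%:C * (Psi mu n x)%:C * a n) @[N --> \oo]
        --> (S : R[i]^o) &
      f x = ((x / 2) `^ (1 - mu) / pi ^+ 2 * Gamma (2 * (1 - mu)))%:C * S.
Proof.
have [C C0 lip] := psi_lipschitz.
(* All kernels are real, so the real and imaginary parts of psi are handled separately as real
   Lipschitz functions. *)
pose p1 u := complex.Re (psi u); pose p2 u := complex.Im (psi u).
have lip1 u v : - pi <= u <= pi -> - pi <= v <= pi -> `|p1 u - p1 v| <= C * `|u - v|.
  move=> Iu Iv; rewrite -lecR; apply: le_trans (lip u v Iu Iv).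
  have -> : p1 u - p1 v = complex.Re (psi u - psi v) by rewrite /p1; case: (psi u); case: (psi v).
  exact: normc_ge_Re.
have lip2 u v : - pi <= u <= pi -> - pi <= v <= pi -> `|p2 u - p2 v| <= C * `|u - v|.
  move=> Iu Iv; rewrite -lecR; apply: le_trans (lip u v Iu Iv).
  have -> : p2 u - p2 v = complex.Im (psi u - psi v) by rewrite /p2; case: (psi u); case: (psi v).
  exact: normc_ge_Im.
have psiN : psi (- pi) = psi pi.
  by rewrite -(psi_periodic (- pi)); congr psi; ring.
have e1 : p1 (- pi) = p1 pi by rewrite /p1 psiN.
have e2 : p2 (- pi) = p2 pi by rewrite /p2 psiN.
have b1 : bm `[- pi, pi] p1.
  by split; [exact: measurable_lipschitz C0 lip1|exact: lipschitz_bound lip1].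
have b2 : bm `[- pi, pi] p2.
  by split; [exact: measurable_lipschitz C0 lip2|exact: lipschitz_bound lip2].
pose F (p : R -> R) x := \int[@lebesgue_measure R]_(u in `[- pi, pi]) (kint mu x u * (p u * sinh u)).
have bs p : bm `[- pi, pi] p -> bm `[- pi, pi] (fun u => p u * sinh u).
  move=> bp; apply: bm_mul => //; split.
    by apply: measurable_funTS; apply: continuous_measurable_fun; exact: continuous_sinh.
  exists (expR pi) => u; rewrite /= in_itv/= => Iu.
  by rewrite (le_trans (norm_sinh_le _))// cosh_le_expR// ler_norml.
have fE y : 0 < y -> f y = F p1 y +i* F p2 y.
  move=> y0; rewrite hf//.
  have c0 : 0 < Gamma (2 * (1 - mu)) * (2 * y) `^ (1 - mu).
    by rewrite mulr_gt0 ?powR_gt0 ?mulr_gt0// Gamma_gt0//; move: hmu; lra.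
  have key p : bm `[- pi, pi] p -> F p y = Gamma (2 * (1 - mu)) * (2 * y) `^ (1 - mu) *
      \int[@lebesgue_measure R]_(u in `[- pi, pi]) (expR (y * cosh u ^+ 2 / 2) *
        parcylD (2 * (mu - 1)) (Num.sqrt (2 * y) * cosh u) * (p u * sinh u)).
    move=> /bs bp; rewrite [in RHS](_ : (fun u => _) = fun u =>
        (Gamma (2 * (1 - mu)) * (2 * y) `^ (1 - mu))^-1 * (kint mu y u * (p u * sinh u))).
      rewrite (bm_RintegralZ (@mI R) (@fI R) _ (bm_kint hmu y0 bp)) -/(F p y).
      by rewrite (mulVKf (lt0r_neq0 c0)).
    apply/funext => u; rewrite -(kint_parcylD hmu u y0) [RHS]mulrA.
    by rewrite (mulKf (lt0r_neq0 c0)).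
  rewrite (key _ b1) (key _ b2) /Cintegral; move: (Gamma _ * _) => c.
  have -> (z t : R) : c%:C * (z +i* t) = (c * z) +i* (c * t).
    by apply/eqP; rewrite eq_complex ReMr ImMr/= !eqxx.
  congr ((_ * _) +i* (_ * _)); apply: eq_Rintegral => u _; rewrite ?ReMr ?ImMr; congr (_ * _);
    rewrite hphi /p1 /p2; case: (psi u) => z t /=; ring.
have aE n : (0 < n)%N -> a n = coefficient mu p1 n +i* coefficient mu p2 n.
  move=> n0; rewrite ha// /coefficient -!whittaker_coefficient// /Cintegral.
  have W x : 0 < x -> (expR (- (x / 2)))%:C * whittakerW mu (0 +i* (n%:R / 2)) x * f x * (x `^ (mu - 2))%:C =
      (expR (- (x / 2)) * Wfun mu n%:R x * x `^ (mu - 2))%:C * (F p1 x +i* F p2 x).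
    by move=> x0; rewrite whittakerW_Wfun// fE// !rmorphM/= mulrAC.
  congr (_ +i* _); apply: eq_Rintegral => x; rewrite inE => /hl_gt0 x0;
    by rewrite W// ?ReMr ?ImMr/= mulrAC.
move=> x x0.
pose K : R := 2 `^ (1 - 2 * mu + 1) * pi ^+ 2 / (Gamma (2 * (1 - mu)) * (2 * x) `^ (1 - mu)).
exists ((K * F p1 x) +i* (K * F p2 x)).
  rewrite (_ : (fun N => _) = fun N => \sum_(k < N) ((sinh (pi * k.+1%:R) * Psi mu k.+1 x)%:C *
     (coefficient mu p1 k.+1 +i* coefficient mu p2 k.+1))); last first.
    apply/funext => N; rewrite big_add1/= big_mkord; apply: eq_bigr => k _.
    by rewrite aE// -rmorphM.
  apply: cvg_complex.
  - rewrite [X in X @ _](_ : _ = fun N => \sum_(k < N)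
        (sinh (pi * k.+1%:R) * Psi mu k.+1 x * coefficient mu p1 k.+1)).
      exact: (real_series_cvg hmu C0 lip1 e1 x0).
    apply/funext => N; rewrite (@Re_sum R (fun k => (sinh (pi * k.+1%:R) * Psi mu k.+1 x)%:C *
      (coefficient mu p1 k.+1 +i* coefficient mu p2 k.+1))).
    by apply: eq_bigr => k _; rewrite ReMr.
  - rewrite [X in X @ _](_ : _ = fun N => \sum_(k < N)
        (sinh (pi * k.+1%:R) * Psi mu k.+1 x * coefficient mu p2 k.+1)).
      exact: (real_series_cvg hmu C0 lip2 e2 x0).
    apply/funext => N; rewrite (@Im_sum R (fun k => (sinh (pi * k.+1%:R) * Psi mu k.+1 x)%:C *
      (coefficient mu p1 k.+1 +i* coefficient mu p2 k.+1))).
    by apply: eq_bigr => k _; rewrite ImMr.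
rewrite fE//.
have G0 : 0 < Gamma (2 * (1 - mu)) by apply: Gamma_gt0; move: hmu; lra.
(* As 4^(1-mu) = 2^(2-2mu), the product reduces to (x/2)^(1-mu) 4^(1-mu) / (2x)^(1-mu) = 1. *)
have k1 : (x / 2) `^ (1 - mu) / pi ^+ 2 * Gamma (2 * (1 - mu)) * K = 1.
  rewrite /K; have -> : 2 * x = 4 * (x / 2) by field.
  rewrite [(4 * _) `^ _]powRM ?divr_ge0 ?(ltW x0)//.
  have -> : 4 `^ (1 - mu) = 2 `^ (1 - 2 * mu + 1).
    rewrite (_ : 4 = 2 `^ 2); last by rewrite powR_mulrn// expr2; ring.
    by rewrite -powRrM; congr (_ `^ _); ring.
  have h1 : 0 < (x / 2) `^ (1 - mu) by rewrite powR_gt0// divr_gt0.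
  have h2 : 0 < 2 `^ (1 - 2 * mu + 1) :> R by rewrite powR_gt0.
  have p0 := pi_gt0 R; move: h1 h2 G0 p0; move: (_ `^ _) (_ `^ _) (Gamma _) (pi : R) => y z g p y0 z0 g0 p0.
  by field; rewrite !gt_eqF.
move: ((x / 2) `^ (1 - mu) / pi ^+ 2 * _) (F p1 x) (F p2 x) K k1 => c z t k k1.
by apply/eqP; rewrite eq_complex ReMr ImMr/= !mulrA k1 !mul1r !eqxx.
Qed.
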